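(* For $n\ge 1$ let $[P_n]$ denote the set of all graphs (up to isomorphism) having the same domination polynomial as the path $P_n$. For $i\ge 3$ let $F_i$ denote the graph consisting of a cycle $C_i$ with a pendant edge (that is, one vertex of the cycle is joined to one new vertex of degree $1$), and let $H_i$ denote the graph formed from the disjoint union of $F_i$ and $K_2$ by adding an edge between the stem of $F_i$ and a vertex of $K_2$. Then \begin{itemize} \item $[P_n]=\{P_n\}$ if $n\le 3$; \item $[P_4]=\{P_4,\,2P_2\}$, where $2P_2$ is the disjoint union of two copies of $P_2$; \item $[P_n]=\{P_n,\ \widetilde{P_n},\ F_{n-3}\cup K_2,\ H_{n-3}\}$ for $n=7,8$; \item $[P_n]=\{P_n,\ \widetilde{P_n}\}$ otherwise (that is, for $n=5,6$ and all $n\ge 9$). \end{itemize}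
   Context: Graphs are finite and simple. A set $S\subseteq V(G)$ is dominating if every vertex of $G$ is in $S$ or adjacent to a vertex of $S$. The domination polynomial of $G$ is $D(G,x)=\sum_i d(G,i)x^i$, where $d(G,i)$ is the number of dominating sets of $G$ of cardinality $i$. Graphs $G,H$ are $\mathcal D$-equivalent if $D(G,x)=D(H,x)$, and $[G]$ is the set of all graphs $\mathcal D$-equivalent to $G$, considered up to isomorphism. $P_n$ and $C_n$ are the path and cycle on $n$ vertices; $\cup$ between graphs means disjoint union. A leaf is a vertex of degree $1$; a stem is a vertex adjacent to a leaf. $\widetilde{P_n}$ (for $n\ge 5$) is the graph obtained from $P_n$ by adding an edge between its two stems. *)

(* Defs.v *)
From HB Require Import structures.
From mathcomp Require Import all_boot all_algebra.
Set Implicit Arguments.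
Unset Strict Implicit.
Unset Printing Implicit Defensive.
Import GRing.Theory.
Local Open Scope ring_scope.

Record sgraph := SGraph {
  vertex :> finType;
  adj : rel vertex;
  adj_sym : symmetric adj;
  adj_irr : irreflexive adj }.

Definition isomorphic (G H : sgraph) : Prop :=
  exists2 f : G -> H, bijective f & forall x y, adj (f x) (f y) = adj x y.

Section Domination.
Variable G : sgraph.

Definition dominating (S : {set G}) : bool :=
  [forall v, (v \in S) || [exists u in S, adj v u]].

Definition num_dom (i : nat) : nat :=
  #|[set S : {set G} | dominating S & #|S| == i]|.

Definition dom_poly : {poly int} := \poly_(i < #|G|.+1) (num_dom i)%:R.

Definition degree (v : G) : nat := #|[set u | adj v u]|.
Definition leaf (v : G) : bool := degree v == 1%N.
Definition stem (v : G) : bool := [exists u, adj v u && leaf u].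

(* [G] together with every edge between two distinct vertices [x], [y] such
   that [p x] and [q y]; if [p] and [q] each hold at a single vertex, or both
   hold at exactly the same two vertices, this joins just one pair. *)
Section AddEdges.
Variables p q : pred G.

Definition add_edges_adj : rel G :=
  fun x y => adj x y || (x != y) && (p x && q y || q x && p y).

Lemma add_edges_sym : symmetric add_edges_adj.
Proof.
move=> x y; rewrite /add_edges_adj adj_sym eq_sym.
by case: (p x); case: (p y); case: (q x); case: (q y).
Qed.

Lemma add_edges_irr : irreflexive add_edges_adj.
Proof. by move=> x; rewrite /add_edges_adj adj_irr eqxx. Qed.

Definition add_edges : sgraph := SGraph add_edges_sym add_edges_irr.
End AddEdges.
End Domination.

Definition D_equiv (G H : sgraph) : Prop := dom_poly G = dom_poly H.

Section DisjointUnion.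
Variables G H : sgraph.

Definition dunion_adj : rel (G + H)%type := fun x y =>
  match x, y with
  | inl a, inl b => adj a b
  | inr a, inr b => adj a b
  | _, _ => false
  end.

Lemma dunion_sym : symmetric dunion_adj.
Proof. by move=> [a|a] [b|b] //=; rewrite adj_sym. Qed.

Lemma dunion_irr : irreflexive dunion_adj.
Proof. by move=> [a|a] /=; rewrite adj_irr. Qed.

Definition dunion : sgraph := SGraph dunion_sym dunion_irr.
End DisjointUnion.

Section Families.
Variable n : nat.

Definition complete_adj : rel 'I_n := fun x y => x != y.
Lemma complete_sym : symmetric complete_adj.
Proof. by move=> x y; rewrite /complete_adj eq_sym. Qed.
Lemma complete_irr : irreflexive complete_adj.
Proof. by move=> x; rewrite /complete_adj eqxx. Qed.
Definition complete_graph : sgraph := SGraph complete_sym complete_irr.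

Definition path_adj : rel 'I_n :=
  fun x y => (x.+1 == y :> nat) || (y.+1 == x :> nat).
Lemma path_sym : symmetric path_adj.
Proof. by move=> x y; rewrite /path_adj orbC. Qed.
Lemma path_irr : irreflexive path_adj.
Proof. by move=> x; rewrite /path_adj orbb gtn_eqF. Qed.
Definition path_graph : sgraph := SGraph path_sym path_irr.

(* [ordS] is the cyclic successor; this is the cycle C_n only for 3 <= n. *)
Definition cycle_adj : rel 'I_n :=
  fun x y => (x != y) && ((ordS x == y) || (ordS y == x)).
Lemma cycle_sym : symmetric cycle_adj.
Proof. by move=> x y; rewrite /cycle_adj eq_sym orbC. Qed.
Lemma cycle_irr : irreflexive cycle_adj.
Proof. by move=> x; rewrite /cycle_adj eqxx. Qed.
Definition cycle_graph : sgraph := SGraph cycle_sym cycle_irr.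
End Families.

(* For 5 <= n, the path has exactly two stems. *)
Definition tilde_path (n : nat) : sgraph :=
  add_edges (@stem (path_graph n)) (@stem (path_graph n)).

(* The cycle vertex 0 is joined to the single vertex of K_1. *)
Definition F_graph (n : nat) : sgraph :=
  @add_edges (dunion (cycle_graph n) (complete_graph 1))
    (fun v => if v is inl x then x == 0%N :> nat else false)
    (fun v => if v is inr _ then true else false).

(* For 3 <= n, [F_graph n] has exactly one stem; it is joined to the vertex 0
   of K_2. *)
Definition H_graph (n : nat) : sgraph :=
  @add_edges (dunion (F_graph n) (complete_graph 2))
    (fun v => if v is inl x then stem x else false)
    (fun v => if v is inr y then y == 0%N :> nat else false).

(* Main.v *)
(* Write E(G) for the reversed domination polynomial, the generating function
   of the complements of dominating sets: the sets containing no closed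
   neighbourhood.  For paths, cycles and cycles with a pendant edge, E counts
   binary words without three consecutive ones, and is expressed through the
   sequence h(n+3) = h(n+2) + X h(n+1) + X^2 h(n).

   If E(G) = E(P_n), the coefficients of X, X^2 and X^3 show that G has two
   leaf-stem pairs and that every other vertex has degree 2, with distinct
   closed neighbourhoods.  Evaluating at -1 excludes components C_4, and the
   coefficient of X^4 then bounds the number of edges from the stems to the
   other vertices by 2.  Deleting an edge between the stems, which does not
   change E, leaves P_m or the union of F_i and K_2, together with disjoint
   cycles.  Finally p_m q_c, for the polynomials p of paths and q of cycles,
   differs from p_(m+c) near X^(min(m,c)); comparing the two lowest terms of
   the difference rules out all cycles, and all F_i except i = 4, 5. *)
Require Import Defs.
From mathcomp Require Import all_boot all_algebra.
From mathcomp Require Import zify ring.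
Set Implicit Arguments.
Unset Strict Implicit.
Unset Printing Implicit Defensive.

(** * Complements of dominating sets *)

Section CoDominating.
Import GRing.Theory.
Local Open Scope ring_scope.

(** For complements the obstructions are the closed neighbourhoods themselves: low coefficients
    count small sets containing one, and a stem, whose closed neighbourhood contains that of its
    leaf, imposes no condition of its own. The main obstacle is to show that a product of p_m with
    several q_c is never a path polynomial. Both sides are multiplied by h_N with N large: q_c h_N
    equals h_(c+N) up to a multiple of X^c, so a product of cycles collapses into a single h plus
    visible traces of its shortest cycles. All error terms are 2 by 2 determinants in h, whose
    leading coefficients repeat 1, 0, -1. The leading terms alone can cancel: for m divisible by 3
    the path contributes nothing at X^m, and for m = 2 modulo 3 one cycle of length m offsets it.
    The next coefficient, which drifts linearly with the index, then decides. The exceptional i = 4,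
    5 arise because h, continued backwards by its recurrence, vanishes at -1 and -2. *)

Definition cnbr (G : sgraph) (v : G) : {set G} := [set u | (u == v) || adj v u].

Lemma cnbrE (G : sgraph) (u v : G) : (u \in cnbr v) = (u == v) || adj v u.
Proof. by rewrite inE. Qed.

Lemma cnbr_sym (G : sgraph) (u v : G) : (u \in cnbr v) = (v \in cnbr u).
Proof. by rewrite !inE eq_sym adj_sym. Qed.

Lemma cnbr_refl (G : sgraph) (v : G) : v \in cnbr v.
Proof. by rewrite cnbrE eqxx. Qed.

Lemma card_cnbr (G : sgraph) (v : G) : #|cnbr v| = (degree v).+1.
Proof.
rewrite (cardsD1 v) cnbr_refl add1n; congr _.+1; apply: eq_card => u.
by rewrite !inE; case: eqP => [->|] //=; rewrite adj_irr.
Qed.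

Definition codominating (G : sgraph) (T : {set G}) : bool :=
  [forall v : G, ~~ (cnbr v \subset T)].

Lemma codominatingE (G : sgraph) (T : {set G}) :
  codominating T = dominating (~: T).
Proof.
apply: eq_forallb => v; apply/subsetPn/orP => [[u]|].
  rewrite cnbrE => /orP[/eqP-> vT|vu uT]; first by left; rewrite inE.
  by right; apply/existsP; exists u; rewrite inE uT.
case=> [|/existsP[u /andP[]]]; rewrite inE => vT; first by exists v; rewrite ?cnbr_refl.
by move=> vu; exists u; rewrite // cnbrE vu orbT.
Qed.

Definition codom_poly (G : sgraph) : {poly int} :=
  \sum_(T : {set G} | codominating T) 'X^#|T|.

Definition num_codom (G : sgraph) (k : nat) : nat :=
  #|[set T : {set G} | codominating T & #|T| == k]|.

Lemma coef_codom_poly (G : sgraph) (k : nat) :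
  (codom_poly G)`_k = (num_codom G k)%:R.
Proof.
rewrite /codom_poly coef_sum /num_codom -sum1_card natr_sum.
rewrite [RHS](eq_bigl (fun T : {set G} => codominating T && (#|T| == k))); last first.
  by move=> T; rewrite inE.
rewrite big_mkcondr /=; apply: eq_bigr => T _; rewrite coefXn eq_sym.
by case: eqP.
Qed.

Lemma num_codom_dom (G : sgraph) (k : nat) : (k <= #|G|)%N ->
  num_codom G k = num_dom G (#|G| - k).
Proof.
move=> kG; rewrite /num_codom /num_dom -(card_imset _ (@setC_inj G)).
apply: eq_card => S; rewrite inE.
have -> : (S \in [set ~: T | T in [set T : {set G} | codominating T & #|T| == k]])
   = (~: S \in [set T : {set G} | codominating T & #|T| == k]).
  apply/imsetP/idP => [[T TI ->]|SI]; first by rewrite setCK.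
  by exists (~: S); rewrite ?setCK.
rewrite inE codominatingE setCK; congr (_ && _).
have := cardsC S; move: (#|S|) (#|~: S|) => a b ab; apply/eqP/eqP; lia.
Qed.

Lemma num_codom_big (G : sgraph) (k : nat) : (#|G| < k)%N -> num_codom G k = 0%N.
Proof.
move=> kG; apply: eq_card0 => T; rewrite !inE; apply/negP=> /andP[_ /eqP Tk].
by have := max_card (mem T); rewrite Tk leqNgt kG.
Qed.

Lemma num_dom_full (G : sgraph) : num_dom G #|G| = 1%N.
Proof.
rewrite -(subn0 #|G|) -num_codom_dom // /num_codom.
rewrite (_ : [set T | _ & _] = [set set0]) ?cards1 //; apply/setP => T.
rewrite !inE cards_eq0; case: eqP => [->|]; rewrite ?andbF // andbT.
apply/forallP => v; apply/subsetPn; exists v; rewrite ?inE ?cnbr_refl ?eqxx //.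
Qed.

Lemma size_dom_poly (G : sgraph) : size (dom_poly G) = #|G|.+1.
Proof. by rewrite /dom_poly size_poly_eq //= num_dom_full oner_eq0. Qed.

(** The full vertex set dominates, so the degree of [dom_poly] is the order of the graph; once the
    orders agree, reversing the coefficients loses nothing. The order has to be kept separately,
    since [codom_poly] is 1 both for the empty graph and for one vertex. *)
Lemma D_equivP (G H : sgraph) :
  D_equiv G H <-> #|G| = #|H| /\ codom_poly G = codom_poly H.
Proof.
have coefD (K : sgraph) i : (i <= #|K|)%N -> (dom_poly K)`_i = (num_dom K i)%:R.
  by move=> iK; rewrite /dom_poly coef_poly ltnS iK.
split=> [GH|[cGH eGH]].
  have cGH : #|G| = #|H|.
    by apply: succn_inj; rewrite -!size_dom_poly; congr (size (polyseq _)).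
  split=> //; apply/polyP => k; rewrite !coef_codom_poly.
  case: (leqP k #|G|) => kG; last by rewrite !num_codom_big -?cGH.
  by rewrite !num_codom_dom -?cGH // -!coefD ?cGH ?leq_subr // GH.
apply/polyP => i; case: (leqP i #|G|) => iG; last first.
  by rewrite !nth_default ?size_dom_poly -?cGH.
rewrite !coefD -?cGH // -(subKn iG) [in X in _ = X]cGH.
rewrite -!num_codom_dom ?leq_subr ?cGH ?leq_subr //.
by rewrite -!coef_codom_poly eGH.
Qed.

Lemma isomorphic_refl (G : sgraph) : isomorphic G G.
Proof. by exists id => //; exists id. Qed.

Lemma isomorphic_sym (G H : sgraph) : isomorphic G H -> isomorphic H G.
Proof.
case=> f [g fK gK] fadj; exists g; first by exists f.
by move=> x y; rewrite -fadj !gK.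
Qed.

Lemma isomorphic_trans (G H K : sgraph) :
  isomorphic G H -> isomorphic H K -> isomorphic G K.
Proof.
case=> f bf fadj [g bg gadj]; exists (g \o f); first exact: bij_comp.
by move=> x y /=; rewrite gadj fadj.
Qed.

Lemma isomorphic_card (G H : sgraph) : isomorphic G H -> #|G| = #|H|.
Proof. by case=> f /bij_eq_card. Qed.

Lemma isomorphic_codom_poly (G H : sgraph) :
  isomorphic G H -> codom_poly G = codom_poly H.
Proof.
case=> f [g fK gK] fadj; rewrite /codom_poly.
have fI := can_inj fK.
have cn v : cnbr (f v) = f @: cnbr v.
  apply/setP => u; rewrite -[u]gK mem_imset // !cnbrE fadj.
  by rewrite (inj_eq fI).
rewrite [RHS](reindex (fun T : {set G} => f @: T)) /=; last first.
  by exists (fun T : {set H} => g @: T) => T _;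
     rewrite -imset_comp -[RHS]imset_id; apply: eq_imset => x /=.
apply: eq_big => [T|T _]; last by rewrite card_imset.
have sf v : (cnbr (f v) \subset f @: T) = (cnbr v \subset T).
  rewrite cn; apply/idP/idP => [/subsetP vT|]; last exact: imsetS.
  by apply/subsetP => u uv; rewrite -(mem_imset _ _ fI) vT ?imset_f.
apply/forallP/forallP => nb v; last by rewrite -sf.
by rewrite -[v]gK sf.
Qed.

Lemma isomorphic_dunion (G G' H H' : sgraph) :
  isomorphic G G' -> isomorphic H H' -> isomorphic (dunion G H) (dunion G' H').
Proof.
case=> f [f' fK f'K] fadj [g [g' gK g'K] gadj].
exists (fun x => match x with inl a => inl (f a) | inr b => inr (g b) end).
  exists (fun x => match x with inl a => inl (f' a) | inr b => inr (g' b) end).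
    by move=> [a|a] /=; rewrite ?fK ?gK.
  by move=> [a|a] /=; rewrite ?f'K ?g'K.
by move=> [a|a] [b|b] //=; rewrite ?fadj ?gadj.
Qed.

Lemma codom_poly_dunion (G H : sgraph) :
  codom_poly (dunion G H) = codom_poly G * codom_poly H.
Proof.
rewrite /codom_poly big_distrlr /= pair_big /=.
pose k (T : {set dunion G H}) : {set G} * {set H} := (inl @^-1: T, inr @^-1: T).
rewrite [RHS](reindex k) /=; last first.
  exists (fun p : {set G} * {set H} =>
    [set x : dunion G H | match x with inl a => a \in p.1 | inr b => b \in p.2 end]).
    by move=> T _; apply/setP => -[a|b]; rewrite !inE.
  by move=> [A B] _; congr pair; apply/setP => a; rewrite !inE.
apply: eq_big => [T|T _]; last first.
  by rewrite -exprD -!sum1_card [in LHS]big_mkcond big_sumType /= -!big_mkcond /=; congr ('X ^+ (_ + _)); apply: eq_bigl => a; rewrite inE.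
apply/forallP/andP => [nb|[/forallP nbG /forallP nbH] [v|v]].
- split; apply/forallP => v.
    have := nb (inl v); apply: contra => /subsetP vT; apply/subsetP => -[u|u]; rewrite inE ?orbF //.
    by move=> uv; have := vT u; rewrite !inE; apply.
  have := nb (inr v); apply: contra => /subsetP vT; apply/subsetP => -[u|u]; rewrite inE ?orbF //.
  by move=> uv; have := vT u; rewrite !inE; apply.
- have := nbG v; apply: contra => /subsetP vT; apply/subsetP => u uv.
  by rewrite inE; apply: vT; move: uv; rewrite !inE.
have := nbH v; apply: contra => /subsetP vT; apply/subsetP => u uv.
by rewrite inE; apply: vT; move: uv; rewrite !inE.
Qed.

(** Only endpoints of new edges get larger closed neighbourhoods. Each of them has a leaf that is no
    endpoint, and the closed neighbourhood of this leaf lies in that of its stem before and after,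
    so the condition at the stem is implied by the one at the leaf. *)
Lemma codom_poly_stem_edges (G : sgraph) (p q : pred G) :
  (forall x, p x || q x ->
     exists l : G, [/\ leaf l, adj x l & ~~ (p l || q l)]) ->
  codom_poly (add_edges p q) = codom_poly G.
Proof.
move=> pq; apply: eq_bigl => T.
have same (v : G) : ~~ (p v || q v) -> cnbr (v : add_edges p q) = cnbr v.
  rewrite negb_or => /andP[/negPf pv /negPf qv]; apply/setP => u.
  by rewrite !inE /= /add_edges_adj pv qv !andbF orbF.
have sub (v : G) : cnbr v \subset cnbr (v : add_edges p q).
  by apply/subsetP => u; rewrite !inE /= /add_edges_adj => /orP[->|->]; rewrite ?orbT.
apply/forallP/forallP => nb v; last first.
  by apply: contra (nb v); apply: subset_trans.
have [pqv|npqv] := boolP (p v || q v); last by rewrite -(same v npqv).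
have [l [/eqP dl vl npql]] := pq v pqv.
apply: contra (nb l) => vT; rewrite same //; apply: subset_trans vT.
have <- : [set l; v] = cnbr l.
  apply/eqP; rewrite eqEcard card_cnbr dl cards2.
  have -> /= : l != v by apply: contraTneq vl => ->; rewrite adj_irr.
  rewrite andbT; apply/subsetP => u; rewrite !inE => /orP[->|/eqP->] //.
  by rewrite adj_sym vl orbT.
by apply/subsetP => u; rewrite !inE => /orP[] /eqP->; rewrite ?eqxx ?vl ?orbT.
Qed.
End CoDominating.

(** * Paths, cycles and pendant cycles as word counts *)

Section Words.
Import GRing.Theory.
Local Open Scope ring_scope.

(** Generating function, by the number of ones, of the words of length n satisfying B. The letters
    already read are stored in the predicate, so that splitting on the first letter holds by
    computation. *)
Fixpoint wsum (n : nat) (B : pred bitseq) : {poly int} :=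
  if n is m.+1 then
    wsum m (fun w => B (false :: w)) + 'X * wsum m (fun w => B (true :: w))
  else (B [::])%:R.

Lemma eq_wsum (n : nat) (B C : pred bitseq) :
  (forall w, size w = n -> B w = C w) -> wsum n B = wsum n C.
Proof.
elim: n B C => [|n IHn] B C BC /=; first by rewrite BC.
by congr (_ + _ * _); apply: IHn => w wn; rewrite BC //= wn.
Qed.

Lemma wsum0 (n : nat) (B : pred bitseq) : (forall w, ~~ B w) -> wsum n B = 0.
Proof.
elim: n B => [|n IHn] B nB /=; first by rewrite (negPf (nB _)).
by rewrite !IHn // mulr0 addr0.
Qed.

Lemma wsumS (n : nat) (B : pred bitseq) :
  wsum n.+1 B = wsum n (fun w => B (false :: w))
              + 'X * wsum n (fun w => B (true :: w)).
Proof. by []. Qed.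

Lemma wsum_rcons (n : nat) (B : pred bitseq) :
  wsum n.+1 B = wsum n (fun w => B (rcons w false))
              + 'X * wsum n (fun w => B (rcons w true)).
Proof.
elim: n B => [//|n IHn] B.
rewrite [LHS]wsumS (IHn (fun w => B (false :: w))) (IHn (fun w => B (true :: w))).
rewrite [X in _ = X + _]wsumS [X in _ = _ + 'X * X]wsumS /=.
by ring.
Qed.

(** A subset is read as its characteristic word along [s]; the two values of the first letter
    correspond to A and [x |: A]. *)
Lemma sum_subset_wsum (T : finType) (s : seq T) (B : pred bitseq) : uniq s ->
  \sum_(A : {set T} | (A \subset [set x in s]) && B (map (mem A) s)) 'X^#|A|
  = wsum (size s) B.
Proof.
elim: s B => [|x s IHs] B /=.
  move=> _; have [B0|nB0] := boolP (B [::]).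
    rewrite (big_pred1 set0) ?cards0 ?expr0 // => A.
    by rewrite andbT (_ : [set x in [::]] = set0) ?subset0 //; apply/setP => y; rewrite !inE.
  by rewrite big_pred0 // => A; rewrite andbF.
case/andP=> xs us; rewrite -!IHs // addrC (bigID (fun A : {set T} => x \in A)) /=.
congr (_ + _).
- rewrite big_distrr /=.
  rewrite (reindex_onto (fun A : {set T} => x |: A) (fun A => A :\ x)) /=; last first.
    by move=> A /andP[_ xA]; rewrite setD1K.
  apply: eq_big => [A|A /andP[_ /eqP eA]].
    rewrite !inE eqxx /=.
    have mapA : map (mem (x |: A)) s = map (mem A) s.
      apply/eq_in_map => y ys; rewrite /= !inE; case: eqP => // yx.
      by rewrite -yx ys in xs.
    rewrite mapA !andbT.
    have [xA|xA] := boolP (x \in A).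
      rewrite [in RHS](_ : A \subset _ = false) ?andbF /=; last first.
        by apply/negbTE/subsetPn; exists x; rewrite // inE.
      by apply/negbTE/negP => /andP[_ /eqP eA]; move: xA; rewrite -eA !inE eqxx.
    rewrite setU1K // eqxx andbT; congr (_ && _).
    apply/subsetP/subsetP => sA y yA.
      have := sA y; rewrite !inE yA orbT => /(_ isT) /orP[/eqP yx|//].
      by rewrite -yx yA in xA.
    move: yA; rewrite !inE => /orP[->//|yA]; have := sA y yA.
    by rewrite inE => ->; rewrite orbT.
  have xA : x \notin A by rewrite -eA !inE eqxx.
  by rewrite cardsU1 xA exprS.
- apply: eq_bigl => A; have [xA|xA] := boolP (x \in A).
    rewrite andbF; apply/esym/negbTE; rewrite negb_and; apply/orP; left.
    by apply/subsetPn; exists x; rewrite // inE.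
  rewrite andbT; congr (_ && _); apply/subsetP/subsetP => sA y yA.
    have := sA y yA; rewrite !inE => /orP[/eqP yx|//].
    by rewrite -yx yA in xA.
  by have := sA y yA; rewrite !inE => ->; rewrite orbT.
Qed.

Lemma codom_poly_wsum (G : sgraph) (n : nat) (s : seq G) (B : pred bitseq) :
  size s = n -> uniq s -> (forall x, x \in s) ->
  (forall T : {set G}, codominating T = B (map (mem T) s)) ->
  codom_poly G = wsum n B.
Proof.
move=> <- us sT TB; rewrite -sum_subset_wsum //; apply: eq_bigl => T; rewrite TB.
by rewrite (_ : T \subset _) //; apply/subsetP => x _; rewrite inE.
Qed.

Fixpoint no111 (w : bitseq) : bool :=
  if w is a :: w' then
    ~~ [&& a, nth false w' 0 & nth false w' 1] && no111 w'
  else true.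

Lemma no111P (w : bitseq) :
  reflect (forall i, (i.+2 < size w)%N ->
             ~~ [&& nth false w i, nth false w i.+1 & nth false w i.+2])
          (no111 w).
Proof.
elim: w => [|a w IHw]; first by constructor.
rewrite /=; apply: (iffP andP) => [[na /IHw nw] [|i] //= iw|nw]; first exact: nw.
split; last by apply/IHw => i iw; apply: (nw i.+1).
have := nw 0%N; case: (w) => [|b [|c u]] /=; rewrite ?andbF //.
by apply.
Qed.

Lemma no111_cat0 (u v : bitseq) : no111 (u ++ false :: v) = no111 u && no111 v.
Proof.
elim: u => [|a u IHu] //=; rewrite IHu andbA; congr (_ && _ && _).
by case: u {IHu} => [|b [|c u]] //=; rewrite ?andbF.
Qed.

(** Tribonacci polynomials, with generating function 1/(1 - t - X t^2 - X^2 t^3). [h n.+1]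
    enumerates the words of length n without 111, and the value 1 at 0 is the one the recurrence
    asks for below them. *)
Fixpoint h (n : nat) : {poly int} :=
  match n with
  | 0 => 1
  | 1 => 1
  | 2 => 1 + 'X
  | (((k.+1) as k1).+1 as k2).+1 => h k2 + 'X * h k1 + 'X^2 * h k
  end.

Lemma hS (n : nat) : h n.+3 = h n.+2 + 'X * h n.+1 + 'X^2 * h n.
Proof. by []. Qed.

Lemma rec3_unique (u v : nat -> {poly int}) :
  (forall n, u n.+3 = u n.+2 + 'X * u n.+1 + 'X^2 * u n) ->
  (forall n, v n.+3 = v n.+2 + 'X * v n.+1 + 'X^2 * v n) ->
  u 0%N = v 0%N -> u 1%N = v 1%N -> u 2%N = v 2%N -> u =1 v.
Proof.
move=> uS vS e0 e1 e2 n.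
suff [-> //] : [/\ u n = v n, u n.+1 = v n.+1 & u n.+2 = v n.+2].
by elim: n => [//|n [E0 E1 E2]]; split=> //; rewrite uS vS E0 E1 E2.
Qed.

Section Suffix.
Variable v : bitseq.
(** The three sums differ in the number of ones standing before the free word. After two ones the
    next letter must be 0, which closes the system into the recurrence of [h] for every suffix
    [v]. *)
Let a n := wsum n (fun w => no111 (w ++ v)).
Let b n := wsum n (fun w => no111 (true :: w ++ v)).
Let c n := wsum n (fun w => no111 (true :: true :: w ++ v)).

Lemma wsum_no111_11 (n : nat) : c n.+1 = a n.
Proof. by rewrite /c wsumS [X in _ + 'X * X]wsum0 // mulr0 addr0. Qed.

Lemma wsum_no111_1 (n : nat) : b n.+2 = a n.+1 + 'X * a n.
Proof. by rewrite -(wsum_no111_11 n). Qed.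

Lemma wsum_no111S (n : nat) : a n.+3 = a n.+2 + 'X * a n.+1 + 'X^2 * a n.
Proof.
have aS k : a k.+1 = a k + 'X * b k by [].
by rewrite aS wsum_no111_1 mulrDr addrA mulrA -expr2.
Qed.
End Suffix.

Lemma wsum_no111 (n : nat) : wsum n no111 = h n.+1.
Proof.
have -> : wsum n no111 = wsum n (fun w => no111 (w ++ [::])).
  by apply: eq_wsum => w _; rewrite cats0.
by apply: (rec3_unique (wsum_no111S [::]) (v := fun n => h n.+1)) => //=; ring.
Qed.

Lemma wsum_no111_suffix1 (n : nat) :
  wsum n.+1 (fun w => no111 (w ++ [:: true])) = h n.+1 + 'X * h n.
Proof.
apply: (rec3_unique (u := fun n => wsum n.+1 (fun w => no111 (w ++ [:: true])))
                    (v := fun n => h n.+1 + 'X * h n)) => [k|k|||].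
- exact: wsum_no111S.
- by rewrite !hS; ring.
- by rewrite /=; ring.
- by rewrite /=; ring.
- by rewrite /=; ring.
Qed.

Lemma wsum_no111_suffix11 (n : nat) :
  wsum n (fun w => no111 (w ++ [:: true; true])) = h n.
Proof.
apply: (rec3_unique (wsum_no111S [:: true; true]) (v := h)) => //=; ring.
Qed.

Lemma wsum_no111_1_1 (n : nat) :
  wsum n.+2 (fun w => no111 (true :: w ++ [:: true])) = h n.+2 + 'X * h n.
Proof.
apply: (rec3_unique
   (u := fun n => wsum n.+2 (fun w => no111 (true :: w ++ [:: true])))
   (v := fun n => h n.+2 + 'X * h n)) => [k|k|||].
- by rewrite !wsum_no111_1 !wsum_no111S; ring.
- by rewrite !hS; ring.
- by rewrite /=; ring.
- by rewrite /=; ring.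
- by rewrite /=; ring.
Qed.

Lemma nth_map_mem_enum_ord (n : nat) (T : {set 'I_n.+1}) (k : nat) :
  (k < n.+1)%N -> nth false (map (mem T) (enum 'I_n.+1)) k = (inord k \in T).
Proof.
move=> kn; rewrite (nth_map ord0) ?size_enum_ord //=; congr (_ \in T).
by apply: val_inj; rewrite /= nth_enum_ord // inordK.
Qed.

(** Two virtual vertices, always in the set, are placed at the ends. The closed neighbourhood of
    every vertex, leaves included, then becomes a window of three consecutive letters. *)
Lemma codom_poly_path (n : nat) :
  codom_poly (path_graph n.+2) = h n.+2 + 'X * h n.
Proof.
rewrite -wsum_no111_1_1.
apply: (@codom_poly_wsum (path_graph n.+2) _ _ _ (size_enum_ord n.+2)) => [||T]; first exact: enum_uniq.
  by move=> x; rewrite mem_enum.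
rewrite cats1; have := @nth_map_mem_enum_ord n.+1 T.
have : size (map (mem T) (enum 'I_n.+2)) = n.+2 by rewrite size_map size_enum_ord.
move: (map _ _) => W sW nW.
apply/forallP/no111P => [gT i|nw v].
  rewrite /= size_rcons sW !ltnS => iN.
  have := gT (inord i); apply: contra => /and3P[].
  rewrite !nth_rcons !sW => W0; rewrite ltnS iN nW // => W1 W2.
  apply/subsetP => u; rewrite cnbrE /= /path_adj inordK // => /or3P[/eqP->|/eqP iu|/eqP ui] //.
    by move: W2; rewrite iu ltn_ord nW // inord_val.
  by move: W0; rewrite -ui /= nth_rcons sW ltn_ord nW // inord_val.
have := nw v; rewrite /= size_rcons sW !ltnS => /(_ (ltn_ord v)).
apply: contra => /subsetP sT; have vT (u : 'I_n.+2) : (u == v) || path_adj v u -> u \in T.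
  by move=> uv; apply: sT; rewrite inE.
apply/and3P; split.
- case E: (v : nat) => [//|k] /=; have kn : (k < n.+2)%N by have := ltn_ord v; lia.
  rewrite nth_rcons sW kn nW //; apply: vT.
  by rewrite /path_adj inordK // E eqxx !orbT.
- rewrite nth_rcons sW ltn_ord nW // inord_val; apply: vT.
  by rewrite eqxx.
rewrite nth_rcons sW; case: ltngtP => // vn; last by have := ltn_ord v; lia.
by rewrite nW //; apply: vT; rewrite /path_adj inordK // eqxx !orbT.
Qed.

(** Copying the last letter to the front and the first letter to the back opens the cycle: cyclic
    windows of length three become windows of a linear word. *)
Lemma cycle_codominating (n : nat) (T : {set 'I_n.+3}) :
  let W := map (mem T) (enum 'I_n.+3) in
  @codominating (cycle_graph n.+3) T
  = no111 (last false W :: rcons W (head false W)).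
Proof.
move=> W; have nW k : (k < n.+3)%N -> nth false W k = (inord k \in T).
  exact: nth_map_mem_enum_ord.
have sW : size W = n.+3 by rewrite size_map size_enum_ord.
rewrite -nth_last -nth0 sW !nW // [n.+3.-1]/=; clearbody W.
have bW i : (i < n.+3)%N ->
    [&& nth false ((inord n.+2 \in T) :: rcons W (inord 0 \in T)) i,
        nth false (rcons W (inord 0 \in T)) i
      & nth false (rcons W (inord 0 \in T)) i.+1]
    = [&& inord (if i is k.+1 then k else n.+2) \in T, inord i \in T
        & inord (if i == n.+2 then 0%N else i.+1) \in T].
  move=> iN; congr [&& _, _ & _].
  - by case: i iN => [|k] iN //=; rewrite nth_rcons sW nW ltnW // (ltnW iN).
  - by rewrite nth_rcons sW iN nW.
  rewrite nth_rcons sW ltnS eqSS; have [->|ne] := eqVneq i n.+2.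
    by rewrite ltnn.
  by have iN2 : (i < n.+2)%N by [lia]; rewrite iN2 nW.
apply/forallP/no111P => [gT i|nw v].
  rewrite [size _]/= size_rcons sW !ltnS => iN.
  rewrite [nth false (_ :: _) i.+1]/= [nth false (_ :: _) i.+2]/= bW //.
  have := gT (inord i); apply: contra => /and3P[W0 W1 W2].
  apply/subsetP => u; rewrite cnbrE /= /cycle_adj.
  case/orP => [/eqP->//|/andP[_ /orP[/eqP<-|/eqP iu]]].
    rewrite (_ : ordS _ = inord (if i == n.+2 then 0%N else i.+1)) //.
    apply: val_inj; rewrite /= !inordK //; last by case: eqP; lia.
    case: eqP => [->|]; first by rewrite modnn.
    by move=> iN2; rewrite modn_small //; lia.
  rewrite (_ : u = inord (if i is k.+1 then k else n.+2)) //.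
  have := congr1 val iu; rewrite /= inordK // => E.
  apply: val_inj; rewrite /= inordK; last by case: (i) iN => //; lia.
  have [un|un] := eqVneq (u : nat) n.+2; first by rewrite -E un modnn.
  by rewrite -E modn_small //; have := ltn_ord u; lia.
have := nw v; rewrite [size _]/= size_rcons sW !ltnS => /(_ (ltn_ord v)).
apply: contra => /subsetP sT; have vT (u : 'I_n.+3) : (u == v) || cycle_adj v u -> u \in T.
  by move=> uv; apply: sT; rewrite inE.
rewrite [nth false (_ :: _) v.+1]/= [nth false (_ :: _) v.+2]/= bW //.
apply/and3P; split; apply: vT; rewrite /cycle_adj.
- apply/orP; right; apply/andP; split.
    apply/eqP => /(congr1 val) /=; case: (v : nat) (ltn_ord v) => [|k] kv.
      by rewrite inordK.
    by rewrite inordK; lia.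
  apply/orP; right; apply/eqP/val_inj => /=.
  case: (v : nat) (ltn_ord v) => [|k] kv; first by rewrite inordK // modnn.
  by rewrite inordK 1?modn_small //; lia.
- by rewrite inord_val eqxx.
apply/orP; right; apply/andP; split.
  apply/eqP => /(congr1 val) /=; rewrite inordK; case: eqP; have := ltn_ord v; lia.
apply/orP; left; apply/eqP/val_inj => /=.
have [->|vn] := eqVneq (v : nat) n.+2; first by rewrite inordK // modnn.
by rewrite inordK ?modn_small //; have := ltn_ord v; lia.
Qed.

Lemma codom_poly_cycle (n : nat) :
  codom_poly (cycle_graph n.+3) = h n.+3 + 'X * h n.+1 + 'X^2 * h n *+ 2.
Proof.
rewrite (@codom_poly_wsum (cycle_graph n.+3) _ _
  (fun W => no111 (last false W :: rcons W (head false W))) (size_enum_ord n.+3)); first last.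
- exact: cycle_codominating.
- by move=> x; rewrite mem_enum.
- exact: enum_uniq.
(* Split on the last letter, then on the first. A 0 at either place cuts the cyclic word open; a 1
   at both places frames the rest by 11 on each side. *)
rewrite wsum_rcons.
have -> : wsum n.+2 (fun w => no111 (last false (rcons w false)
    :: rcons (rcons w false) (head false (rcons w false)))) = wsum n.+2 no111.
  apply: eq_wsum => -[//|a w] _.
  rewrite last_rcons [head _ _]/= -[LHS]/(no111 (rcons (rcons (a :: w) false) a)).
  by rewrite -!cats1 -catA no111_cat0 [no111 [:: a]]/= andbF [~~ false]/= !andbT.
rewrite [X in _ + 'X * X]wsumS.
have -> : wsum n.+1 (fun w => no111 (last false (rcons (false :: w) true)
    :: rcons (rcons (false :: w) true) (head false (rcons (false :: w) true))))
   = wsum n.+1 (fun w => no111 (w ++ [:: true])).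
  apply: eq_wsum => w _.
  rewrite last_rcons -[LHS]/(no111 (rcons (rcons w true) false)).
  by rewrite -[rcons _ false]cats1 no111_cat0 andbT cats1.
have -> : wsum n.+1 (fun w => no111 (last false (rcons (true :: w) true)
    :: rcons (rcons (true :: w) true) (head false (rcons (true :: w) true))))
   = wsum n.+1 (fun w => no111 (true :: true :: w ++ [:: true; true])).
  apply: eq_wsum => w _.
  by rewrite last_rcons [head _ _]/= !rcons_cons -!cats1 -catA.
rewrite wsum_no111 wsum_no111_suffix1 wsum_no111_11 wsum_no111_suffix11.
by rewrite mulr2n; ring.
Qed.

Lemma cycle_adjE (n i : nat) (u : 'I_n.+3) : (i < n.+2)%N ->
  cycle_adj (inord i.+1) u
  = (u == inord i) || (u == inord (if i == n.+1 then 0%N else i.+2)).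
Proof.
move=> iN; have iN1 : (i.+1 < n.+3)%N by [].
have iN0 : (i < n.+3)%N by lia.
have eS : (ordS (inord i.+1) == u) = (u == inord (if i == n.+1 then 0%N else i.+2)).
  rewrite eq_sym; congr (_ == _); apply: val_inj; rewrite /= inordK //.
  have [->|ne] := eqVneq i n.+1; first by rewrite modnn inordK.
  by rewrite modn_small ?inordK //; lia.
have eP : (ordS u == inord i.+1) = (u == inord i).
  rewrite -!val_eqE /= !inordK //.
  have [->|ne] := eqVneq (u : nat) n.+2.
    by rewrite modnn; apply/eqP/eqP; lia.
  by rewrite modn_small ?eqSS //; have := ltn_ord u; lia.
rewrite /cycle_adj eS eP orbC; case: eqP => //= <-.
apply/esym/negbTE; rewrite negb_or -!val_eqE /=.
by have [->|ne] := eqVneq i n.+1; rewrite !inordK; lia.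
Qed.

(** The condition at the stem follows from the one at its leaf, so the word is closed up on one side
    only. If the stem is out of the set, the leaf is free; if it is in, the leaf is out and the
    remaining n + 2 cycle vertices behave like a path framed by ones. *)
Lemma codom_poly_F (n : nat) :
  codom_poly (F_graph n.+3)
  = (1 + 'X) * h n.+3 + 'X * (h n.+2 + 'X * h n).
Proof.
pose s : seq (F_graph n.+3) := inr ord0 :: map inl (enum 'I_n.+3).
rewrite (@codom_poly_wsum (F_graph n.+3) n.+4 s
  (fun W => ~~ (head false (behead W) && head false W)
            && no111 (rcons (behead W) (head false (behead W))))); last first.
- move=> T; rewrite /s [map _ _]/= [head _ (_ :: _)]/= [behead _]/= -map_comp.
  pose S : {set 'I_n.+3} := [set x | inl x \in T].
  have -> : [seq (mem T \o inl) i | i <- enum 'I_n.+3] = map (mem S) (enum 'I_n.+3).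
    by apply: eq_map => x /=; rewrite inE.
  have nW k : (k < n.+3)%N -> nth false (map (mem S) (enum 'I_n.+3)) k = (inord k \in S).
    exact: nth_map_mem_enum_ord.
  have sW : size (map (mem S) (enum 'I_n.+3)) = n.+3 by rewrite size_map size_enum_ord.
  move: (map _ _) nW sW => W nW sW.
  rewrite -nth0 nW //.
  have bW i : (i < n.+2)%N ->
      [&& nth false (rcons W (inord 0 \in S)) i,
          nth false (rcons W (inord 0 \in S)) i.+1
        & nth false (rcons W (inord 0 \in S)) i.+2]
      = [&& inord i \in S, inord i.+1 \in S
          & inord (if i == n.+1 then 0%N else i.+2) \in S].
    move=> iN; have iN1 : (i < n.+3)%N by [lia]; have iN2 : (i.+1 < n.+3)%N by [lia].
    rewrite !nth_rcons sW iN1 iN2 (nW i) // (nW i.+1) // !ltnS !eqSS.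
    congr [&& _, _ & _]; have [->|ne] := eqVneq i n.+1; first by rewrite ltnn.
    by have iN3 : (i <= n)%N by [lia]; rewrite iN3 nW //; lia.
  have i0 : inord 0 = ord0 :> 'I_n.+3 by apply: val_inj; rewrite /= inordK.
  have c0 : (inl ord0 \in T) = (inord 0 \in S) by rewrite inE i0.
  apply/forallP/andP => [gT|[nl /no111P nw] v].
    split.
      have := gT (inr ord0); apply: contra => /andP[l0 r0].
      apply/subsetP => -[u|u]; rewrite inE; last by rewrite (ord1 u).
      rewrite /= /add_edges_adj /= => /eqP u0.
      by rewrite (_ : u = ord0) ?c0 //; apply: val_inj.
    apply/no111P => i; rewrite size_rcons sW !ltnS => iN; rewrite bW //.
    have := gT (inl (inord i.+1)); apply: contra => /and3P[W0 W1 W2].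
    apply/subsetP => -[u|u]; rewrite inE /= /add_edges_adj /=; last first.
      by rewrite inordK.
    rewrite !andbF !orbF.
    rewrite cycle_adjE // => uv; have : u \in S; last by rewrite inE.
    by case/orP: uv => [/eqP[->]//|/orP[] /eqP->].
  case: v => [v|v]; last first.
    rewrite (ord1 v); apply: contra nl => /subsetP vT; rewrite -c0.
    by apply/andP; split; apply: vT; rewrite inE ?eqxx.
  case E : (v : nat) => [|i].
    apply: contra nl => /subsetP vT.
    have v0 : v = ord0 by apply: val_inj.
    by rewrite -c0 !vT // inE v0 ?eqxx //= /add_edges_adj.
  have iN : (i < n.+2)%N by have := ltn_ord v; lia.
  have := nw i; rewrite size_rcons sW !ltnS => /(_ iN); rewrite bW //.
  have vi : v = inord i.+1 by apply: val_inj; rewrite /= inordK //; lia.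
  apply: contra => /subsetP vT.
  have {}vT (u : 'I_n.+3) : [|| u == v, u == inord i | u == inord (if i == n.+1 then 0 else i.+2)] -> u \in S.
    move=> uv; rewrite inE; apply: vT; rewrite inE /= /add_edges_adj /= vi cycle_adjE // -vi.
    by case/or3P: uv => /eqP->; rewrite ?eqxx ?orbT.
  by rewrite !vT ?eqxx ?orbT // vi eqxx.
- case=> [x|y]; rewrite !inE.
    by rewrite mem_map ?mem_enum ?orbT //; move=> a b [].
  by rewrite (ord1 y).
- rewrite /s /= map_inj_uniq ?enum_uniq ?andbT; last by move=> a b [].
  by apply/negP => /mapP[].
- by rewrite /s /= size_map size_enum_ord.
have l0 : wsum n.+2 (fun w => no111 (rcons (false :: w) false)) = h n.+3.
  rewrite -wsum_no111; apply: eq_wsum => w _.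
  by rewrite -cats1 no111_cat0 andbT.
have l1 : wsum n.+2 (fun w => no111 (rcons (true :: w) true)) = h n.+2 + 'X * h n.
  by rewrite -wsum_no111_1_1; apply: eq_wsum => w _; rewrite -cats1.
(* The first letter is the leaf and the second the stem; their four values give the four terms
   treated below. *)
rewrite wsumS !(wsumS n.+2).
have -> : wsum n.+2 (fun w => ~~ (head false (behead [:: true, true & w])
    && head false [:: true, true & w]) && no111 (rcons (behead [:: true, true & w])
     (head false (behead [:: true, true & w])))) = 0 by apply: wsum0.
have -> : wsum n.+2 (fun w => ~~ (head false (behead [:: false, true & w])
    && head false [:: false, true & w]) && no111 (rcons (behead [:: false, true & w])
     (head false (behead [:: false, true & w])))) = h n.+2 + 'X * h n.
  by rewrite -l1; apply: eq_wsum.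
have -> : wsum n.+2 (fun w => ~~ (head false (behead [:: false, false & w])
    && head false [:: false, false & w]) && no111 (rcons (behead [:: false, false & w])
     (head false (behead [:: false, false & w])))) = h n.+3 by rewrite -l0; apply: eq_wsum.
ring.
Qed.
End Words.

(** * Comparing products of path and cycle polynomials *)

Section TopOrder.
Import GRing.Theory.
Local Open Scope ring_scope.

(** Congruence modulo X^K; the explicit quotient lets [ring] verify congruences once a witness is
    given. *)
Definition eqmX (K : nat) (u v : {poly int}) : Prop :=
  exists w, u = v + 'X^K * w.

Lemma eqmX_refl (K : nat) (u : {poly int}) : eqmX K u u.
Proof. by exists 0; rewrite mulr0 addr0. Qed.

Lemma eqmX_sym (K : nat) (u v : {poly int}) : eqmX K u v -> eqmX K v u.
Proof. by case=> w ->; exists (- w); ring. Qed.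

Lemma eqmX_trans (K : nat) (v u x : {poly int}) :
  eqmX K u v -> eqmX K v x -> eqmX K u x.
Proof. by case=> w -> [w' ->]; exists (w + w'); ring. Qed.

Lemma eqmXD (K : nat) (u u' v v' : {poly int}) :
  eqmX K u v -> eqmX K u' v' -> eqmX K (u + u') (v + v').
Proof. by case=> w -> [w' ->]; exists (w + w'); ring. Qed.

Lemma eqmXM (K : nat) (u u' v v' : {poly int}) :
  eqmX K u v -> eqmX K u' v' -> eqmX K (u * u') (v * v').
Proof. by case=> w -> [w' ->]; exists (v * w' + v' * w + 'X^K * w * w'); ring. Qed.

Lemma eqmX_shift (j K : nat) (u v : {poly int}) :
  eqmX K u v -> eqmX (j + K) ('X^j * u) ('X^j * v).
Proof. by case=> w ->; exists w; rewrite exprD; ring. Qed.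

Lemma eqmX_weaken (L K : nat) (u v : {poly int}) :
  (K <= L)%N -> eqmX L u v -> eqmX K u v.
Proof.
by move=> /subnKC<- [w ->]; exists ('X^(L - K) * w); rewrite exprD mulrA.
Qed.

Lemma eqmX0 (L K : nat) (w : {poly int}) : (K <= L)%N -> eqmX K ('X^L * w) 0.
Proof. by move=> KL; apply: eqmX_weaken KL _; exists w; rewrite add0r. Qed.

Lemma intr_polyC (z : int) : z%:~R = z%:P :> {poly int}.
Proof. by rewrite -[in RHS](intz z) rmorph_int. Qed.

Lemma eqmX_lin_eq0 (b : nat) (c d : int) :
  eqmX b.+2 ('X^b * (c%:~R + d%:~R * 'X)) 0 -> c = 0 /\ d = 0.
Proof.
case=> w e.
have ei i : (c%:~R + d%:~R * 'X : {poly int})`_i = ('X^2 * w)`_i.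
  have := congr1 (fun u : {poly int} => u`_(b + i)) e.
  rewrite add0r -addn2 exprD -mulrA (coefXnM b) (coefXnM b).
  by rewrite ltnNge leq_addr /= addKn.
have := ei 1%N; have := ei 0%N.
by rewrite !intr_polyC !coefXnM !coefD !coefCM !coefC !coefX /= mulr0 mulr1 addr0 add0r.
Qed.

Lemma eqmX_const_eq0 (b : nat) (c : int) : eqmX b.+1 ('X^b * c%:~R) 0 -> c = 0.
Proof.
case=> w /(congr1 (fun u : {poly int} => u`_b)).
by rewrite add0r intr_polyC !coefXnM ltnn subnn coefC ltnSn.
Qed.

Lemma h_lin (n : nat) : eqmX 2 (h n.+1) (1 + n%:R * 'X).
Proof.
suff [//] : [/\ eqmX 2 (h n.+1) (1 + n%:R * 'X),
  eqmX 2 (h n.+2) (1 + n.+1%:R * 'X) & eqmX 2 (h n.+3) (1 + n.+2%:R * 'X)].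
elim: n => [|n [H0 H1 H2]]; first by split; [exists 0|exists 0|exists 1]; rewrite /=; ring.
split=> //; case: H0 H1 H2 => w0 E0 [w1 E1] [w2 E2].
rewrite hS E0 E1 E2; exists (w2 + 'X * w1 + 'X^2 * w0 + n.+1%:R + 1 + n%:R * 'X).
by ring.
Qed.

Definition dl (a b : nat) : {poly int} := h a * h b.+1 - h a.+1 * h b.

(* Both indices advance together: dl (a + k) (b + k) is a combination of the
   products of two distinct roots of the recurrence of h, whence its own
   recurrence and its order X^(a + 1). *)
Lemma dlS (a b : nat) :
  dl a.+3 b.+3 = - 'X * dl a.+2 b.+2 - 'X^2 * dl a.+1 b.+1 + 'X^4 * dl a b.
Proof. by rewrite /dl !hS; ring. Qed.

(** Along a diagonal, division of the determinants by their powers of X turns the recurrence into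
    d_(k+3) = - d_(k+2) - d_(k+1) + X d_k. Modulo X only t^2 + t + 1 remains, whence the leading
    coefficients 1, 0, -1 with period 3; the term X d_k feeds them into the next coefficient, which
    therefore grows linearly in k. *)
Lemma dl_lin (k e : nat) :
  [/\ eqmX ((3 * k).+1 + 2) (dl (3 * k) (3 * k + e.+4))
        ('X^((3 * k).+1) * (1%:~R + (e%:Z + 3 + 2 * k%:Z)%:~R * 'X)),
      eqmX ((3 * k).+2 + 2) (dl (3 * k).+1 (3 * k + e.+4).+1)
        ('X^((3 * k).+2) * (0%:~R + (- 1 - k%:Z)%:~R * 'X)) &
      eqmX ((3 * k).+3 + 2) (dl (3 * k).+2 (3 * k + e.+4).+2)
        ('X^((3 * k).+3) * ((- 1)%:~R + (- e%:Z - 3 - k%:Z)%:~R * 'X))].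
Proof.
elim: k => [|k [H0 H1 H2]].
  have [w1 E1] := h_lin e.+1; have [w2 E2] := h_lin e.+2.
  rewrite muln0 add0n /dl; split.
  - exists (w2 + 'X * w1 + e.+1%:R); rewrite [h 0]/= [h 1]/= mul1r hS E1 E2; ring.
  - by exists (- w1 *'X - e.+1%:R); rewrite [h 1]/= [h 2]/= (hS e.+3) (hS e.+2) E1; ring.
  by exists (- (1 + 'X) * w2 - e.+2%:R);
    rewrite [h 2]/= [h 3]/= (hS e.+4) (hS e.+3) E2; ring.
have e1 : (3 * k.+1 = (3 * k).+3)%N by lia.
have e2 : (3 * k.+1 + e.+4 = (3 * k + e.+4).+3)%N by lia.
rewrite e2 e1.
have H3 : eqmX ((3 * k).+4 + 2) (dl (3 * k).+3 (3 * k + e.+4).+3)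
   ('X^((3 * k).+4) * (1%:~R + (e%:Z + 3 + 2 * (k.+1)%:Z)%:~R * 'X)).
  rewrite dlS; case: H0 H1 H2 => w0 -> [w1 ->] [w2 ->].
  exists ('X * w0 - w1 - w2 + (e%:Z + 3 + 2 * k%:Z)%:~R); move: (3 * k)%N => j.
  rewrite !addn2 !exprS; ring.
have H4 : eqmX ((3 * k).+4.+1 + 2) (dl (3 * k).+4 (3 * k + e.+4).+4)
   ('X^((3 * k).+4.+1) * (0%:~R + (- 1 - (k.+1)%:Z)%:~R * 'X)).
  rewrite dlS; case: H1 H2 H3 => w0 -> [w1 ->] [w2 ->].
  exists ('X * w0 - w1 - w2 + (- 1 - k%:Z)%:~R); move: (3 * k)%N => j.
  rewrite !addn2 !exprS; ring.
split=> //.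
rewrite dlS; case: H2 H3 H4 => w0 -> [w1 ->] [w2 ->].
exists ('X * w0 - w1 - w2 + (- e%:Z - 3 - k%:Z)%:~R); move: (3 * k)%N => j.
rewrite !addn2 !exprS; ring.
Qed.

Lemma mod3_cases (P : nat -> Prop) :
  (forall k, P (3 * k)%N) -> (forall k, P (3 * k).+1) ->
  (forall k, P (3 * k).+2) -> forall n, P n.
Proof.
move=> P0 P1 P2 n; have := divn_eq n 3; rewrite mulnC.
case: (n %% 3)%N (ltn_pmod n (isT : (0 < 3)%N)) => [|[|[|//]]] _ ->.
- by rewrite addn0.
- by rewrite addn1.
- by rewrite addn2.
Qed.

Lemma modn3E (k : nat) :
  (((3 * k) %% 3 = 0)%N * ((3 * k).+1 %% 3 = 1)%N * ((3 * k).+2 %% 3 = 2)%N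
  * ((3 * k).+3 %% 3 = 0)%N * ((3 * k).+4 %% 3 = 1)%N
  * ((3 * k).+4.+1 %% 3 = 2)%N)%type.
Proof. by do !split; lia. Qed.

(** * Lowest terms of products of path and cycle polynomials with h *)

Definition pathp (m : nat) : {poly int} := h m + 'X * h (m - 2).
Definition cyclep (c : nat) : {poly int} :=
  h c + 'X * h (c - 2) + 'X^2 * h (c - 3) *+ 2.

(* X^c * cycle_sign c and X^m * path_sign m are the lowest-order terms by
   which q_c h_N and p_m h_(N+1) differ from h_(c+N) and p_(m+1) h_N. *)
Definition cycle_sign (c : nat) : int := if (c %% 3 == 0)%N then 2 else -1.
Definition path_sign (m : nat) : int := [:: 0; -1; 1]`_(m %% 3).

(** The terms classify the words of length a + b + 3 by the letter following the first a + 1 ones of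
    its positions: it is 0, or it is 1 and belongs to a run of at most two ones. The proof only
    compares recurrences in b. *)
Lemma h_addn (a b : nat) :
  h (a.+2 + b.+2) = h a.+2 * h b.+2 + ('X * h a.+1 + 'X^2 * h a) * h b.+1
                    + 'X^2 * h a.+1 * h b.
Proof.
apply: (rec3_unique (u := fun b => h (a.+2 + b.+2))
  (v := fun b => h a.+2 * h b.+2 + ('X * h a.+1 + 'X^2 * h a) * h b.+1
                    + 'X^2 * h a.+1 * h b)) => [k|k|||].
- by rewrite !addnS !hS.
- by rewrite !hS; ring.
- by rewrite !addnS addn0 [h 2]/= [h 1]/= [h 0]/= !hS; ring.
- by rewrite !addnS addn0 [h 3]/= [h 2]/= [h 1]/= !hS; ring.
- by rewrite !addnS addn0 [h 4]/= [h 3]/= [h 2]/= !hS; ring.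
Qed.

(** With c = a + 3 and b large, the three error terms are divisible by X^c, X^c and X^(c+1): the
    first two determine the leading coefficient, and the last enters only in the next one. *)
Lemma cyclep_h (a b : nat) :
  cyclep a.+3 * h b.+2 = h (a.+3 + b.+2)
    + ('X * dl a.+1 b.+1 + 'X^2 * dl a b.+1 *+ 2 + 'X^2 * dl a.+1 b).
Proof.
have -> : cyclep a.+3 = h a.+3 + 'X * h a.+1 + 'X^2 * h a *+ 2.
  by rewrite /cyclep !subSS !subn0.
by rewrite h_addn /dl; ring.
Qed.

(** For c = 2 modulo 3 the sign of a cycle is -1, so a single cycle of length c can cancel a defect
    +X^c of the other factor, and the next coefficient has to be compared. *)
Lemma cyclep_h_lin (c N : nat) :
  (3 <= c)%N -> (c %% 3 = 2)%N -> (c + 5 <= N)%N ->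
  eqmX c.+2 (cyclep c * h N)
    (h (c + N) + 'X^c * ((- 1)%:~R + (c%:Z + 1 - N%:Z)%:~R * 'X)).
Proof.
move=> c3 cm cN; have [k ck] : exists k, c = (3 * k).+2.+3 by exists (c %/ 3 - 1)%N; lia.
have [d dN] : exists d, N = ((3 * k).+2 + d.+3.+3).+2 by exists (N - c - 5)%N; lia.
rewrite {c3 cm cN}dN {}ck cyclep_h; apply: eqmXD (eqmX_refl _ _) _.
have [[w0 E0] _ _] := dl_lin k.+1 d.+2; have [_ _ [w2 E2]] := dl_lin k d.+3.
have [[w0' E0'] _ _] := dl_lin k.+1 d.+1.
have e0 : (3 * k.+1 = (3 * k).+3)%N by lia.
have e1 : (3 * k.+1 + d.+2.+4 = ((3 * k).+2 + d.+3.+3).+1)%N by lia.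
have e2 : ((3 * k + d.+3.+4).+2 = ((3 * k).+2 + d.+3.+3).+1)%N by lia.
have e3 : (3 * k.+1 + d.+1.+4 = ((3 * k).+2 + d.+3.+3))%N by lia.
rewrite e1 e0 in E0; rewrite e2 in E2; rewrite e3 e0 in E0'.
rewrite E0 E2 E0'; exists (w0 + w2 *+ 2 + (d.+1%:Z + 3 + 2 * k.+1%:Z)%:~R + 'X * w0').
rewrite -e1 e0; move: (3 * k)%N E0 E2 E0' e0 e1 e2 e3 => j *.
rewrite !addn2 !exprS; ring.
Qed.

Definition dl_sign (a : nat) : int := [:: 1; 0; -1]`_(a %% 3).

Lemma dl_const (a b : nat) : (a + 4 <= b)%N ->
  eqmX a.+2 (dl a b) ('X^(a.+1) * (dl_sign a)%:~R).
Proof.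
move=> /subnKC<-; move: (b - (a + 4))%N => e.
rewrite -addnA (_ : 4 + e = e.+4)%N //; elim/mod3_cases: a => k; rewrite /dl_sign modn3E.
- have [[w ->] _ _] := dl_lin k e.
  by exists ((e%:Z + 3 + 2 * k%:Z)%:~R + 'X * w); rewrite addn2 !exprS /=; ring.
- have [_ [w E] _] := dl_lin k e; rewrite [((3 * k).+1 + _)%N]addSn E.
  by exists ((- 1 - k%:Z)%:~R + 'X * w); rewrite addn2 !exprS /=; ring.
- have [_ _ [w E]] := dl_lin k e; rewrite [((3 * k).+2 + _)%N]addSn addSn E.
  by exists ((- e%:Z - 3 - k%:Z)%:~R + 'X * w); rewrite addn2 !exprS /=; ring.
Qed.

Lemma cyclep_h_const (c N : nat) : (3 <= c)%N -> (c + 6 <= N)%N ->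
  eqmX c.+1 (cyclep c * h N) (h (c + N) + 'X^c * (cycle_sign c)%:~R).
Proof.
move=> c3 cN; have [a ca] : exists a, c = a.+3 by exists (c - 3)%N; lia.
have [b bN] : exists b, N = b.+2 by exists (N - 2)%N; lia.
rewrite ca bN in cN *; rewrite cyclep_h; apply: eqmXD (eqmX_refl _ _) _.
have [w1 ->] := @dl_const a.+1 b.+1 ltac:(lia).
have [w0 ->] := @dl_const a b.+1 ltac:(lia).
have [w2 ->] := @dl_const a.+1 b ltac:(lia).
have -> : cycle_sign a.+3 = dl_sign a.+1 + dl_sign a *+ 2.
  rewrite /cycle_sign /dl_sign.
  by elim/mod3_cases: a {ca cN w0 w1 w2} => k; rewrite !modn3E.
by exists (w1 + w0 *+ 2 + (dl_sign a.+1)%:~R + 'X * w2); rewrite !exprS; ring.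
Qed.

Lemma pathp_step (a b : nat) :
  pathp a.+2 * h b.+1 - pathp a.+3 * h b = dl a.+2 b + 'X * dl a b.
Proof.
have e (m : nat) : pathp m.+2 = h m.+2 + 'X * h m by rewrite /pathp !subSS subn0.
by rewrite !e /dl; ring.
Qed.

(** Telescoping in S: moving one unit of index from [h] to [pathp] costs a multiple of X^m, and
    every later move a multiple of X^(m+1). Only the first move is visible, so the leading term does
    not depend on S. *)
Lemma pathp_h_const (S m N : nat) : (0 < S)%N -> (2 <= m)%N -> (m + S + 4 <= N)%N ->
  eqmX m.+1 (pathp m * h (N + S) - pathp (m + S) * h N)
            ('X^m * (path_sign m)%:~R).
Proof.
have step k M : (2 <= k)%N -> (k + 4 <= M)%N ->
    eqmX k.+1 (pathp k * h M.+1 - pathp k.+1 * h M) ('X^k * (path_sign k)%:~R).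
  move=> k2 kM; have [a ka] : exists a, k = a.+2 by exists (k - 2)%N; lia.
  rewrite ka in kM *; rewrite pathp_step.
  have [w2 ->] := @dl_const a.+2 M ltac:(lia).
  have [w0 ->] := @dl_const a M ltac:(lia).
  have -> : path_sign a.+2 = dl_sign a.
    rewrite /path_sign /dl_sign.
    by elim/mod3_cases: a {ka kM w0 w2} => j; rewrite !modn3E.
  by exists (w0 + (dl_sign a.+2)%:~R + 'X * w2); rewrite !exprS; ring.
case: S => // S _; elim: S m N => [|S IHS] m N m2 mN.
  by rewrite !addn1; apply: step; lia.
have -> : pathp m * h (N + S.+2) - pathp (m + S.+2) * h N
  = (pathp m * h (N + S.+1).+1 - pathp m.+1 * h (N + S.+1))
    + (pathp m.+1 * h (N + S.+1) - pathp (m.+1 + S.+1) * h N).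
  by rewrite !addnS addSn; ring.
rewrite -[X in eqmX _ _ X]addr0; apply: eqmXD; first by apply: step; lia.
have /(_ _ _)/eqmX_weaken := IHS m.+1 N; move=> /(_ m.+1 (leqnSn _) ltac:(lia) ltac:(lia)) H.
apply: eqmX_trans H _; exact: eqmX0.
Qed.

(** One order further, for m = a + 2: the first move is kept exactly, and all the following ones
    together contribute just the leading coefficient at X^(m+1). *)
Lemma pathp_h_split (S a N : nat) : (a + S + 8 <= N)%N ->
  eqmX a.+4 (pathp a.+2 * h (N + S.+2) - pathp (a.+2 + S.+2) * h N)
    (dl a.+2 (N + S.+1) + 'X * dl a (N + S.+1)
     + 'X^(a.+3) * (path_sign a.+3)%:~R).
Proof.
move=> aN; have -> : pathp a.+2 * h (N + S.+2) - pathp (a.+2 + S.+2) * h N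
  = (dl a.+2 (N + S.+1) + 'X * dl a (N + S.+1))
    + (pathp a.+3 * h (N + S.+1) - pathp (a.+3 + S.+1) * h N).
  by rewrite -pathp_step !addnS !addSn; ring.
by apply: eqmXD (eqmX_refl _ _) _; apply: pathp_h_const; lia.
Qed.

Lemma pathp_h_lin0 (S k N : nat) : (3 * k + S + 12 <= N)%N ->
  eqmX (3 * k).+3.+2 (pathp (3 * k).+3 * h (N + S.+2)
                      - pathp ((3 * k).+3 + S.+2) * h N)
    ('X^((3 * k).+3) * (0%:~R + (- k.+1%:Z)%:~R * 'X)).
Proof.
move=> kN; apply: eqmX_trans (@pathp_h_split S (3 * k).+1 N ltac:(lia)) _.
have [w1 ->] := @dl_const (3 * k).+3 (N + S.+1)%N ltac:(lia).
have [e eN] : exists e, (N + S.+1 = (3 * k + e.+4).+1)%N by exists (N + S.+1 - 3 * k - 5)%N; lia.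
have [_ [w2 E2] _] := dl_lin k e; rewrite eN E2 /path_sign /dl_sign !modn3E.
by exists (w1 + w2); rewrite !addn2 !exprS /=; ring.
Qed.

Lemma pathp_h_lin2 (S k N : nat) : (3 * k + S + 12 <= N)%N ->
  eqmX (3 * k).+4 (pathp (3 * k).+2 * h (N + S.+2)
                      - pathp ((3 * k).+2 + S.+2) * h N)
    ('X^((3 * k).+2) * (1%:~R + (N%:Z + S%:Z - 1 - k%:Z)%:~R * 'X)).
Proof.
move=> kN; apply: eqmX_trans (@pathp_h_split S (3 * k) N ltac:(lia)) _.
have [w1 ->] := @dl_const (3 * k).+2 (N + S.+1)%N ltac:(lia).
have [e eN] : exists e, (N + S.+1 = (3 * k + e.+4))%N by exists (N + S.+1 - 3 * k - 4)%N; lia.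
have [[w2 E2] _ _] := dl_lin k e; rewrite eN E2 /path_sign /dl_sign !modn3E.
have -> : N%:Z + S%:Z - 1 - k%:Z = e%:Z + 2 + 2 * k%:Z by lia.
by exists (w1 + w2); rewrite !addn2 !exprS /=; ring.
Qed.

Lemma cyclep1 (c : nat) : (3 <= c)%N -> eqmX 2 (cyclep c) (1 + c%:R * 'X).
Proof.
move=> c3; have [a ->] : exists a, c = a.+3 by exists (c - 3)%N; lia.
rewrite /cyclep !subSS !subn0; have [w ->] := h_lin a.+2; have [w1 ->] := h_lin a.
by exists (w + a%:R + 'X * w1 + h a *+ 2); ring.
Qed.

Lemma pathp1 (m : nat) : (2 <= m)%N -> eqmX 2 (pathp m) (1 + m%:R * 'X).
Proof.
move=> m2; have [a ->] : exists a, m = a.+2 by exists (m - 2)%N; lia.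
rewrite /pathp !subSS !subn0; have [w ->] := h_lin a.+1.
case: a => [|a]; first by exists w; rewrite /=; ring.
by have [w1 ->] := h_lin a; exists (w + a%:R + 'X * w1); ring.
Qed.

(** The cycles are absorbed into [h] one at a time. Each one of length b leaves the trace
    [cycle_sign b] at X^b, and the longer ones leave theirs at higher powers. *)
Lemma prod_cyclep_h_const (b N : nat) (cs : seq nat) : (3 <= b)%N ->
  all (leq b) cs -> (sumn cs + 6 <= N)%N ->
  eqmX b.+1 (h N * \prod_(c <- cs) cyclep c)
    (h (N + sumn cs) + 'X^b * (cycle_sign b * (count_mem b cs)%:Z)%:~R).
Proof.
move=> b3; elim: cs N => [|c cs IHcs] N /=.
  by move=> _ _; rewrite big_nil addn0; exists 0; ring.
move=> /andP[bc bcs] cN; rewrite big_cons.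
have {}IHcs : eqmX b.+1 (h (N + c) * \prod_(c <- cs) cyclep c)
   (h (N + c + sumn cs) + 'X^b * (cycle_sign b * (count_mem b cs)%:Z)%:~R).
  by apply: IHcs => //; lia.
have c3 : (3 <= c)%N by lia.
have [w Ew] := @cyclep_h_const c N c3 ltac:(lia).
have -> : h N * (cyclep c * \prod_(j <- cs) cyclep j)
   = h (N + c) * \prod_(c <- cs) cyclep c
     + ('X^c * (cycle_sign c)%:~R + 'X^(c.+1) * w) * \prod_(j <- cs) cyclep j.
  by rewrite mulrA [h N * _]mulrC Ew [(c + N)%N]addnC; ring.
rewrite addnA PoszD mulrDr [in X in eqmX _ _ X]rmorphD /= [_%:~R + _]addrC mulrDr addrA.
apply: eqmXD IHcs _.
have [eqbc|nbc] := eqVneq c b; last first.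
  have [d ->] : exists d, c = (b.+1 + d)%N by exists (c - b.+1)%N; lia.
  exists ('X^d * ((cycle_sign (b.+1 + d))%:~R + 'X * w) * \prod_(j <- cs) cyclep j).
  by rewrite mulr0 mulr0 !exprS !exprD; ring.
have [w' ->] : eqmX 1 (\prod_(j <- cs) cyclep j) 1.
  have : all (leq 3) cs by apply: sub_all bcs => x; apply: leq_trans b3.
  elim: (cs) => [|x xs IH] /=; first by rewrite big_nil; exists 0; ring.
  move=> /andP[x3 /IH H]; rewrite big_cons -[X in eqmX _ _ X]mulr1; apply: eqmXM H.
  by have [v ->] := cyclep1 x3; exists (x%:R + 'X * v); ring.
rewrite eqbc [nat_of_bool _]/= mulr1; exists ((cycle_sign b)%:~R * w' + w + w * 'X * w').
by rewrite !exprS; ring.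
Qed.

Lemma seq_min (cs : seq nat) : cs != [::] -> exists2 b, b \in cs & all (leq b) cs.
Proof.
elim: cs => // x [|y cs] IH _; first by exists x; rewrite /= ?mem_head ?leqnn.
have [//|b bcs bm] := IH; have [xb|bx] := leqP x b.
  exists x; first exact: mem_head.
  by rewrite /= leqnn; apply: sub_all bm => z; apply: leq_trans.
exists b; first by rewrite inE bcs orbT.
by move: bm => /= ->; rewrite ltnW.
Qed.

Lemma all_leqS (b : nat) (cs : seq nat) :
  all (leq b) cs -> count_mem b cs = 0%N -> all (leq b.+1) cs.
Proof.
move=> /allP bcs /count_memPn bn; apply/allP => c ccs.
by rewrite ltn_neqAle bcs // andbT; apply: contraNneq bn => ->.
Qed.

Lemma eqmX1_mul (b : nat) (P u : {poly int}) :
  eqmX 1 P 1 -> eqmX b.+1 (P * ('X^b * u)) ('X^b * u).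
Proof. by case=> w ->; exists (u * w); rewrite !exprS; ring. Qed.

Lemma pathp_const1 (m : nat) : (2 <= m)%N -> eqmX 1 (pathp m) 1.
Proof. by case/pathp1 => w ->; exists (m%:R + 'X * w); ring. Qed.

Lemma cyclep_const1 (c : nat) : (3 <= c)%N -> eqmX 1 (cyclep c) 1.
Proof. by case/cyclep1 => w ->; exists (c%:R + 'X * w); ring. Qed.

(** The common frame of the comparisons below: P is the factor without cycles, Q is the product of
    [h N] with the cycles, and A is the single [h] into which Q collapses. The traces [cyc] of the
    cycles have to cancel the defect R of P. *)
Lemma eqmX_cancel (K : nat) (P A B Q cyc R : {poly int}) :
  P * Q = B -> eqmX K Q (A + cyc) -> eqmX K (P * A - B) R ->
  eqmX K (P * cyc + R) 0.
Proof.
move=> <- [w ->] [w' E]; exists (- P * w - w').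
have -> : R = P * A - P * (A + cyc + 'X^K * w) - 'X^K * w' by rewrite E; ring.
by ring.
Qed.

Lemma cycle_sign_neq0 (c : nat) : cycle_sign c != 0.
Proof. by rewrite /cycle_sign; case: ifP. Qed.

(** If P has no defect up to X^b, nothing can cancel the traces of the cycles of length b, which all
    have the same sign. *)
Lemma short_cycle_contra (P B : {poly int}) (N b : nat) (cs : seq nat) :
  eqmX 1 P 1 -> P * (h N * \prod_(c <- cs) cyclep c) = B ->
  eqmX b.+1 (P * h (N + sumn cs) - B) 0 -> (sumn cs + 6 <= N)%N ->
  (3 <= b)%N -> all (leq b) cs -> b \notin cs.
Proof.
move=> P1 EN HR SN b3 bmin.
have H := eqmX_cancel EN (prod_cyclep_h_const b3 bmin SN) HR; rewrite addr0 in H.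
have /eqmX_const_eq0/eqP := eqmX_trans (eqmX_sym (eqmX1_mul b _ P1)) H.
rewrite mulf_eq0 (negPf (cycle_sign_neq0 _)) /= eqz_nat.
by move=> /eqP c0; apply/count_memPn.
Qed.

(** The unique cycle of length c is absorbed last, so that its two lowest terms are known exactly;
    every cycle of length c + 1 adds its sign 2 to the second of them. *)
Lemma prod_cyclep_h_lin (c N : nat) (cs : seq nat) :
  (3 <= c)%N -> (c %% 3 = 2)%N -> all (leq c) cs -> count_mem c cs = 1%N ->
  (2 * sumn cs + 6 <= N)%N ->
  eqmX c.+2 (h N * \prod_(j <- cs) cyclep j)
    (h (N + sumn cs) + 'X^c * ((- 1)%:~R
      + (2 * c%:Z + 1 - N%:Z - (sumn cs)%:Z + 2 * (count_mem c.+1 cs)%:Z)%:~R * 'X)).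
Proof.
move=> c3 cm ccs cnt NS.
have cmem : c \in cs by rewrite -has_pred1 has_count cnt.
pose cs' := rem c cs; have cs_perm := perm_to_rem cmem.
have Scs : sumn cs = (c + sumn cs')%N by rewrite (perm_sumn cs_perm).
have cnt0 : count_mem c cs' = 0%N.
  by have /permP/(_ (pred1 c)) := cs_perm; rewrite cnt /= eqxx => -[].
have cntS : count_mem c.+1 cs = count_mem c.+1 cs'.
  by have /permP/(_ (pred1 c.+1)) := cs_perm; rewrite /= ltn_eqF.
have ccs' : all (leq c) cs' by apply/allP => j /mem_rem; apply: (allP ccs).
have HQ1 := @prod_cyclep_h_const c.+1 N cs' (leqW c3) (all_leqS ccs' cnt0) ltac:(lia).
have HC := @cyclep_h_lin c (N + sumn cs') c3 cm ltac:(lia).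
rewrite (perm_big _ cs_perm) big_cons mulrCA /=.
apply: eqmX_trans (eqmXM (eqmX_refl _ _) HQ1) _; rewrite mulrDr.
apply: eqmX_trans (eqmXD HC (eqmX1_mul _ _ (cyclep_const1 c3))) _.
have sgn : cycle_sign c.+1 = 2.
  by rewrite /cycle_sign -addn1 -modnDml cm.
rewrite Scs (addnCA N c) sgn cntS; exists 0.
by rewrite !PoszD !exprS /=; ring.
Qed.

Lemma pathp_cyclep_eq (m : nat) (cs : seq nat) :
  (2 <= m)%N -> all (leq 3) cs ->
  pathp m * \prod_(c <- cs) cyclep c = pathp (m + sumn cs) -> cs = [::].
Proof.
move=> m2 cs3 E; apply/eqP/negPn/negP => csN.
have [b bcs bmin] := seq_min csN.
have b3 : (3 <= b)%N by apply: (allP cs3).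
have bS : (b <= sumn cs)%N by rewrite (perm_sumn (perm_to_rem bcs)) /= leq_addr.
(* Any N beyond the thresholds of the expansions would do; both sides of the equation are multiplied
   by [h N]. *)
pose N := (3 * m + 2 * sumn cs + 20)%N.
have SN : (sumn cs + 6 <= N)%N by lia.
have EN : pathp m * (h N * \prod_(c <- cs) cyclep c) = pathp (m + sumn cs) * h N.
  by rewrite -E; ring.
have Ep := @pathp_h_const (sumn cs) m N ltac:(lia) m2 ltac:(lia).
have key := eqmX_cancel EN.
have P1 := pathp_const1 m2.
(* A cycle shorter than m would leave a trace below X^m, where the path has no defect. *)
have mb : (m <= b)%N.
  rewrite leqNgt; apply/negP => bm.
  have HR := eqmX_trans (eqmX_weaken (leqW bm : b.+1 <= m.+1)%N Ep) (eqmX0 _ bm).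
  by have /negP := short_cycle_contra P1 EN HR SN b3 bmin.
have mcs : all (leq m) cs by apply: sub_all bmin => c; apply: leq_trans.
have [S' ES] : exists S', sumn cs = S'.+2 by exists (sumn cs - 2)%N; lia.
clear csN b bcs bmin b3 bS mb.
(* For m = 2 the path defect X^2 lies below the traces of all cycles. *)
have [m3|m3] := leqP m 2.
  have em : m = 2 by lia.
  have HQ := @prod_cyclep_h_const 3 N cs isT cs3 SN.
  have {}HQ : eqmX 3 (h N * \prod_(c <- cs) cyclep c) (h (N + sumn cs) + 0).
    apply: eqmX_trans (eqmX_weaken _ HQ) (eqmXD (eqmX_refl _ _) (eqmX0 _ _)) => //.
  rewrite em in key Ep; have H := key _ _ _ _ HQ Ep; rewrite mulr0 add0r in H.
  by have := eqmX_const_eq0 H.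
have HQ := prod_cyclep_h_const m3 mcs SN.
have H := key _ _ _ _ HQ Ep.
have /eqmX_const_eq0 : eqmX m.+1 ('X^m * (cycle_sign m * (count_mem m cs)%:Z + path_sign m)%:~R) 0.
  apply: eqmX_trans _ H; rewrite rmorphD /= mulrDr; apply: eqmXD (eqmX_refl _ _).
  exact: eqmX_sym (eqmX1_mul _ _ P1).
clear H HQ Ep; rewrite /cycle_sign /path_sign; have := divn_eq m 3.
case mm : (m %% 3)%N (ltn_pmod m (isT : (0 < 3)%N)) => [|[|[|//]]] _ em //= cnt.
(* Case m = 0 modulo 3: the path contributes 0 at X^m and each cycle of length m contributes 2, so
   there is none. At X^(m+1) the path gives - (k + 1) and each cycle of length m + 1 gives -1. *)
- have cm0 : count_mem m cs = 0%N by move: (count_mem m cs) cnt => x; clear; lia.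
  have [k mk] : exists k, m = (3 * k).+3.
    by exists (m %/ 3 - 1)%N; move: em m3; clear; lia.
  clear cnt em mm; have HQ1 := @prod_cyclep_h_const m.+1 N cs (leqW m3) (all_leqS mcs cm0) SN.
  have HR1 := @pathp_h_lin0 S' k N ltac:(lia).
  rewrite -ES -mk in HR1; have := key _ _ _ _ HQ1 HR1 => H1.
  suff : - k.+1%:Z - (count_mem m.+1 cs)%:Z = 0.
    by move: (count_mem m.+1 cs) => x; clear; lia.
  apply: proj2 (@eqmX_lin_eq0 m 0 _ _).
  apply: eqmX_trans _ H1.
  apply: eqmX_trans (eqmXD (eqmX_sym (eqmX1_mul _ _ P1)) (eqmX_refl _ _)).
  by rewrite /cycle_sign mk modn3E; exists 0; rewrite !exprS /=; ring.
(* Case m = 1 modulo 3: path and cycles both contribute negatively at X^m. *)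
- by move: (count_mem m cs) cnt => x; clear; lia.
(* Case m = 2 modulo 3: exactly one cycle of length m cancels the path. At X^(m+1) there remains 2k
   plus twice the number of cycles of length m + 1, which is positive because m > 2. *)
have cm1 : count_mem m cs = 1%N by move: (count_mem m cs) cnt => x; clear; lia.
have [k mk] : exists k, m = (3 * k).+2.
  by exists (m %/ 3)%N; move: em; clear; lia.
clear cnt em; have HR1 := @pathp_h_lin2 S' k N ltac:(lia); rewrite -ES -mk in HR1.
have HQ1 := @prod_cyclep_h_lin m N cs m3 mm mcs cm1 ltac:(lia).
have H1 := key _ _ _ _ HQ1 HR1.
suff : 2 * k%:Z + 2 * (count_mem m.+1 cs)%:Z = 0.
  by move: (count_mem m.+1 cs) m3 mk => x; clear; lia.
apply: proj2 (@eqmX_lin_eq0 m 0 _ _).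
apply: eqmX_trans _ H1; have [v ->] := pathp1 m2.
have eS : (sumn cs)%:Z = S'%:Z + 2 by rewrite ES; clear; lia.
have ek : m%:Z = 3 * k%:Z + 2 by rewrite mk; clear; lia.
have em : m%:R = (3 * k%:Z + 2)%:~R :> {poly int} by rewrite -ek pmulrn.
rewrite eS ek em; move: (count_mem _ _)%:Z => c1.
exists (v - (2 * (3 * k%:Z + 2) + 1 - N%:Z - (S'%:Z + 2) + 2 * c1)%:~R
            * ((3 * k%:Z + 2)%:~R + v * 'X)).
rewrite !exprS; move: (N%:Z) ('X^m) => M Y.
by ring.
Qed.

(** * Cycles with a pendant edge, next to K_2 *)

Definition Fp (i : nat) : {poly int} := (1 + 'X) * h i + 'X * pathp (i - 1).

Lemma Fp4 : Fp 4 * pathp 2 = pathp 7.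
Proof. by rewrite /Fp /pathp /=; ring. Qed.

Lemma Fp5 : Fp 5 * pathp 2 = pathp 8.
Proof. by rewrite /Fp /pathp /=; ring. Qed.

(** Continued backwards, the recurrence gives h(-1) = h(-2) = 0 and h(-3) = X^(-2). The same
    identity at j = -2, -1 is therefore [Fp4] and [Fp5], while at j = -3 it leaves the defect X^3 (1
    + X) of F_3. *)
Lemma Fp6 (j : nat) :
  Fp (j + 6) * pathp 2 = pathp (j + 9) + 'X^5 * ((1 + 'X) * h j).
Proof.
rewrite /Fp /pathp [h 2]/= [h (2 - 2)]/= !addnS addn0 !subSS !subn0 !hS.
by ring.
Qed.

(** The defect starts with +X^5 for every such i, below that of a path on i + 3 >= 9 vertices. Hence
    all cycles have length at least 5 and exactly one has length 5; the coefficient of X^6 then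
    comes out positive. *)
Lemma Fp_cyclep_neq (i : nat) (cs : seq nat) :
  (6 <= i)%N -> all (leq 3) cs ->
  Fp i * pathp 2 * \prod_(c <- cs) cyclep c <> pathp (i + 3 + sumn cs).
Proof.
move=> i6 cs3; have [j ->] : exists j, i = (j + 6)%N by exists (i - 6)%N; lia.
rewrite Fp6 (_ : j + 6 + 3 = j + 9)%N; last by lia.
set P := _ + _ => E.
pose N := (3 * j + 2 * sumn cs + 50)%N.
have SN : (sumn cs + 6 <= N)%N by lia.
have EN : P * (h N * \prod_(c <- cs) cyclep c) = pathp (j + 9 + sumn cs) * h N.
  by rewrite -E; ring.
have [v Ev] : eqmX 2 P (1 + (j + 9)%:R * 'X).
  have [|w Ew] := @pathp1 (j + 9); first by lia.
  by rewrite /P Ew; exists (w + 'X^3 * ((1 + 'X) * h j)); ring.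
have P1 : eqmX 1 P 1 by rewrite Ev; exists ((j + 9)%:R + 'X * v); ring.
(* [l] is the linear coefficient of [h j], which equals j - 1 except at j = 0, where it is 0. *)
have [l [l0 El]] : exists l : int, j%:Z - 1 <= l /\ eqmX 2 (h j) (1 + l%:~R * 'X).
  case: (j) => [|j']; first by exists 0; split=> //; exists 0; rewrite /=; ring.
  exists j'%:Z; split; first by lia.
  by have [w ->] := h_lin j'; exists w; rewrite pmulrn.
have Ep : eqmX 8 (pathp (j + 9) * h (N + sumn cs) - pathp (j + 9 + sumn cs) * h N) 0.
  have [->|S0] := posnP (sumn cs); first by rewrite !addn0; exists 0; ring.
  apply: eqmX_trans (eqmX_weaken _ (@pathp_h_const (sumn cs) (j + 9) N S0 ltac:(lia) ltac:(lia))) _.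
    by lia.
  by apply: eqmX0; lia.
have HR : eqmX 7 (P * h (N + sumn cs) - pathp (j + 9 + sumn cs) * h N)
    ('X^5 * (1%:~R + (1 + l + N%:Z + (sumn cs)%:Z - 1)%:~R * 'X)).
  have [w Ew] := Ep.
  have -> : P * h (N + sumn cs) - pathp (j + 9 + sumn cs) * h N
    = 'X^8 * w + 'X^5 * ((1 + 'X) * h j * h (N + sumn cs)).
    by rewrite -[X in _ = X + _]add0r -Ew /P; ring.
  have [w' Ew'] : eqmX 2 (h (N + sumn cs)) (1 + (N%:Z + (sumn cs)%:Z - 1)%:~R * 'X).
    have [M NM] : exists M, (N + sumn cs)%N = M.+1 by exists (N + sumn cs - 1)%N; lia.
    rewrite NM; have [w' ->] := h_lin M.
    have -> : N%:Z + (sumn cs)%:Z - 1 = M%:Z by lia.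
    by exists w'; rewrite pmulrn.
  have H : eqmX 2 ((1 + 'X) * h j * h (N + sumn cs))
     (1%:~R + (1 + l + N%:Z + (sumn cs)%:Z - 1)%:~R * 'X).
    apply: eqmX_trans (eqmXM (eqmXM (eqmX_refl _ _) El) (ex_intro _ w' Ew')) _.
    set a := l%:~R; set b := (N%:Z + _ - 1)%:~R.
    have -> : (1 + l + N%:Z + (sumn cs)%:Z - 1)%:~R = 1 + a + b :> {poly int}.
      by rewrite /a /b; ring.
    by exists (a + b + a * b + 'X * a * b); ring.
  apply: eqmX_trans (eqmXD (eqmX0 _ _) (eqmX_shift 5 H)) _ => //.
  by rewrite add0r; apply: eqmX_refl.
have key := eqmX_cancel EN.
have cs5 : all (leq 5) cs.
  apply/allP => c ccs; have [|b bcs bmin] := @seq_min cs; first by case: (cs) ccs.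
  apply: leq_trans (allP bmin c ccs); rewrite leqNgt; apply/negP => b5.
  have b3 : (3 <= b)%N := allP cs3 b bcs.
  have HRb := eqmX_trans (eqmX_weaken _ HR) (eqmX0 _ _).
  have /negP := short_cycle_contra P1 EN (HRb b.+1 ltac:(lia) ltac:(lia)) SN b3 bmin.
  by apply.
have HQ := @prod_cyclep_h_const 5 N cs isT cs5 SN.
have H := key _ _ _ _ HQ (eqmX_weaken (isT : 6 <= 7)%N HR).
have cm1 : count_mem 5 cs = 1%N.
  suff /(@eqmX_const_eq0 5) :
    eqmX 6 ('X^5 * (cycle_sign 5 * (count_mem 5 cs)%:Z + 1)%:~R) 0.
    by rewrite /cycle_sign /=; move: (count_mem 5 cs) => x; clear; lia.
  apply: eqmX_trans _ H; rewrite rmorphD /= mulrDr; apply: eqmXD.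
    exact: eqmX_sym (eqmX1_mul _ _ P1).
  by exists (- (1 + l + N%:Z + (sumn cs)%:Z - 1)%:~R); ring.
have HQ1 := @prod_cyclep_h_lin 5 N cs isT erefl cs5 cm1 ltac:(lia).
have H1 := key _ _ _ _ HQ1 HR.
suff : 2 - j%:Z + l + 2 * (count_mem 6 cs)%:Z = 0.
  by move: (count_mem 6 cs) l0 => x; clear; lia.
apply: proj2 (@eqmX_lin_eq0 5 0 _ _).
apply: eqmX_trans _ H1; rewrite Ev.
move: (count_mem _ _)%:Z (sumn cs)%:Z (N%:Z) => c1 s1 M.
exists (v - (2 * 5 + 1 - M - s1 + 2 * c1)%:~R * ((j + 9)%:R + v * 'X)).
by ring.
Qed.
End TopOrder.

(** * Decomposing graphs of small degree *)

Section Structure.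

Section Induced.
Variables (G : sgraph) (U : {set G}).
Definition induced_adj : rel {x : G | x \in U} := fun x y => adj (val x) (val y).
Lemma induced_sym : symmetric induced_adj.
Proof. by move=> x y; rewrite /induced_adj adj_sym. Qed.
Lemma induced_irr : irreflexive induced_adj.
Proof. by move=> x; rewrite /induced_adj adj_irr. Qed.
Definition induced : sgraph := SGraph induced_sym induced_irr.
End Induced.

(** These sets are the unions of connected components. *)
Definition nbr_closed (G : sgraph) (U : {set G}) : Prop :=
  forall x y, x \in U -> adj x y -> y \in U.

Lemma nbr_closedC (G : sgraph) (U : {set G}) : nbr_closed U -> nbr_closed (~: U).
Proof.
move=> cU x y; rewrite !inE => xU xy; apply: contra xU => yU.
by apply: cU yU _; rewrite adj_sym.
Qed.

Lemma card_induced (G : sgraph) (U : {set G}) : #|induced U| = #|U|.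
Proof. by rewrite card_sig; apply: eq_card => x; rewrite inE. Qed.

Lemma degree_induced (G : sgraph) (U : {set G}) (x : induced U) :
  nbr_closed U -> degree x = degree (val x).
Proof.
move=> cU; rewrite /degree -(card_imset _ val_inj); apply: eq_card => y.
rewrite inE; apply/imsetP/idP => [[z]|xy]; first by rewrite inE => ? ->.
have yU : y \in U by apply: cU xy; apply: valP.
by exists (Sub y yU); rewrite ?inE.
Qed.

Lemma closed_dunion (G : sgraph) (U : {set G}) : nbr_closed U ->
  exists f : dunion (induced U) (induced (~: U)) -> G,
    [/\ bijective f, forall x y, adj (f x) (f y) = adj x y,
        forall a, f (inl a) = val a & forall b, f (inr b) = val b].
Proof.
move=> cU.
pose f (x : dunion (induced U) (induced (~: U))) : G :=
  match x with inl a => val a | inr b => val b end.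
exists f; split=> //; last first.
  have UC (a : induced U) (b : induced (~: U)) : adj (val a) (val b) = false.
    apply/negbTE/negP => ab; have := valP b; rewrite inE => /negP; apply.
    exact: cU (valP a) ab.
  by move=> [a|a] [b|b] //=; rewrite ?UC // adj_sym UC.
have ne (a : induced U) (b : induced (~: U)) : sval a <> sval b.
  by case: a b => a aU [b bU] /= ab; move: bU; rewrite inE -ab aU.
apply: inj_card_bij.
  move=> [a|a] [b|b] //= ab; first by congr inl; apply: val_inj.
  - by case: (ne _ _ ab).
  - by case: (ne _ _ (esym ab)).
  by congr inr; apply: val_inj.
by rewrite card_sum !card_induced cardsC.
Qed.

(** Greedy extension at the far end; the order of the graph bounds the length of a path without
    repetition. *)
Lemma maximal_path (G : sgraph) (v : G) :
  exists p, [/\ path (@adj G) v p, uniq (v :: p) &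
                forall y, adj (last v p) y -> y \in v :: p].
Proof.
set n := #|G|.
suff H k p : (n - size p < k)%N -> path (@adj G) v p -> uniq (v :: p) ->
    exists p, [/\ path (@adj G) v p, uniq (v :: p) &
                forall y, adj (last v p) y -> y \in v :: p].
  exact: (H _ [::] (ltnSn _)).
elim: k p => // k IH p pk vp up.
have [/existsP[y /andP[ly yp]]|/existsPn H] :=
  boolP [exists y, adj (last v p) y && (y \notin v :: p)]; last first.
  by exists p; split=> // y ly; have := H y; rewrite ly negbK.
apply: (IH (rcons p y)).
- have : (#|v :: p| < n)%N.
    rewrite /n -(cardC (mem (v :: p))) -[X in (X < _)%N]addn0 ltn_add2l.
    by apply/card_gt0P; exists y; rewrite !inE in yp *.
  by rewrite (card_uniqP up) size_rcons /=; lia.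
- by rewrite rcons_path vp ly.
by rewrite -rcons_cons rcons_uniq yp up.
Qed.

Section PathNbrs.
Variables (G : sgraph) (v : G) (p : seq G).
Hypotheses (vp : path (@adj G) v p) (up : uniq (v :: p)).
Hypothesis lastp : forall y, adj (last v p) y -> y \in v :: p.
Hypothesis deg2 : forall x : G, (degree x <= 2)%N.
Let s := v :: p.
Let x_ i := nth v s i.

Lemma path_nth_adj (i : nat) : (i.+1 < size s)%N -> adj (x_ i) (x_ i.+1).
Proof. by move=> ip; apply: (pathP v vp). Qed.

Lemma path_nth_eq (i j : nat) : (i < size s)%N -> (j < size s)%N ->
  (x_ i == x_ j) = (i == j).
Proof. by move=> ip jp; rewrite nth_uniq. Qed.

Lemma path_mid_nbr (i : nat) (y : G) : (i.+2 < size s)%N ->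
  adj (x_ i.+1) y = (y == x_ i) || (y == x_ i.+2).
Proof.
move=> ip; have ip0 : (i < size s)%N by apply: ltnW (ltnW ip).
have : [set x_ i; x_ i.+2] = [set y | adj (x_ i.+1) y].
  apply/eqP; rewrite eqEcard cards2 path_nth_eq //.
  rewrite (ltn_eqF (leqnSn i.+1)) (deg2 (x_ i.+1)) andbT.
  apply/subsetP => z; rewrite !inE => /orP[] /eqP->; last exact: path_nth_adj.
  by rewrite adj_sym; apply: path_nth_adj; apply: ltnW.
by move=> /setP/(_ y); rewrite !inE => <-.
Qed.

(** An inner vertex already has both of its neighbours on the path, and the last vertex is covered
    by maximality; the hypothesis takes care of the first. *)
Lemma path_closed : (forall y, adj v y -> y \in s) ->
  nbr_closed [set x in s].
Proof.
move=> v_s x y; rewrite !in_set => xs xy; have := xs; rewrite -index_mem => ix.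
have xE : x_ (index x s) = x by apply: nth_index.
case E : (index x s) ix xE => [|i] ix xE; first by apply: v_s; rewrite [v]xE.
have [ip|ip] := ltnP i.+2 (size s).
  have := path_mid_nbr y ip; rewrite xE xy => /esym/orP[] /eqP->; apply: mem_nth => //.
  by rewrite ltnW // ltnW.
apply: lastp; suff -> : last v p = x by [].
rewrite -[RHS]xE (last_nth v); congr nth; move: ix ip; rewrite /s /=; lia.
Qed.

Lemma path_lt_adj (i j : nat) : (0 < i)%N -> (i < j)%N -> (j < size s)%N ->
  adj (x_ i) (x_ j) = (i.+1 == j).
Proof.
case: i => // i _ ij js; rewrite path_mid_nbr ?(leq_trans _ js) //.
rewrite !path_nth_eq; [|lia..].
by rewrite eq_sym (ltn_eqF (ltnW ij)) [RHS]eq_sym.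
Qed.
End PathNbrs.

Lemma isomorphic_of_nth (G H : sgraph) (v : G) (s : seq G) (f : H -> nat) :
  uniq s -> injective f -> (forall x, f x < size s)%N -> #|H| = size s ->
  (forall x y, adj (nth v s (f x)) (nth v s (f y)) = adj x y) ->
  exists g : H -> induced [set x in s], [/\ bijective g,
    forall x y, adj (g x) (g y) = adj x y &
    forall x, val (g x) = nth v s (f x)].
Proof.
move=> us fI fs Hs fadj.
have gP x : nth v s (f x) \in [set x in s] by rewrite inE mem_nth.
exists (fun x => Sub (nth v s (f x)) (gP x)); split=> [|x y|x].
- apply: inj_card_bij.
    by move=> x y /(congr1 val) /= /eqP; rewrite nth_uniq // => /eqP/fI.
  by rewrite card_induced cardsE (card_uniqP us) Hs.
- by rewrite -fadj.
by [].
Qed.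

Definition two_regular (G : sgraph) : Prop := forall x : G, degree x = 2%N.

Lemma two_regular_induced (G : sgraph) (U : {set G}) :
  nbr_closed U -> (forall x, x \in U -> degree x = 2%N) ->
  two_regular (induced U).
Proof. by move=> cU dU x; rewrite degree_induced // dU //; apply: valP. Qed.

(** The inner vertices of a maximal path from v are saturated, so the second neighbour of its last
    vertex can only be v. The last clause places v at vertex 0 of the cycle, so that a pendant edge
    at v can be put back later. *)
Lemma cycle_component (G : sgraph) (v : G) : two_regular G ->
  exists c (Z : sgraph) (g : dunion (cycle_graph c.+3) Z -> G),
    [/\ two_regular Z, bijective g, forall x y, adj (g x) (g y) = adj x y &
        forall x, (g (inl x) == v) = (x == 0 :> nat)].
Proof.
move=> regG; have [p [vp up lastp]] := maximal_path v.
have deg2 (x : G) : (degree x <= 2)%N by rewrite regG.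
pose s := v :: p; pose x_ i := nth v s i.
have lastE : last v p = x_ (size p) by rewrite (last_nth v).
have last_nbr y : adj (last v p) y -> y \in [set v; x_ (size p).-1].
  move=> ly; have ys := lastp y ly; rewrite !inE.
  have : (index y s < size s)%N by rewrite index_mem.
  have yE : x_ (index y s) = y by apply: nth_index.
  case E : (index y s) yE => [|j] yE js; first by rewrite -yE eqxx.
  have [jp|jp] := ltnP j.+2 (size s).
    have := path_mid_nbr vp up deg2 (last v p) jp.
    rewrite -/s -/(x_ j.+1) yE adj_sym ly lastE -/(x_ j) -/(x_ j.+2).
    rewrite !path_nth_eq //; [|by rewrite ltnW // ltnW].
    by move=> /esym/orP[] /eqP jE; [move: jp|]; rewrite /s /= ?jE ?yE ?eqxx ?orbT //; lia.
  have jE : j.+1 = size p by move: js jp; rewrite /s /=; lia.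
  by move: ly; rewrite lastE -jE yE adj_irr.
have Nlast : [set y | adj (last v p) y] = [set v; x_ (size p).-1].
  apply/eqP; rewrite eqEcard -[#|[set y | _]|]/(degree _) regG cards2.
  by rewrite ltnS leq_b1 andbT; apply/subsetP => y; rewrite inE; apply: last_nbr.
have vx : v != x_ (size p).-1.
  by have := regG (last v p); rewrite /degree Nlast cards2; case: eqP.
have [c pc] : exists c, size p = c.+2.
  move: vx; rewrite /x_ /s; case: (size p) => [|[|c]] /=; rewrite ?eqxx // => _.
  by exists c.
have sc : size s = c.+3 by rewrite /s /= pc.
have lv : adj (last v p) v by have /setP/(_ v) := Nlast; rewrite !inE eqxx.
have v1 : adj v (x_ 1) by apply: (path_nth_adj vp (i := 0)); rewrite /= pc.
have eqx i j : (i < c.+3)%N -> (j < c.+3)%N -> (x_ i == x_ j) = (i == j).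
  by move=> ic jc; rewrite /x_ nth_uniq ?sc.
have vE : v = x_ 0 by [].
have v_nbr y : adj v y = (y == x_ 1) || (y == x_ c.+2).
  have : [set x_ 1; x_ c.+2] = [set y | adj v y].
    apply/eqP; rewrite eqEcard cards2 eqx // -[#|[set y | _]|]/(degree _) regG andbT.
    apply/subsetP => z; rewrite !inE => /orP[] /eqP->//.
    by rewrite adj_sym -pc -lastE.
  by move=> /setP/(_ y); rewrite !inE => <-.
have adj_lt i j : (i < j)%N -> (j < c.+3)%N ->
    adj (x_ i) (x_ j) = (i.+1 == j) || (i == 0)%N && (j == c.+2).
  move=> ij jc; case: i ij => [|i] ij.
    by rewrite -vE v_nbr !eqx // eq_sym.
  by rewrite orbF (path_lt_adj vp up deg2) // -/s sc.
have adjC (i j : 'I_c.+3) : adj (x_ i) (x_ j) = cycle_adj i j.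
  wlog ij : i j / (i <= j)%N => [H|].
    by case/orP: (leq_total i j) => ij; [|rewrite adj_sym cycle_sym]; apply: H.
  have [eij|nij] := eqVneq i j; first by rewrite eij cycle_irr adj_irr.
  have {}ij : (i < j)%N by rewrite ltn_neqAle ij andbT.
  have ji := ltn_ord j; rewrite adj_lt // /cycle_adj nij /= -!val_eqE /=.
  rewrite (modn_small (leq_ltn_trans ij ji)); congr (_ || _).
  have [jE|jN] := eqVneq (j : nat) c.+2; first by rewrite jE modnn andbT eq_sym.
  by rewrite modn_small ?andbF; [apply/esym/negbTE|]; lia.
have cs : nbr_closed [set x in s].
  apply: path_closed => // y; rewrite v_nbr => /orP[] /eqP->; apply: mem_nth;
  by rewrite sc.
have [g0 [bg0 adjg0 g0E]] := @isomorphic_of_nth G (cycle_graph c.+3) v s val up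
   val_inj ltac:(by move=> x; rewrite sc; apply: ltn_ord)
   ltac:(by rewrite card_ord sc) adjC.
have [f [bf adjf fl fr]] := closed_dunion cs.
pose k (x : dunion (cycle_graph c.+3) (induced (~: [set x in s]))) :
    dunion (induced [set x in s]) (induced (~: [set x in s])) :=
  match x with inl a => inl (g0 a) | inr b => inr b end.
have bk : bijective k.
  have [g1 g1K g0K] := bg0.
  by exists (fun x => match x with inl a => inl (g1 a) | inr b => inr b end) => -[a|b] //=;
     rewrite ?g1K ?g0K.
exists c, (induced (~: [set x in s])), (f \o k); split=> [|||x].
- by apply: two_regular_induced => //; apply: nbr_closedC.
- exact: bij_comp.
- by move=> [a|a] [b|b] /=; rewrite adjf //=; apply: adjg0.
by rewrite /= fl g0E -/(x_ x) vE eqx.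
Qed.

Lemma two_regular_codom_poly (G : sgraph) : two_regular G ->
  exists cs, [/\ all (leq 3) cs, sumn cs = #|G| &
    codom_poly G = (\prod_(c <- cs) cyclep c)%R].
Proof.
have [n] := ubnP #|G|; elim: n G => // n IHn G Gn regG.
have [v _|G0] := pickP (mem G); last first.
  exists [::]; split=> //; first by apply/esym/eq_card0.
  rewrite big_nil /codom_poly (big_pred1 set0) ?cards0 ?GRing.expr0 // => T.
  have -> : T = set0 by apply/setP => x; have := G0 x; rewrite inE.
  by rewrite [RHS]eqxx; apply/forallP => x; have := G0 x; rewrite inE.
have [c [Z [g [regZ bg adjg _]]]] := cycle_component v regG.
have iso : isomorphic (dunion (cycle_graph c.+3) Z) G by exists g.
have cG := isomorphic_card iso; rewrite card_sum card_ord in cG.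
have [|cs [cs3 csZ csE]] := IHn Z _ regZ; first by move: Gn; rewrite -cG; lia.
exists (c.+3 :: cs); split=> //=; first by rewrite csZ cG.
rewrite -(isomorphic_codom_poly iso) codom_poly_dunion codom_poly_cycle csE big_cons.
by rewrite /cyclep !subSS !subn0.
Qed.

Lemma dunion_empty (G Z : sgraph) : #|Z| = 0%N -> isomorphic (dunion G Z) G.
Proof.
move=> /card0_eq Z0.
have f_ (z : Z) : G by have := Z0 z; rewrite inE.
exists (fun x => match x with inl a => a | inr z => f_ z end).
  by exists inl => [[a|z]|a] //; have := Z0 z; rewrite inE.
by move=> [a|z] [b|z'] //=; [have := Z0 z' | have := Z0 z | have := Z0 z]; rewrite inE.
Qed.

(** The last vertex of a maximal path from l turns out to have degree 1, so it is l'. The final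
    clause expresses that G is connected when nothing remains outside the path. *)
Lemma path_component (G : sgraph) (l l' : G) : l != l' ->
  degree l = 1%N -> degree l' = 1%N ->
  (forall x, x != l -> x != l' -> degree x = 2%N) ->
  exists m (Z : sgraph), [/\ two_regular Z,
    isomorphic (dunion (path_graph m.+2) Z) G &
    #|Z| = 0%N -> forall U : {set G}, nbr_closed U -> l \in U -> U = setT].
Proof.
move=> ll' dl dl' dA.
have deg2 (x : G) : (degree x <= 2)%N.
  have [->|xl] := eqVneq x l; first by rewrite dl.
  by have [->|xl'] := eqVneq x l'; rewrite ?dl' ?dA.
have deg1 (x : G) : (0 < degree x)%N.
  have [->|xl] := eqVneq x l; first by rewrite dl.
  by have [->|xl'] := eqVneq x l'; rewrite ?dl' ?dA.
have [p [lp up lastp]] := maximal_path l.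
pose s := l :: p; pose x_ i := nth l s i.
have lastE : last l p = x_ (size p) by rewrite (last_nth l).
have p0 : (0 < size p)%N.
  rewrite lt0n size_eq0; apply/eqP => p0; move: lastp; rewrite p0 /= => lastp.
  have /card_gt0P[y] := deg1 l; rewrite inE => ly.
  by have := lastp y ly; rewrite inE => /eqP yl; rewrite yl adj_irr in ly.
have [m pm] : exists m, size p = m.+1 by exists (size p).-1; rewrite prednK.
have sm : size s = m.+2 by rewrite /s /= pm.
have lE : l = x_ 0 by [].
have eqx i j : (i < m.+2)%N -> (j < m.+2)%N -> (x_ i == x_ j) = (i == j).
  by move=> ic jc; rewrite /x_ nth_uniq ?sm.
have l1 : adj l (x_ 1) by apply: (path_nth_adj lp (i := 0)); rewrite /= pm.
have l_nbr y : adj l y = (y == x_ 1).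
  have : [set x_ 1] = [set y | adj l y].
    apply/eqP; rewrite eqEcard cards1 -[#|[set y | _]|]/(degree _) dl andbT.
    by apply/subsetP => z; rewrite !inE => /eqP->.
  by move=> /setP/(_ y); rewrite !inE.
have adj_lt i j : (i < j)%N -> (j < m.+2)%N -> adj (x_ i) (x_ j) = (i.+1 == j).
  move=> ij jm; case: i ij => [|i] ij; first by rewrite -lE l_nbr eqx // eq_sym.
  by rewrite (path_lt_adj lp up deg2) // -/s sm.
have adjP (i j : 'I_m.+2) : adj (x_ i) (x_ j) = path_adj i j.
  wlog ij : i j / (i <= j)%N => [H|].
    by case/orP: (leq_total i j) => ij; [|rewrite adj_sym path_sym]; apply: H.
  have [eij|nij] := eqVneq i j; first by rewrite eij path_irr adj_irr.
  have {}ij : (i < j)%N by rewrite ltn_neqAle ij andbT.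
  by rewrite adj_lt // /path_adj [X in _ || X]gtn_eqF ?orbF // ltnW.
have cs : nbr_closed [set x in s].
  apply: path_closed => // y; rewrite l_nbr => /eqP->; apply: mem_nth.
  by rewrite sm.
have [g0 [bg0 adjg0 _]] := @isomorphic_of_nth G (path_graph m.+2) l s val up
   val_inj ltac:(by move=> x; rewrite sm; apply: ltn_ord)
   ltac:(by rewrite card_ord sm) adjP.
have last_leaf : degree (last l p) = 1%N.
  have lm : last l p = x_ m.+1 by rewrite lastE pm.
  apply/eqP; rewrite eqn_leq deg1 andbT; apply: leq_trans (_ : #|[set x_ m]| <= 1)%N;
    last by rewrite cards1.
  apply/subset_leq_card/subsetP => y; rewrite !inE => ly.
  have ys := lastp y ly.
  have yE : x_ (index y s) = y by apply: nth_index.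
  have jm : (index y s < m.+2)%N by rewrite -sm index_mem.
  move: (index y s) yE jm ly => j <-; rewrite lm adj_sym.
  have [->|jm1] := eqVneq j m.+1; first by rewrite adj_irr.
  move=> jm2; have im1 : (j < m.+1)%N by rewrite ltn_neqAle jm1 -ltnS.
  by rewrite adj_lt // eqSS eqx // ltnW.
have lastl : last l p = l'.
  apply/eqP; apply: contraT => Nl'.
  have : degree (last l p) = 2%N.
    by apply: dA => //; rewrite lastE pm lE eqx.
  by rewrite last_leaf.
have sC x : x \notin [set x in s] -> degree x = 2%N.
  rewrite in_set => xs; apply: dA; apply: contraNneq xs => ->; first exact: mem_head.
  by rewrite -lastl; apply: mem_last.
exists m, (induced (~: [set x in s])); split.
- by apply: two_regular_induced => [|x]; [apply: nbr_closedC|rewrite in_setC; apply: sC].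
- apply: isomorphic_trans (_ : isomorphic _ (dunion (induced [set x in s]) (induced (~: [set x in s])))) _.
    by apply: isomorphic_dunion (isomorphic_refl _); exists g0.
  by have [f [bf adjf _ _]] := closed_dunion cs; exists f.
rewrite card_induced => /eqP; rewrite cards_eq0 => /eqP sT U cU lU.
have xU i : (i < m.+2)%N -> x_ i \in U.
  elim: i => [|i IHi] im //; apply: cU (IHi (ltnW im)) _.
  by apply: path_nth_adj; rewrite // -/s sm.
apply/setP => x; rewrite inE.
have xs : x \in s.
  by apply: contraT => xs; have /setP/(_ x) := sT; rewrite !in_set xs.
by rewrite -(nth_index l xs); apply: xU; rewrite -sm index_mem.
Qed.
End Structure.

(** * Low coefficients of the path polynomial *)

Section PathCoefficients.
Import GRing.Theory.
Local Open Scope ring_scope.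

Lemma pathpS (k : nat) :
  pathp k.+1.+4 = pathp k.+4 + 'X * pathp k.+3 + 'X^2 * pathp k.+2.
Proof. by rewrite /pathp !subSS !subn0 !hS; ring. Qed.

(** With n = K + 5, these are 24 times C(n,i) - b_i for i = 1, ..., 4, where b_i is 0, 2, 3n - 8 and
    2 C(n-2,2) + (n-4)^2 - 2: the number of i-sets of P_n that contain a closed neighbourhood. The
    factor 24 clears the denominators. *)
Let c1 (K : int) : int := 24 * (K + 5).
Let c2 (K : int) : int := 12 * ((K + 5) * (K + 4) - 4).
Let c3 (K : int) : int := 4 * ((K + 5) * (K + 4) * (K + 3)) - 24 * (3 * K + 7).
Let c4 (K : int) : int := (K + 5) * (K + 4) * (K + 3) * (K + 2)
  - 24 * ((K + 3) * (K + 2) - 2 + (K + 1) * (K + 1)).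

(** The formula for X^4 sets the start at n = 5: at n = 4 it would give the coefficient 1, whereas
    [pathp 4] has degree 2. *)
Lemma pathp_expansion (k : nat) :
  eqmX 5 (24%:~R * pathp k.+1.+4)
    (24%:~R + (c1 k)%:~R * 'X + (c2 k)%:~R * 'X^2 + (c3 k)%:~R * 'X^3
     + (c4 k)%:~R * 'X^4).
Proof.
pose Q k := 24%:~R + (c1 k)%:~R * 'X + (c2 k)%:~R * 'X^2
     + (c3 k)%:~R * 'X^3 + (c4 k)%:~R * 'X^4 : {poly int}.
suff [//] : [/\ eqmX 5 (24%:~R * pathp k.+1.+4) (Q k),
  eqmX 5 (24%:~R * pathp k.+2.+4) (Q k.+1)
  & eqmX 5 (24%:~R * pathp k.+3.+4) (Q k.+2)].
elim: k => [|k [H0 H1 H2]].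
  by split; exists 0; rewrite /Q /c1 /c2 /c3 /c4 /pathp /=; ring.
split=> //; case: H0 H1 H2 => w0 E0 [w1 E1] [w2 E2].
exists (w2 + 'X * w1 + 'X^2 * w0 + (c4 k.+1)%:~R + (c3 k)%:~R + (c4 k)%:~R * 'X).
have -> : 24%:~R * pathp k.+4.+4 = 24%:~R * pathp k.+3.+4
  + 'X * (24%:~R * pathp k.+2.+4) + 'X^2 * (24%:~R * pathp k.+1.+4).
  by rewrite (pathpS k.+3); ring.
rewrite E0 E1 E2 /Q /c1 /c2 /c3 /c4.
ring.
Qed.

Lemma pathp_coef (k : nat) :
  [/\ 24 * (pathp k.+1.+4)`_1 = c1 k, 24 * (pathp k.+1.+4)`_2 = c2 k,
      24 * (pathp k.+1.+4)`_3 = c3 k & 24 * (pathp k.+1.+4)`_4 = c4 k].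
Proof.
have [w E] := pathp_expansion k.
have co i : (i < 5)%N -> 24 * (pathp k.+1.+4)`_i = [:: 24; c1 k; c2 k; c3 k; c4 k]`_i.
  move=> i5; have := congr1 (fun u : {poly int} => u`_i) E.
  rewrite !intr_polyC coefCM => ->; rewrite !coefD coefXnM i5 addr0 !coefCM coefC !coefXn coefX.
  by case: i i5 => [|[|[|[|[|//]]]]] _ /=; ring.
by split; rewrite co.
Qed.

Lemma num_codom_path (G : sgraph) (n : nat) :
  #|G| = n -> (3 <= n)%N -> codom_poly G = pathp n ->
  [/\ num_codom G 1 = n, (num_codom G 2 + 2 = 'C(n, 2))%N,
      (num_codom G 3 + (3 * n - 8) = 'C(n, 3))%N &
      (5 <= n)%N ->
      (num_codom G 4 + (2 * 'C(n - 2, 2) + (n - 4) * (n - 4) - 2) = 'C(n, 4))%N].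
Proof.
move=> Gn n3 En.
have co k : (num_codom G k)%:R = (pathp n)`_k :> int by rewrite -coef_codom_poly En.
have [n5|n5] := ltnP n 5.
  have [nE|nE] : n = 3%N \/ n = 4%N by lia.
    have pE : pathp n = 1 + 3%:P * 'X + 'X^2 by rewrite nE /pathp /=; ring.
    move: (co 1%N) (co 2%N) (co 3%N).
    rewrite pE !coefD !coefCM !coefX !coefXn !coef1 nE /= => e1 e2 e3.
    have b2 : 'C(3, 2) = 3%N by []. have b3 : 'C(3, 3) = 1%N by [].
    by rewrite b2 b3; split; lia.
  have pE : pathp n = 1 + 4%:P * 'X + 4%:P * 'X^2 by rewrite nE /pathp /=; ring.
  move: (co 1%N) (co 2%N) (co 3%N).
  rewrite pE !coefD !coefCM !coefX !coefXn !coef1 nE /= => e1 e2 e3.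
  have b2 : 'C(4, 2) = 6%N by []. have b3 : 'C(4, 3) = 4%N by [].
  by rewrite b2 b3; split; lia.
have [k nk] : exists k, n = k.+1.+4 by exists (n - 5)%N; lia.
have [e1 e2 e3 e4] := pathp_coef k.
move: (co 1%N) (co 2%N) (co 3%N) (co 4%N) => f1 f2 f3 f4.

have b2 : 2 * 'C(n, 2)%:Z = (k%:Z + 5) * (k%:Z + 4).
  by have := congr1 Posz (bin_ffact n 2); rewrite nk !ffactnS ffactn0 !factS fact0 !muln1; lia.
have b3 : 6 * 'C(n, 3)%:Z = (k%:Z + 5) * (k%:Z + 4) * (k%:Z + 3).
  transitivity (n ^_ 3)%N%:Z; first by rewrite -bin_ffact !factS fact0; lia.
  by rewrite nk !ffactnS ffactn0 !PoszM /=; ring.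
have b4 : 24 * 'C(n, 4)%:Z = (k%:Z + 5) * (k%:Z + 4) * (k%:Z + 3) * (k%:Z + 2).
  transitivity (n ^_ 4)%N%:Z; first by rewrite -bin_ffact !factS fact0; lia.
  by rewrite nk !ffactnS ffactn0 !PoszM /=; ring.
have b2' : 2 * 'C(n - 2, 2)%:Z = (k%:Z + 3) * (k%:Z + 2).
  by have := congr1 Posz (bin_ffact (n - 2) 2); rewrite nk !subSS subn0 !ffactnS ffactn0 !factS fact0 !muln1; lia.
have s4 : ((n - 4) * (n - 4))%N%:Z = (k%:Z + 1) * (k%:Z + 1) by rewrite nk; lia.
rewrite nk in f1 f2 f3 f4; rewrite -f1 /c1 in e1; rewrite -f2 /c2 -b2 in e2; rewrite -f3 /c3 -b3 in e3.
rewrite -f4 /c4 -b4 -b2' -s4 in e4.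
clear b2 b3 b4 f1 f2 f3 f4 co En.
(* This keeps the subtraction of 2 in the count of four-sets from being truncated. *)
have B2' : (1 <= 'C(n - 2, 2))%N by rewrite bin_gt0; lia.
move: ('C(n - 2, 2)) (((n - 4) * (n - 4))%N) B2' b2' s4 e4 => B2' S4 B2'1 _ _ e4.
move: (num_codom G 1) (num_codom G 2) (num_codom G 3) (num_codom G 4) e1 e2 e3 e4.
move=> N1 N2 N3 N4 e1 e2 e3 e4.
by split=> [|||_]; lia.
Qed.
End PathCoefficients.

(** * Counting small non-dominating complements *)

Section Counting.

Lemma card_supersets (T : finType) (E : {set T}) (k : nat) : (#|E| <= k)%N ->
  #|[set S : {set T} | E \subset S & #|S| == k]| = 'C(#|T| - #|E|, k - #|E|).
Proof.
move=> Ek; have <- : #|~: E| = (#|T| - #|E|)%N by rewrite -(cardsC E) addKn.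
rewrite -cards_draws -[RHS](card_in_imset (f := fun S => E :|: S)); last first.
  move=> A B; rewrite !inE => /andP[AE _] /andP[BE _] /setP AB.
  have nE (C : {set T}) x : C \subset ~: E -> x \in C -> x \notin E.
    by move=> /subsetP CE /CE; rewrite inE.
  apply/setP => x; have := AB x; rewrite !inE.
  have [xE _|_ //] := boolP (x \in E).
  have /negPf-> : x \notin A := contraTN (nE _ _ AE) xE.
  by have /negPf-> : x \notin B := contraTN (nE _ _ BE) xE.
apply: eq_card => S; rewrite inE; apply/andP/imsetP => [[ES /eqP Sk]|[A]].
  exists (S :\: E).
    by rewrite inE subsetDr /= cardsD (setIidPr ES) Sk.
  by apply/setP => x; rewrite !inE; case: (boolP (x \in E)) => //= /(subsetP ES).
rewrite inE => /andP[AE /eqP Ak] ->; split; first exact: subsetUl.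
rewrite cardsU Ak (_ : E :&: A = set0); first by rewrite cards0 subn0 subnKC.
by apply/disjoint_setI0; rewrite disjoint_sym -[E]setCK -subsets_disjoint.
Qed.

Definition num_bad (G : sgraph) (k : nat) : nat :=
  #|[set T : {set G} | ~~ codominating T & #|T| == k]|.

Lemma num_bad_codom (G : sgraph) (k : nat) :
  (num_bad G k + num_codom G k)%N = 'C(#|G|, k).
Proof.
rewrite -card_draws -(cardsID [set T : {set G} | codominating T]) addnC.
by congr addn; apply: eq_card => T; rewrite !inE andbC.
Qed.

Lemma badP (G : sgraph) (T : {set G}) :
  reflect (exists v : G, cnbr v \subset T) (~~ codominating T).
Proof.
rewrite negb_forall; apply: (iffP existsP) => -[v]; rewrite ?negbK => vT; exists v;
by rewrite ?negbK.
Qed.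

Lemma leaf_cnbr (G : sgraph) (l s : G) :
  degree l = 1%N -> adj l s -> cnbr l = [set l; s].
Proof.
move=> dl ls; apply/esym/eqP; rewrite eqEcard card_cnbr dl cards2.
have -> /= : l != s by apply: contraTneq ls => ->; rewrite adj_irr.
by rewrite andbT; apply/subsetP => u; rewrite !inE => /orP[->//|/eqP->]; rewrite ls orbT.
Qed.

Lemma degree_gt0 (G : sgraph) (v : G) : num_bad G 1 = 0%N -> (0 < degree v)%N.
Proof.
move=> /card0_eq b1; rewrite lt0n; apply/eqP => dv; have := b1 (cnbr v).
rewrite !inE card_cnbr dv eqxx andbT => /negbFE/forallP/(_ v).
by rewrite subxx.
Qed.

(** Without isolated vertices, the bad pairs are exactly the closed neighbourhoods of leaves. Pairs
    are counted rather than leaves because both ends of a K_2 component share one. *)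
Lemma leaf_pairs (G : sgraph) : num_bad G 1 = 0%N -> num_bad G 2 = 2 ->
  exists l1 s1 l2 s2 : G,
  [/\ degree l1 = 1%N, degree l2 = 1%N, adj l1 s1, adj l2 s2 & cnbr l1 != cnbr l2]
  /\ forall l, degree l = 1%N -> cnbr l = cnbr l1 \/ cnbr l = cnbr l2.
Proof.
move=> b1 /eqP/cards2P[e1 [e2 [ne E]]].
have leaf_of e : e \in [set e1; e2] -> exists2 l, degree l = 1%N & e = cnbr l.
  rewrite -E inE => /andP[/badP[l le] /eqP e2c].
  have := subset_leq_card le; rewrite card_cnbr e2c ltnS => dl.
  have dl1 : degree l = 1%N by apply/eqP; rewrite eqn_leq dl degree_gt0.
  by exists l => //; apply/esym/eqP; rewrite eqEcard le card_cnbr dl1 e2c.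
have nbr_of (l : G) : exists s, adj l s.
  by have /card_gt0P[s] := degree_gt0 l b1; rewrite inE => ls; exists s.
have [|l1 d1 E1] := leaf_of e1; first by rewrite !inE eqxx.
have [|l2 d2 E2] := leaf_of e2; first by rewrite !inE eqxx orbT.
have [s1 a1] := nbr_of l1; have [s2 a2] := nbr_of l2.
exists l1, s1, l2, s2; split; first by split=> //; rewrite -E1 -E2.
move=> l dl; have : cnbr l \in [set e1; e2].
  by rewrite -E inE card_cnbr dl eqxx andbT; apply/badP; exists l.
by rewrite !inE E1 E2 => /orP[] /eqP->; [left|right].
Qed.

Section TwoLeafPairs.
Variables (G : sgraph) (l1 s1 l2 s2 : G).
Hypotheses (d1 : degree l1 = 1%N) (d2 : degree l2 = 1%N).
Hypotheses (a1 : adj l1 s1) (a2 : adj l2 s2) (ne : cnbr l1 != cnbr l2).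

Let c1 : cnbr l1 = [set l1; s1] := leaf_cnbr d1 a1.
Let c2 : cnbr l2 = [set l2; s2] := leaf_cnbr d2 a2.

Lemma leaf_nbr1 (y : G) : adj l1 y -> y = s1.
Proof.
move=> ly; have /setP/(_ y) := c1; rewrite !inE ly orbT => /esym/orP[] /eqP // yl.
by rewrite yl adj_irr in ly.
Qed.

Lemma leaf_nbr2 (y : G) : adj l2 y -> y = s2.
Proof.
move=> ly; have /setP/(_ y) := c2; rewrite !inE ly orbT => /esym/orP[] /eqP // yl.
by rewrite yl adj_irr in ly.
Qed.

Lemma pair_neq : [/\ l1 != l2, l1 != s1, l2 != s2, l1 != s2 & l2 != s1].
Proof.
have n1 : l1 != s1 by apply: contraTneq a1 => ->; rewrite adj_irr.
have n2 : l2 != s2 by apply: contraTneq a2 => ->; rewrite adj_irr.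
split=> //.
- by apply: contraNneq ne => ->.
- apply: contraNneq ne => E; have s1E : l2 = s1 by apply: leaf_nbr1; rewrite adj_sym E.
  by rewrite c1 c2 -E -s1E setUC.
apply: contraNneq ne => E; have s2E : l1 = s2 by apply: leaf_nbr2; rewrite adj_sym E.
by rewrite c1 c2 -E -s2E setUC.
Qed.

Definition middle : {set G} := ~: [set l1; s1; l2; s2].
Definition has_pair (T : {set G}) : bool := (cnbr l1 \subset T) || (cnbr l2 \subset T).

Lemma middleP (v : G) :
  (v \in middle) = [&& v != l1, v != s1, v != l2 & v != s2].
Proof. by rewrite !inE !negb_or -!andbA. Qed.

Lemma card_middle : (#|middle| + (s1 != s2) + 3)%N = #|G|.
Proof.
have [n12 n1 n2 n12' n21'] := pair_neq.
rewrite -(cardsC middle) /middle setCK -addnA; congr addn.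
have -> : [set l1; s1; l2; s2] = s2 |: [set l1; s1; l2].
  by rewrite [RHS]setUC.
rewrite cardsU1 (_ : #|[set l1; s1; l2]| = 3).
  rewrite !inE (eq_sym s2) (negPf n12') (eq_sym s2 s1) (eq_sym s2) (negPf n2) orbF /=.
  by case: eqP.
by rewrite setUC cardsU1 !inE (negPf n21') (eq_sym l2) (negPf n12) cards2 n1.
Qed.

Lemma has_pair_bad (T : {set G}) : has_pair T -> ~~ codominating T.
Proof. by move=> /orP[] lT; apply/badP; [exists l1|exists l2]. Qed.

(** Inclusion-exclusion over the two pairs, whose union has 3 or 4 elements. The factors [3 <= k]
    and [4 <= k] remove the values where k - 3 or k - 4 would be truncated. *)
Lemma card_has_pair (k : nat) : (2 <= k)%N ->
  (#|[set T : {set G} | has_pair T & #|T| == k]|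
   + (if s1 == s2 then (3 <= k) * 'C(#|G| - 3, k - 3)
      else (4 <= k) * 'C(#|G| - 4, k - 4)) = 2 * 'C(#|G| - 2, k - 2))%N.
Proof.
move=> k2; have [n12 n1 n2 n12' n21'] := pair_neq.
have cc1 : #|cnbr l1| = 2 by rewrite card_cnbr d1.
have cc2 : #|cnbr l2| = 2 by rewrite card_cnbr d2.
pose S1 := [set T : {set G} | cnbr l1 \subset T & #|T| == k].
pose S2 := [set T : {set G} | cnbr l2 \subset T & #|T| == k].
have -> : [set T : {set G} | has_pair T & #|T| == k] = S1 :|: S2.
  by apply/setP => T; rewrite !inE andb_orl.
have cS1 : #|S1| = 'C(#|G| - 2, k - 2) by rewrite card_supersets cc1.
have cS2 : #|S2| = 'C(#|G| - 2, k - 2) by rewrite card_supersets cc2.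
have -> : (if s1 == s2 then (3 <= k) * 'C(#|G| - 3, k - 3)
      else (4 <= k) * 'C(#|G| - 4, k - 4))%N = #|S1 :&: S2|.
  pose U := cnbr l1 :|: cnbr l2.
  have -> : S1 :&: S2 = [set T : {set G} | U \subset T & #|T| == k].
    by apply/setP => T; rewrite !inE subUset; case: (#|T| == k); rewrite ?andbF ?andbT.
  have cU : #|U| = if s1 == s2 then 3 else 4.
    have CU := card_middle; rewrite -(cardsC middle) /middle setCK in CU.
    have UE : U = [set l1; s1; l2; s2] by rewrite /U c1 c2 !setUA.
    by move: CU; rewrite -UE -addnA => /addnI <-; case: eqP.
  have [Uk|Uk] := leqP #|U| k.
    by rewrite card_supersets // cU; move: Uk; rewrite cU; case: eqP => _ ->; rewrite mul1n.
  rewrite (_ : [set T | _ & _] = set0) ?cards0; last first.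
    apply/setP => T; rewrite !inE; apply/negbTE; apply/negP => /andP[/subset_leq_card UT /eqP Tk].
    by rewrite Tk leqNgt Uk in UT.
  by move: Uk; rewrite cU; case: eqP => _; rewrite ltnNge => /negPf->.
by rewrite cardsUI cS1 cS2 mul2n addnn.
Qed.

Lemma card_bad_split (k : nat) :
  num_bad G k = (#|[set T : {set G} | has_pair T & #|T| == k]|
   + #|[set T : {set G} | [&& ~~ codominating T, ~~ has_pair T & #|T| == k]]|)%N.
Proof.
rewrite /num_bad -(cardsID [set T : {set G} | has_pair T]); congr addn.
  apply: eq_card => T; rewrite !inE andbC; case: (boolP (has_pair T)) => //= p.
  by rewrite has_pair_bad.
by apply: eq_card => T; rewrite !inE; case: (has_pair T); rewrite ?andbF.
Qed.

Hypothesis leaves : forall l, degree l = 1%N -> cnbr l = cnbr l1 \/ cnbr l = cnbr l2.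
Hypothesis deg_gt0 : forall v : G, (0 < degree v)%N.

Lemma middle_deg_gt1 (v : G) : v \in middle -> (1 < degree v)%N.
Proof.
rewrite middleP => /and4P[v1 v2 v3 v4]; rewrite ltn_neqAle deg_gt0 andbT.
apply/eqP => /esym/leaves[] /setP/(_ v); rewrite cnbr_refl.
  by rewrite c1 !inE (negPf v1) (negPf v2).
by rewrite c2 !inE (negPf v3) (negPf v4).
Qed.

(** The closed neighbourhood of a leaf or of its stem contains the pair formed by the two. *)
Lemma cnbr_sub_middle (v : G) (T : {set G}) :
  cnbr v \subset T -> ~~ has_pair T -> v \in middle.
Proof.
move=> vT; rewrite middleP; apply: contraR; rewrite !negb_and !negbK /has_pair.
have s1T : v = s1 -> cnbr l1 \subset T.
  move=> vs; apply: subset_trans vT; rewrite c1 vs; apply/subsetP => x.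
  by rewrite !inE => /orP[] /eqP->; rewrite ?eqxx // adj_sym a1 orbT.
have s2T : v = s2 -> cnbr l2 \subset T.
  move=> vs; apply: subset_trans vT; rewrite c2 vs; apply/subsetP => x.
  by rewrite !inE => /orP[] /eqP->; rewrite ?eqxx // adj_sym a2 orbT.
by case/or4P => /eqP E; rewrite ?(s1T E) ?(s2T E) -?E ?vT ?orbT.
Qed.

(* The bad triples containing no leaf pair are closed neighbourhoods of
   middle vertices; there are as many of them as middle vertices. *)
Lemma middle_deg2 : (num_bad G 3 = 3 * #|G| - 8)%N ->
  {in middle, forall v, degree v = 2%N} /\ {in middle &, injective (@cnbr G)}.
Proof.
move=> b3; pose Tr := [set T : {set G} | [&& ~~ codominating T, ~~ has_pair T & #|T| == 3]].
have TrA : #|Tr| = #|middle|.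
  have P := card_has_pair (isT : 2 <= 3)%N; have S := card_bad_split 3.
  have M := card_middle; rewrite b3 -/Tr in S; rewrite !bin1 in P.
  move: #|Tr| #|middle| #|[set T | has_pair T & _]| #|G| S P M => t m p n.
  by case: eqP => _ /=; rewrite ?bin0; lia.
have sub : Tr \subset [set cnbr v | v in middle].
  apply/subsetP => T; rewrite inE => /and3P[/badP[v vT] np /eqP T3].
  have vA := cnbr_sub_middle vT np; apply/imsetP; exists v => //.
  by apply/esym/eqP; rewrite eqEcard vT T3 card_cnbr ltnS; apply: middle_deg_gt1.
have card_im : #|[set cnbr v | v in middle]| = #|middle|.
  by apply/eqP; rewrite eqn_leq leq_imset_card -TrA subset_leq_card.
split; last by apply/imset_injP/eqP.
move=> v vA; have : cnbr v \in Tr.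
  have /eqP -> : Tr == [set cnbr v | v in middle].
    by rewrite eqEcard sub card_im TrA leqnn.
  exact: imset_f.
by rewrite inE card_cnbr eqSS => /and3P[_ _ /eqP].
Qed.

Hypothesis deg2 : {in middle, forall v, degree v = 2%N}.
Hypothesis cnbr_inj : {in middle &, injective (@cnbr G)}.
Hypothesis no_C4 :
  forall T : {set G}, T \subset middle -> #|T| = 4 -> ~ nbr_closed T.

(** [Q4] collects the bad four-sets not explained by a leaf pair, and [I T] the middle vertices that
    witness the badness of T. *)
Let Q4 := [set T : {set G} | [&& ~~ codominating T, ~~ has_pair T & #|T| == 4]].
Let I (T : {set G}) := [set v in middle | cnbr v \subset T].

(* The subgraph induced by I(T) has no cycle, so fewer edges than vertices. *)
Lemma closed_vertices_forest (T : {set G}) : T \in Q4 ->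
  (2 + \sum_(v in I T) #|[set w in I T | adj v w]| <= \sum_(v in I T) 2)%N.
Proof.
rewrite inE => /and3P[/badP[v0 v0T] np /eqP T4].
have v0I : v0 \in I T by rewrite inE v0T andbT (cnbr_sub_middle v0T np).
have IT : I T \subset T.
  by apply/subsetP => v; rewrite inE => /andP[_ /subsetP]; apply; apply: cnbr_refl.
have dle2 v : v \in I T -> (#|[set w in I T | adj v w]| <= 2)%N.
  rewrite inE => /andP[vA _]; rewrite -(deg2 vA).
  by apply/subset_leq_card/subsetP => w; rewrite !inE => /andP[].
have dlt v : v \in I T -> (#|[set w in I T | adj v w]| < #|I T|)%N.
  move=> vI; apply: proper_card; apply/properP; split.
    by apply/subsetP => w; rewrite inE => /andP[].
  by exists v => //; rewrite inE adj_irr andbF.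
have I4 := subset_leq_card IT; rewrite T4 in I4.
rewrite sum_nat_const; case E : #|I T| I4 dlt => [|[|[|[|[|//]]]]] _ dlt.
- by rewrite (cards0_eq E) inE in v0I.
- by rewrite big1 // => v /dlt; case: #|_|.
- rewrite -[(2 * 2)%N]/(2 + 2)%N leq_add2l.
  suff : (\sum_(v in I T) #|[set w in I T | adj v w]| <= \sum_(v in I T) 1)%N.
    by rewrite sum1_card E.
  by apply: leq_sum => v /dlt.
(* With three vertices, one of inner degree below 2 has a non-neighbour, whose inner degree is below
   2 as well. *)
- have [/existsP[v /andP[vI dv]]|/existsPn dN] :=
    boolP [exists v, (v \in I T) && (#|[set w in I T | adj v w]| < 2)%N].
  have [w wI /andP[wv vw]] : exists2 w, w \in I T & (w != v) && ~~ adj v w.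
    have : (0 < #|I T :\ v :\: [set w in I T | adj v w]|)%N.
      rewrite cardsD subn_gt0 (leq_ltn_trans (subset_leq_card (subsetIr _ _))) //.
      by apply: leq_trans dv _; have := cardsD1 v (I T); rewrite vI E add1n => -[<-].
    case/card_gt0P => w; rewrite in_setD in_setD1 => /andP[nvw /andP[wv wI]].
    by exists w => //; rewrite wv; move: nvw; rewrite in_set wI.
  have dw : (#|[set u in I T | adj w u]| < 2)%N.
    have : [set u in I T | adj w u] \subset I T :\ w :\ v.
      apply/subsetP => u; rewrite in_set !in_setD1 => /andP[-> wu]; rewrite andbT.
      apply/andP; split; first by apply: contraTneq wu => ->; rewrite adj_sym.
      by apply: contraTneq wu => ->; rewrite adj_irr.
    move/subset_leq_card; rewrite ltnS => /leq_trans; apply.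
    have := cardsD1 w (I T); rewrite wI E add1n (cardsD1 v) in_setD1 eq_sym wv vI.
    by rewrite add1n => -[<-].
  rewrite (bigD1 v) //= (bigD1 w) /=; last by rewrite wI.
  have rest : (\sum_(i in I T | (i != v) && (i != w)) #|[set w0 in I T | adj i w0]| <= 2)%N.
    apply: (@leq_trans (\sum_(i in I T | (i != v) && (i != w)) 2)).
      by apply: leq_sum => i /andP[iI _]; apply: dle2.
    rewrite sum_nat_const -[X in (_ <= X)%N]mul1n leq_mul2r /=.
    have := cardsD1 v (I T); rewrite vI E add1n (cardsD1 w) in_setD1 wv wI.
    rewrite add1n => -[->]; apply/subset_leq_card/subsetP => i; rewrite !in_setD1.
    by move=> /andP[-> /andP[-> ->]].
  under eq_bigl => i do rewrite -andbA.
  by move: #|_| #|_| (\sum_(_ | _) _) dv dw rest; lia.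
  (* Otherwise the three vertices form a triangle; having degree 2 they share one closed
     neighbourhood, against [cnbr_inj]. *)
  have full v : v \in I T -> cnbr v = I T.
    move=> vI; apply/esym/eqP; rewrite eqEcard card_cnbr E deg2; last first.
      by move: vI; rewrite inE => /andP[].
    rewrite andbT; have := dN v; rewrite vI /= -leqNgt => dv.
    have : [set w in I T | adj v w] = I T :\ v.
      apply/eqP; rewrite eqEcard; apply/andP; split.
        apply/subsetP => w; rewrite in_set in_setD1 => /andP[-> vw]; rewrite andbT.
        by apply: contraTneq vw => ->; rewrite adj_irr.
      by have := cardsD1 v (I T); rewrite vI E add1n => -[<-].
    move=> /setP eN; apply/subsetP => w wI; rewrite cnbrE.
    have [//|wv] := eqVneq w v; have := eN w; rewrite in_setD1 wv wI.
    by rewrite in_set => /andP[].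
  have := cardsD1 v0 (I T); rewrite v0I E add1n => -[] /esym/eqP.
  case: (set_0Vmem (I T :\ v0)) => [->|[w]]; first by rewrite cards0.
  rewrite in_setD1 => /andP[wv wI] _; case/eqP: wv.
  apply: cnbr_inj; rewrite ?full //; first by move: wI; rewrite inE => /andP[].
  by move: v0I; rewrite inE => /andP[].
(* Four witnesses fill T, which is then closed under adjacency, against [no_C4]. *)
have IE : I T = T by apply/eqP; rewrite eqEcard IT T4 E.
case: (@no_C4 T) => //.
  by rewrite -IE; apply/subsetP => v; rewrite inE => /andP[].
move=> x y; rewrite -{1}IE inE => /andP[_ /subsetP xT] xy; apply: xT.
by rewrite cnbrE xy orbT.
Qed.

(** Such a T is [cnbr v] plus one vertex outside it. That vertex is not a leaf whose stem is
    adjacent to v, since T contains no leaf pair. *)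
Lemma closed_sets_through (v : G) : v \in middle ->
  (#|[set T in Q4 | cnbr v \subset T]| + (adj v s1 + adj v s2) + 3 <= #|G|)%N.
Proof.
have [n12 n1 n2 n12' n21'] := pair_neq.
move=> vA; have := vA; rewrite middleP => /and4P[vl1 vs1 vl2 vs2].
pose L := [set u | (u == l1) && adj v s1 || (u == l2) && adj v s2].
have nl1 : l1 \notin cnbr v.
  by rewrite cnbr_sym c1 !inE negb_or vl1 vs1.
have nl2 : l2 \notin cnbr v.
  by rewrite cnbr_sym c2 !inE negb_or vl2 vs2.
have cL : #|L| = (adj v s1 + adj v s2)%N.
  rewrite /L; case: (adj v s1); case: (adj v s2); rewrite /= ?addn0 ?add0n.
  - rewrite -[RHS]/2 (_ : [set u | _] = [set l1; l2]) ?cards2 ?n12 //.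
    by apply/setP => u; rewrite !inE !andbT.
  - rewrite (_ : [set u | _] = [set l1]) ?cards1 //.
    by apply/setP => u; rewrite !inE andbT andbF orbF.
  - rewrite (_ : [set u | _] = [set l2]) ?cards1 //.
    by apply/setP => u; rewrite !inE andbT andbF.
  - rewrite (_ : [set u | _] = set0) ?cards0 //.
    by apply/setP => u; rewrite !inE !andbF.
have sub : [set T in Q4 | cnbr v \subset T]
    \subset [set u |: cnbr v | u in ~: (cnbr v :|: L)].
  apply/subsetP => T; rewrite !inE => /andP[/and3P[_ np /eqP T4] vT].
  have : (0 < #|T :\: cnbr v|)%N.
    by rewrite cardsD (setIidPr vT) T4 card_cnbr deg2.
  case/card_gt0P => u; rewrite inE => /andP[uv uT].
  have TE : T = u |: cnbr v.
    apply/esym/eqP; rewrite eqEcard subUset sub1set uT vT /=.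
    by rewrite cardsU1 uv card_cnbr deg2 // T4.
  apply/imsetP; exists u => //; rewrite !inE -cnbrE negb_or uv /=.
  apply: contra np => /orP[] /andP[/eqP ul vs]; rewrite /has_pair; apply/orP.
    left; rewrite c1; apply/subsetP => x; rewrite !inE => /orP[] /eqP->; first by rewrite -ul.
    by apply: (subsetP vT); rewrite cnbrE vs orbT.
  right; rewrite c2; apply/subsetP => x; rewrite !inE => /orP[] /eqP->; first by rewrite -ul.
  by apply: (subsetP vT); rewrite cnbrE vs orbT.
have := leq_trans (subset_leq_card sub) (leq_imset_card _ _).
have : #|cnbr v :|: L| = (3 + (adj v s1 + adj v s2))%N.
  rewrite cardsU card_cnbr deg2 // cL (_ : cnbr v :&: L = set0) ?cards0 ?subn0 //.
  apply/setP => u; rewrite !inE -cnbrE; apply/negbTE; apply/negP => /andP[uv].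
  by case/orP => /andP[/eqP ul _]; rewrite ul ?(negPf nl1) ?(negPf nl2) in uv.
rewrite -(cardsC (cnbr v :|: L)) => -> H.
by rewrite -addnA addnC [(_ + 3)%N]addnC leq_add2l.
Qed.

(** A middle vertex is adjacent to no leaf, so its two neighbours are middle vertices or stems; the
    factor prevents a common stem from being counted twice. *)
Lemma middle_nbrs (v : G) : v \in middle ->
  (#|[set w in middle | adj v w]| + (adj v s1 + (s1 != s2) * adj v s2))%N = 2.
Proof.
move=> vA; have := vA; rewrite middleP => /and4P[vl1 vs1 vl2 vs2].
rewrite -(deg2 vA) /degree -(cardsID middle [set u | adj v u]); congr addn.
  by apply: eq_card => w; rewrite !inE andbC.
have nl1 : adj v l1 = false.
  by apply/negbTE; apply: contra vs1 => vl; apply/eqP/leaf_nbr1; rewrite adj_sym.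
have nl2 : adj v l2 = false.
  by apply/negbTE; apply: contra vs2 => vl; apply/eqP/leaf_nbr2; rewrite adj_sym.
have -> : [set u | adj v u] :\: middle = [set u in [set s1; s2] | adj v u].
  apply/setP => u; rewrite /middle !inE negbK.
  by have [->|_] := eqVneq u l1; rewrite ?nl1 ?andbF //=;
     have [->|_] := eqVneq u l2; rewrite ?nl2 ?andbF //= ?orbF.
have [->|n12] := eqVneq s1 s2; rewrite ?mul0n ?addn0 ?mul1n.
  case vs : (adj v s2).
    rewrite (_ : [set u in _ | _] = [set s2]) ?cards1 //.
    by apply/setP => u; rewrite !inE orbb; case: eqP => [->|].
  rewrite (_ : [set u in _ | _] = set0) ?cards0 //.
  by apply/setP => u; rewrite !inE orbb; case: eqP => [->|].
rewrite -(cardsID [set s1]); congr addn.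
  case vs : (adj v s1).
    rewrite (_ : _ :&: _ = [set s1]) ?cards1 //.
    by apply/setP => u; rewrite !inE; case: eqP => [->|]; rewrite ?vs ?andbF.
  rewrite (_ : _ :&: _ = set0) ?cards0 //.
  by apply/setP => u; rewrite !inE; case: eqP => [->|]; rewrite ?vs ?andbF.
case vs : (adj v s2).
  rewrite (_ : _ :\: _ = [set s2]) ?cards1 //.
  apply/setP => u; rewrite !inE; have [->|] := eqVneq u s1; first by rewrite /= (negPf n12).
  by move=> _ /=; case: eqP => [->|].
rewrite (_ : _ :\: _ = set0) ?cards0 //.
apply/setP => u; rewrite !inE; have [->//|_ /=] := eqVneq u s1.
by case: eqP => [->|].
Qed.

(** The forest bound is summed over [Q4]. On the right, [closed_sets_through] bounds the number of
    pairs of a set T and a witness v. On the left, each pair of adjacent middle vertices v, w occurs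
    at least once, for the four-set T = [cnbr v :|: cnbr w]; it has four elements because the two
    closed neighbourhoods differ. Finally [middle_nbrs] trades edges inside the middle for edges to
    the stems. *)
Lemma middle_count :
  (2 * #|Q4| + 2 * #|middle| + \sum_(v in middle) (adj v s1 : nat)
   + \sum_(v in middle) (if s1 == s2 then 2 else 1) * adj v s2 + 2 * 3 * #|middle|
   <= 2 * #|G| * #|middle|)%N.
Proof.
have main : (\sum_(T in Q4) (2 + \sum_(v in I T) #|[set w in I T | adj v w]|)
             <= \sum_(T in Q4) \sum_(v in I T) 2)%N.
  by apply: leq_sum => T; apply: closed_vertices_forest.
have vertices : (\sum_(T in Q4) \sum_(v in I T) 2
    = \sum_(v in middle) 2 * #|[set T in Q4 | cnbr v \subset T]|)%N.
  rewrite (exchange_big_dep (mem middle)) /=; last first.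
    by move=> T v _; rewrite inE => /andP[].
  apply: eq_bigr => v vA; rewrite sum_nat_const mulnC; congr muln.
  apply: eq_card => T; rewrite [RHS]in_set.
  by have <- : (v \in I T) = (cnbr v \subset T) by rewrite /I in_set vA.
have edges : (\sum_(v in middle) #|[set w in middle | adj v w]|
    <= \sum_(T in Q4) \sum_(v in I T) #|[set w in I T | adj v w]|)%N.
  rewrite [X in (_ <= X)%N](exchange_big_dep (mem middle)) /=; last first.
    by move=> T v _; rewrite inE => /andP[].
  apply: leq_sum => v vA.
  under [X in (_ <= X)%N]eq_bigr => T _ do rewrite -sum1_card.
  rewrite [X in (_ <= X)%N](exchange_big_dep (mem middle)) /=; last first.
    by move=> T w _; rewrite in_set /I in_set => /andP[/andP[]].
  rewrite -sum1_card [X in (X <= _)%N](eq_bigl (fun w => (w \in middle) && adj v w)); last first.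
    by move=> w; rewrite in_set.
  rewrite big_mkcondr /=; apply: leq_sum => w wA; case vw : (adj v w) => //.
  rewrite sum1_card; apply/card_gt0P; exists (cnbr v :|: cnbr w).
  have vI : v \in I (cnbr v :|: cnbr w) by rewrite /I in_set vA subsetUl.
  have wI : w \in I (cnbr v :|: cnbr w) by rewrite /I in_set wA subsetUr.
  suff TQ : cnbr v :|: cnbr w \in Q4.
    by rewrite -topredE /= TQ vI in_set wI vw.
  rewrite /Q4 in_set.
  have nv : v != w by apply: contraTneq vw => ->; rewrite adj_irr.
  have c4 : #|cnbr v :|: cnbr w| = 4.
    have le2 : (2 <= #|cnbr v :&: cnbr w|)%N.
      have -> : 2 = #|[set v; w]| by rewrite cards2 nv.
      apply/subset_leq_card/subsetP => x; rewrite in_setI !inE.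
      by move=> /orP[] /eqP->; rewrite !eqxx ?(adj_sym w) vw ?orbT.
    have lt3 : (#|cnbr v :&: cnbr w| < 3)%N.
      rewrite ltnNge; apply/negP => ge3; case/eqP: nv; apply: cnbr_inj => //.
      have e1 : cnbr v :&: cnbr w = cnbr v.
        by apply/eqP; rewrite eqEcard subsetIl card_cnbr deg2.
      have e2 : cnbr v :&: cnbr w = cnbr w.
        by apply/eqP; rewrite eqEcard subsetIr card_cnbr deg2.
      by rewrite -e1 {1}e2.
    rewrite cardsU !card_cnbr !deg2 //.
    by have -> : #|cnbr v :&: cnbr w| = 2 by apply/eqP; rewrite eqn_leq le2 -ltnS lt3.
  rewrite c4 eqxx andbT; apply/andP; split.
    by apply/badP; exists v; apply: subsetUl.
  have nl (l s x : G) : degree l = 1%N -> adj l s -> x \in middle ->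
      (forall y, adj l y -> y = s) -> l != x -> s != x -> l \notin cnbr x.
    move=> dl ls xA ly lx sx; rewrite cnbrE negb_or lx /=.
    by apply: contra sx => xl; apply/eqP/esym/ly; rewrite adj_sym.
  have notl l s : degree l = 1%N -> adj l s -> (forall y, adj l y -> y = s) ->
     (forall x, x \in middle -> (l != x) && (s != x)) ->
     ~~ (cnbr l \subset cnbr v :|: cnbr w).
    move=> dl ls ly nlx; apply/subsetPn; exists l; first exact: cnbr_refl.
    have /andP[v1 v2] := nlx v vA; have /andP[w1 w2] := nlx w wA.
    by rewrite in_setU negb_or (nl l s v) // (nl l s w).
  rewrite negb_or (notl l1 s1) ?(notl l2 s2) //; try exact: leaf_nbr1; try exact: leaf_nbr2.
    by move=> x; rewrite middleP => /and4P[_ _ A B]; rewrite eq_sym A eq_sym B.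
  by move=> x; rewrite middleP => /and4P[A B _ _]; rewrite eq_sym A eq_sym B.
have e1 : (\sum_(v in middle) (#|[set w in middle | adj v w]|
    + (adj v s1 + (s1 != s2) * adj v s2)) = 2 * #|middle|)%N.
  by rewrite (eq_bigr (fun=> 2)) ?sum_nat_const ?(mulnC 2) // => v; apply: middle_nbrs.
have e2 : (\sum_(v in middle) (2 * #|[set T in Q4 | cnbr v \subset T]|
   + 2 * (adj v s1 + adj v s2) + 2 * 3) <= \sum_(v in middle) 2 * #|G|)%N.
  apply: leq_sum => v vA; have := closed_sets_through vA.
  by rewrite -!mulnDr leq_mul2l.
rewrite big_split /= big_split /= -!big_distrr /= !big_split /= !sum_nat_const in e1 e2.
rewrite big_split /= sum_nat_const in main.
rewrite vertices -big_distrr /= in main.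
rewrite -!big_distrr /=.
move: (\sum_(v in middle) #|[set w in middle | adj v w]|) edges e1 => x1 edges e1.
move: (\sum_(T in Q4) \sum_(v in I T) #|_|)%N main edges => x2 main edges.
move: (\sum_(v in middle) #|_|) main e2 => x3 main e2.
move: (\sum_(v in middle) adj v s1) (\sum_(v in middle) adj v s2) e1 e2 => K1 K2.
move: #|G| #|Q4| #|middle| main edges => n q m.
by case: (s1 == s2) => /=; nia.
Qed.

(** With n = r + 5, the value of [num_bad G 4] gives [Q4] exactly r^2 + 2r elements for distinct
    stems and r^2 + 3r + 1 for a common one. In [middle_count] everything then cancels except K1 +
    K2 <= 2 in the first case and 3 K <= 2 in the second, so K = 0 there, K being the number of
    edges from the stem to the middle. *)
Lemma stem_middle_nbrs : (5 <= #|G|)%N ->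
  (num_bad G 4 = 2 * 'C(#|G| - 2, 2) + (#|G| - 4) * (#|G| - 4) - 2)%N ->
  (\sum_(v in middle) (adj v s1 : nat)
   + (s1 != s2) * \sum_(v in middle) (adj v s2 : nat) <= 2 * (s1 != s2))%N.
Proof.
move=> n5 b4; have P := card_has_pair (isT : 2 <= 4)%N.
have S := card_bad_split 4; rewrite b4 -/Q4 in S.
have M := card_middle; have C := middle_count.
rewrite -big_distrr /= in C; rewrite !bin0 !bin1 in P.
move: C P S M n5; have [->|ne12] := eqVneq s1 s2 => /=.
  move: (\sum_(v in middle) _)%N #|[set T | has_pair T & _]| #|Q4| #|middle| #|G| => K p q m n.
  move: 'C(_, _) => B C P S M n5.
  have [r nr] : exists r, n = (r + 5)%N by exists (n - 5)%N; lia.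
  have m_r : m = (r + 2)%N by lia.
  rewrite nr m_r in C P S *; clear M nr m_r.
  have q_r : q = (r * r + 3 * r + 1)%N by nia.
  by rewrite q_r in C; nia.
move: (\sum_(v in middle) _)%N (\sum_(v in middle) _)%N #|[set T | has_pair T & _]| #|Q4| #|middle| #|G| => K1 K2 p q m n.
move: 'C(_ - 2, _) => B C P S M n5.
have [r nr] : exists r, n = (r + 5)%N by exists (n - 5)%N; lia.
have m_r : m = (r + 1)%N by lia.
rewrite nr m_r in C P S *; clear M nr m_r.
have q_r : q = (r * r + 2 * r)%N by nia.
by rewrite q_r in C; nia.
Qed.
End TwoLeafPairs.

(** Handshake lemma, with the ends of an edge ordered by [enum_rank]. Applied to the middle, whose
    degrees sum to an even number, it makes the number of edges to the stems even. *)
Lemma even_sum_nbrs (G : sgraph) (A : {set G}) :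
  ~~ odd (\sum_(v in A) #|[set w in A | adj v w]|).
Proof.
pose lt (v w : G) := (enum_rank v < enum_rank w)%N.
suff -> : (\sum_(v in A) #|[set w in A | adj v w]|
   = 2 * \sum_(v in A) \sum_(w in A) (adj v w && lt v w))%N by rewrite oddM.
have -> : (\sum_(v in A) #|[set w in A | adj v w]|
   = \sum_(v in A) \sum_(w in A) ((adj v w && lt v w) + (adj v w && lt w v)))%N.
  apply: eq_bigr => v vA; rewrite -sum1_card.
  rewrite (eq_bigl (fun w => (w \in A) && adj v w)); last by move=> w; rewrite in_set.
  rewrite big_mkcondr /=; apply: eq_bigr => w wA; rewrite /lt.
  case: ltngtP => [||/ord_inj/enum_rank_inj->]; rewrite ?adj_irr //;
  by rewrite ?andbT ?andbF ?addn0; case: (adj v w).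
under eq_bigr => v _ do rewrite big_split /=.
rewrite big_split /= mul2n -addnn; congr addn.
rewrite exchange_big /=; apply: eq_bigr => v _; apply: eq_bigr => w _.
by rewrite adj_sym.
Qed.
End Counting.

(** * Two-leaf graphs and stubs *)

Section Evaluation.
Import GRing.Theory.
Local Open Scope ring_scope.

(** At X = -1 the characteristic polynomial is (t - 1)(t^2 + 1), whose roots are fourth roots of
    unity. *)
Lemma h_m1 (n : nat) : (h n.+4).[-1] = (h n).[-1].
Proof. by rewrite (hS n.+1) !hS !hornerE; ring. Qed.

Lemma pathp_m1 (n : nat) : (2 <= n)%N -> (pathp n).[-1] = 1 \/ (pathp n).[-1] = -1.
Proof.
move=> n2; have -> : n = (n - 2).+2 by lia.
move: (n - 2)%N => {n n2} n; rewrite /pathp !subSS subn0 !hornerE.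
suff H m : (m < n.+1)%N -> (h m.+2).[-1] + -1 * (h m).[-1] = 1 \/
  (h m.+2).[-1] + -1 * (h m).[-1] = -1 by apply: H.
elim/ltn_ind: m => -[|[|[|[|m]]]] IH mn.
- by right; rewrite /= !hornerE.
- by right; rewrite /= !hornerE.
- by left; rewrite /= !hornerE.
- by left; rewrite /= !hornerE.
by rewrite (h_m1 m.+2) h_m1; apply: IH; lia.
Qed.

Lemma cyclep4_m1 : (cyclep 4).[-1] = 3.
Proof. by rewrite /cyclep /= !hornerE. Qed.

(** The defect of F_3 with K_2 starts with +X^3, which could only be cancelled by triangles; each of
    these contributes 2, so parity forbids it. *)
Lemma Fp3_cyclep_neq (cs : seq nat) : all (leq 3) cs ->
  Fp 3 * pathp 2 * \prod_(c <- cs) cyclep c <> pathp (6 + sumn cs).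
Proof.
move=> cs3; set P := Fp 3 * pathp 2 => E.
have PE : P = pathp 6 + 'X^3 * (1 + 'X) by rewrite /P /Fp /pathp /=; ring.
pose N := (2 * sumn cs + 50)%N.
have SN : (sumn cs + 6 <= N)%N by lia.
have EN : P * (h N * \prod_(c <- cs) cyclep c) = pathp (6 + sumn cs) * h N.
  by rewrite -E; ring.
have P1 : eqmX 1 P 1.
  rewrite PE -[X in eqmX _ _ X]addr0; apply: eqmXD; first exact: pathp_const1.
  exact: eqmX0.
have Ep : eqmX 6 (pathp 6 * h (N + sumn cs) - pathp (6 + sumn cs) * h N) 0.
  have [->|S0] := posnP (sumn cs); first by rewrite !addn0; exists 0; ring.
  apply: eqmX_trans (eqmX_weaken _ (@pathp_h_const (sumn cs) 6 N S0 isT ltac:(lia))) _ => //.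
  exact: eqmX0.
have HR : eqmX 4 (P * h (N + sumn cs) - pathp (6 + sumn cs) * h N) ('X^3 * 1%:~R).
  have [w Ew] := Ep; have [v Ev] : eqmX 1 (h (N + sumn cs)) 1.
    have [M NM] : exists M, (N + sumn cs)%N = M.+1 by exists (N + sumn cs - 1)%N; lia.
    by rewrite NM; have [v ->] := h_lin M; exists (M%:R + 'X * v); ring.
  exists ('X^2 * w + v + 1 + 'X * v).
  have -> : P * h (N + sumn cs) - pathp (6 + sumn cs) * h N
    = 'X^6 * w + 'X^3 * ((1 + 'X) * h (N + sumn cs)).
    by rewrite -[X in _ = X + _]add0r -Ew PE; ring.
  by rewrite Ev; ring.
have H := eqmX_cancel EN (@prod_cyclep_h_const 3 N cs isT cs3 SN) HR.
suff /(@eqmX_const_eq0 3) :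
    eqmX 4 ('X^3 * (cycle_sign 3 * (count_mem 3 cs)%:Z + 1)%:~R) 0.
  by rewrite /cycle_sign /=; move: (count_mem 3 cs) => x; clear; lia.
apply: eqmX_trans _ H; rewrite rmorphD /= mulrDr; apply: eqmXD (eqmX_refl _ _).
exact: eqmX_sym (eqmX1_mul _ _ P1).
Qed.
End Evaluation.

Section Classification.

(** Cycle lengths of at least 3 with sum 4 leave only C_4, whose value 3 at -1 divides neither 1 nor
    -1. *)
Lemma no_C4_component (G : sgraph) (n : nat) (T : {set G}) :
  (2 <= n)%N -> codom_poly G = pathp n -> (forall x, x \in T -> degree x = 2%N) ->
  #|T| = 4 -> ~ nbr_closed T.
Proof.
move=> n2 En dT T4 cT.
have [cs [cs3 Scs Ecs]] := two_regular_codom_poly (two_regular_induced cT dT).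
rewrite card_induced T4 in Scs.
have csE : cs = [:: 4].
  move: cs3 Scs {Ecs}; case: cs => [|c [|c' cs]] //=; first by rewrite addn0 => _ ->.
  by move=> /and3P[]; lia.
have [f [bf adjf _ _]] := closed_dunion cT.
have /isomorphic_codom_poly : isomorphic (dunion (induced T) (induced (~: T))) G by exists f.
rewrite codom_poly_dunion Ecs csE big_cons big_nil GRing.mulr1 En.
move=> /(congr1 (fun u : {poly int} => u.[-1]%R)); rewrite hornerM cyclep4_m1.
by have [->|->] := pathp_m1 n2; lia.
Qed.

Lemma codom_poly_path_graph (n : nat) : (2 <= n)%N ->
  codom_poly (path_graph n) = pathp n.
Proof.
move=> n2; have -> : n = (n - 2).+2 by lia.
by rewrite codom_poly_path /pathp !subSS subn0.
Qed.

Lemma two_leaf_path (G : sgraph) (l l' : G) : l != l' ->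
  degree l = 1%N -> degree l' = 1%N ->
  (forall x, x != l -> x != l' -> degree x = 2%N) ->
  codom_poly G = pathp #|G| ->
  isomorphic G (path_graph #|G|) /\
  forall U : {set G}, nbr_closed U -> l \in U -> U = setT.
Proof.
move=> ll' dl dl' dA EG.
have [m [Z [regZ iso closedT]]] := path_component ll' dl dl' dA.
have [cs [cs3 Scs Ecs]] := two_regular_codom_poly regZ.
have cG := isomorphic_card iso; rewrite card_sum card_ord in cG.
have := isomorphic_codom_poly iso.
rewrite codom_poly_dunion codom_poly_path_graph // Ecs EG -cG -Scs.
move=> /pathp_cyclep_eq => /(_ isT cs3) cs0.
have Z0 : #|Z| = 0%N by rewrite -Scs cs0.
split; last exact: closedT.
rewrite cs0 addn0; apply: isomorphic_sym.
apply: isomorphic_trans iso; apply: isomorphic_sym; exact: dunion_empty.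
Qed.

(** * Deleting the edge between the stems *)

Section DeleteEdge.
Variables (G : sgraph) (a b : G).
Definition del_edge_adj : rel G := fun x y =>
  adj x y && ~~ ((x == a) && (y == b) || (x == b) && (y == a)).
Lemma del_edge_sym : symmetric del_edge_adj.
Proof.
move=> x y; rewrite /del_edge_adj adj_sym; congr (_ && ~~ _).
by rewrite orbC; congr (_ || _); rewrite andbC.
Qed.
Lemma del_edge_irr : irreflexive del_edge_adj.
Proof. by move=> x; rewrite /del_edge_adj adj_irr. Qed.
Definition del_edge : sgraph := SGraph del_edge_sym del_edge_irr.

Lemma add_del_edge : adj a b ->
  isomorphic (add_edges (pred1 (a : del_edge)) (pred1 (b : del_edge))) G.
Proof.
move=> ab; exists id => [|x y]; first by exists id.
have nab : a != b by apply: contraTneq ab => ->; rewrite adj_irr.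
rewrite /= /add_edges_adj /= /del_edge_adj.
set e := (x == a) && (y == b) || (x == b) && (y == a).
have eE : e -> @adj G x y && (x != y).
  by move=> /orP[] /andP[/eqP-> /eqP->]; rewrite ?ab ?nab // adj_sym ab eq_sym nab.
by case: e eE => [/(_ isT)/andP[-> ->]|_]; rewrite /= ?andbT ?andbF ?orbF.
Qed.
End DeleteEdge.

Lemma isomorphic_add_edges (G H : sgraph) (f : G -> H) (p q : pred G) (p' q' : pred H) :
  bijective f -> (forall x y, adj (f x) (f y) = adj x y) ->
  (forall x, p' (f x) = p x) -> (forall x, q' (f x) = q x) ->
  isomorphic (add_edges p q) (add_edges p' q').
Proof.
move=> bf adjf pf qf; exists f => // x y.
by rewrite /= /add_edges_adj !pf !qf adjf (bij_eq bf).
Qed.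

Lemma degree_iso (G H : sgraph) (f : G -> H) (x : G) : bijective f ->
  (forall x y, adj (f x) (f y) = adj x y) -> degree (f x) = degree x.
Proof.
move=> bf adjf; rewrite /degree -(card_imset _ (bij_inj bf)); apply: eq_card => y.
have [g gK fK] := bf; by rewrite -[y]fK mem_imset ?inE //; apply: bij_inj.
Qed.

Lemma stem_iso (G H : sgraph) (f : G -> H) (x : G) : bijective f ->
  (forall x y, adj (f x) (f y) = adj x y) -> stem (f x) = stem x.
Proof.
move=> bf adjf; have [g gK fK] := bf.
apply/existsP/existsP => -[u /andP[xu /eqP lu]].
  exists (g u); rewrite -adjf fK xu /= /leaf -(degree_iso (g u) bf adjf) fK.
  by apply/eqP.
by exists (f u); rewrite adjf xu /leaf degree_iso //; apply/eqP.
Qed.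

Record two_stubs (G : sgraph) (l1 s1 l2 s2 : G) : Prop := TwoStubs {
  stub_deg1 : degree l1 = 1%N;
  stub_deg2 : degree l2 = 1%N;
  stub_adj1 : adj l1 s1;
  stub_adj2 : adj l2 s2;
  stub_neq : cnbr l1 != cnbr l2;
  stub_stems : s1 != s2;
  stub_middle : {in middle l1 s1 l2 s2, forall v, degree v = 2%N} }.

Definition middle_nbr (G : sgraph) (l1 s1 l2 s2 s : G) : {set G} :=
  [set v in middle l1 s1 l2 s2 | adj v s].

Lemma middle_swap (G : sgraph) (l1 s1 l2 s2 : G) :
  middle l2 s2 l1 s1 = middle l1 s1 l2 s2.
Proof.
apply/setP => v; rewrite !middleP.
by case: (v == l1); case: (v == l2); case: (v == s1); case: (v == s2).
Qed.

Lemma two_stubs_swap (G : sgraph) (l1 s1 l2 s2 : G) :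
  two_stubs l1 s1 l2 s2 -> two_stubs l2 s2 l1 s1.
Proof.
by case=> *; split=> //; rewrite 1?eq_sym // middle_swap.
Qed.

Section Stubs.
Variables (G : sgraph) (l1 s1 l2 s2 : G).
Hypothesis stubs : two_stubs l1 s1 l2 s2.

Let d1 := stub_deg1 stubs.
Let d2 := stub_deg2 stubs.
Let a1 := stub_adj1 stubs.
Let a2 := stub_adj2 stubs.
Let ne := stub_neq stubs.
Let s12 := stub_stems stubs.

Lemma stub_adj_leaf1 (y : G) : adj l1 y = (y == s1).
Proof. by apply/idP/eqP => [|->//]; apply: (leaf_nbr1 d1 a1). Qed.

Lemma stub_adj_leaf2 (y : G) : adj l2 y = (y == s2).
Proof. by apply/idP/eqP => [|->//]; apply: (leaf_nbr2 d2 a2). Qed.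

Lemma stub_adj_stem1 (y : G) : ~~ adj s1 s2 ->
  adj s1 y = (y == l1) || (y \in middle_nbr l1 s1 l2 s2 s1).
Proof.
move=> ns; have [n12 n1 n2 n12' n21'] := pair_neq d1 d2 a1 a2 ne.
rewrite in_set middleP [adj y s1]adj_sym.
have [->|yl1] /= := eqVneq y l1; first by rewrite adj_sym a1.
have [->|ys1] /= := eqVneq y s1; first by rewrite adj_irr.
have [->|yl2] /= := eqVneq y l2.
  by rewrite adj_sym stub_adj_leaf2; apply/negbTE.
by have [->|ys2] /= := eqVneq y s2; first exact/negbTE.
Qed.

(** Reduction to non-adjacent stems: the leaves survive as witnesses for [codom_poly_stem_edges],
    and no edge to the middle is touched. *)
Lemma two_stubs_del : adj s1 s2 ->
  [/\ @two_stubs (del_edge s1 s2) l1 s1 l2 s2, codom_poly (del_edge s1 s2) = codom_poly G,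
      @middle_nbr (del_edge s1 s2) l1 s1 l2 s2 s1 = middle_nbr l1 s1 l2 s2 s1 &
      @middle_nbr (del_edge s1 s2) l1 s1 l2 s2 s2 = middle_nbr l1 s1 l2 s2 s2].
Proof.
move=> ab; have [n12 n1 n2 n12' n21'] := pair_neq d1 d2 a1 a2 ne.
have dadj (x : G) : x != s1 -> x != s2 -> @adj (del_edge s1 s2) x =1 adj x.
  by move=> /negPf x1 /negPf x2 y; rewrite /= /del_edge_adj x1 x2 andbT.
have ddeg (x : G) : x != s1 -> x != s2 -> @degree (del_edge s1 s2) x = degree x.
  by move=> x1 x2; apply: eq_card => y; rewrite !inE dadj.
have n21 : l2 != s1 := n21'.
have st : @two_stubs (del_edge s1 s2) l1 s1 l2 s2.
  split; rewrite ?ddeg ?dadj //.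
    apply: contra ne => /eqP/setP E; apply/eqP/setP => y; have := E y.
    by rewrite !inE !dadj.
  move=> v vA; have : v \in @middle (del_edge s1 s2) l1 s1 l2 s2 := vA.
  by rewrite middleP => /and4P[v1 v2 v3 v4]; rewrite ddeg ?(stub_middle stubs) // middleP v1 v2 v3.
split=> //; last 2 first.
- apply/setP => v; rewrite [LHS]in_set [RHS]in_set !middleP; have [->|v1] /= := eqVneq v s1; first by rewrite !andbF.
  by have [->|v2] /= := eqVneq v s2; rewrite ?andbF // /del_edge_adj ?(negPf v1) ?(negPf v2) /= ?andbF ?andbT.
- apply/setP => v; rewrite [LHS]in_set [RHS]in_set !middleP; have [->|v1] /= := eqVneq v s1; first by rewrite !andbF.
  by have [->|v2] /= := eqVneq v s2; rewrite ?andbF // /del_edge_adj ?(negPf v1) ?(negPf v2) /= ?andbF ?andbT.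
rewrite -(isomorphic_codom_poly (add_del_edge ab)); apply/esym/codom_poly_stem_edges.
move=> x /orP[] /eqP->; [exists l1|exists l2]; split; rewrite /leaf ?ddeg ?d1 ?d2 //.
- by rewrite adj_sym dadj.
- by rewrite /= negb_or n1.
- by rewrite adj_sym dadj.
by rewrite /= negb_or n21.
Qed.
End Stubs.
End Classification.

(** * Stems with at most two inner neighbours *)

Lemma codom_poly_K2 : codom_poly (complete_graph 2) = pathp 2.
Proof.
rewrite -codom_poly_path_graph //; apply: isomorphic_codom_poly.
exists id => [|x y]; first by exists id.
by case: x y => [[|[|//]] i] [[|[|//]] j].
Qed.

Lemma codom_poly_F_graph (i : nat) : (3 <= i)%N -> codom_poly (F_graph i) = Fp i.
Proof.
move=> i3; have -> : i = (i - 3).+3 by lia.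
by rewrite codom_poly_F /Fp /pathp !subSS !subn0.
Qed.

Lemma degree_insert (G : sgraph) (s l : G) (N : {set G}) : l \notin N ->
  (forall y, adj s y = (y == l) || (y \in N)) -> degree s = #|N|.+1.
Proof.
move=> lN sN; rewrite /degree -[RHS]add1n -[X in (X + _)%N](_ : nat_of_bool (l \notin N) = 1%N).
  by rewrite -cardsU1; apply: eq_card => y; rewrite !inE sN.
by rewrite lN.
Qed.

Section Cases.
Variables (G : sgraph) (l1 s1 l2 s2 : G).
Hypothesis stubs : two_stubs l1 s1 l2 s2.
Hypothesis ns : ~~ adj s1 s2.
Hypothesis EG : codom_poly G = pathp #|G|.

Let d1 := stub_deg1 stubs.
Let d2 := stub_deg2 stubs.
Let a1 := stub_adj1 stubs.
Let a2 := stub_adj2 stubs.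
Let ne := stub_neq stubs.
Let s12 := stub_stems stubs.
Let N1 := middle_nbr l1 s1 l2 s2 s1.
Let N2 := middle_nbr l1 s1 l2 s2 s2.

Lemma stub_adj_stem2 (y : G) : adj s2 y = (y == l2) || (y \in N2).
Proof.
have ns' : ~~ adj s2 s1 by rewrite adj_sym.
by rewrite (stub_adj_stem1 (two_stubs_swap stubs)) // /N2 /middle_nbr middle_swap.
Qed.

Lemma card_stub_middle : (#|middle l1 s1 l2 s2| + 4 = #|G|)%N.
Proof. by have := card_middle d1 d2 a1 a2 ne; rewrite s12 -addnA. Qed.

Lemma leaf1_notin : l1 \notin N1.
Proof. by rewrite in_set middleP eqxx. Qed.

Lemma leaf2_notin : l2 \notin N2.
Proof. by rewrite in_set middleP eqxx !andbF. Qed.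

Lemma stub_two_leaf : #|N1| = 1%N -> #|N2| = 1%N ->
  forall x, x != l1 -> x != l2 -> degree x = 2%N.
Proof.
move=> c1 c2 x x1 x2; have [->|xs1] := eqVneq x s1.
  by rewrite (degree_insert leaf1_notin (stub_adj_stem1 stubs ^~ ns)) -/N1 c1.
have [->|xs2] := eqVneq x s2.
  by rewrite (degree_insert leaf2_notin stub_adj_stem2) c2.
by apply: (stub_middle stubs); rewrite middleP x1 x2 xs1 xs2.
Qed.

Let bridge := add_edges (pred1 s1) (pred1 s2).

(** Joining the stems gives a graph with two leaves and all other degrees 2, and with the same
    polynomial, hence a path. A path is connected, yet leaves and stems form a closed set, so there
    are no other vertices. *)
Lemma no_middle_nbr : N1 = set0 -> N2 = set0 ->
  isomorphic bridge (path_graph #|G|) /\ #|G| = 4.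
Proof.
move=> N10 N20; have [n12 n1 n2 n12' n21'] := pair_neq d1 d2 a1 a2 ne.
have adjE (x y : bridge) : adj x y = @adj G x y || (x == s1) && (y == s2) || (x == s2) && (y == s1).
  rewrite /= /add_edges_adj /= -orbA; congr (_ || _).
  have [->|xs1] /= := eqVneq x s1.
    have [->|ys2] /= := eqVneq y s2; first by rewrite s12.
    by rewrite (negPf s12) andbF.
  by have [->|xs2] /= := eqVneq x s2; rewrite ?andbF // eq_sym;
     have [->|ys1] := eqVneq y s1; rewrite ?andbF // s12.
have adj1 y : @adj G s1 y = (y == l1) by rewrite (stub_adj_stem1 stubs y ns) -/N1 N10 inE orbF.
have adj2 y : @adj G s2 y = (y == l2) by rewrite stub_adj_stem2 N20 inE orbF.
have dl (l : G) : l != s1 -> l != s2 -> @degree bridge l = degree l.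
  move=> ls1 ls2; apply: eq_card => y.
  by rewrite [LHS]in_set [RHS]in_set adjE (negPf ls1) (negPf ls2) !orbF.
have dA (x : bridge) : x != l1 -> x != l2 -> degree x = 2%N.
  move=> x1 x2; have [->|xs1] := eqVneq x s1.
    rewrite /degree (_ : [set u | _] = [set l1; s2] :> {set G}) ?cards2 ?n12' //.
    apply/setP => y; rewrite [LHS]in_set adjE adj1 eqxx (negPf s12) orbF in_set2.
    by [].
  have [->|xs2] := eqVneq x s2.
    rewrite /degree (_ : [set u | _] = [set l2; s1] :> {set G}) ?cards2 ?n21' //.
    apply/setP => y; rewrite [LHS]in_set adjE adj2 eqxx (eq_sym s2 s1) (negPf s12) in_set2.
    by rewrite orbF.
  by rewrite dl // (stub_middle stubs) // middleP x1 x2 xs1.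
have stemP (x : G) : pred1 s1 x || pred1 s2 x ->
    exists l : G, [/\ leaf l, adj x l & ~~ (pred1 s1 l || pred1 s2 l)].
  by move=> /orP[] /eqP->; [exists l1|exists l2]; split;
     rewrite /leaf ?d1 ?d2 // 1?adj_sym // /= negb_or ?n1 ?n12' ?n21' ?n2.
have EB : codom_poly bridge = pathp #|bridge| by rewrite codom_poly_stem_edges.
have [iso closedT] := @two_leaf_path bridge l1 l2 n12 (etrans (dl l1 n1 n12') d1)
   (etrans (dl l2 n21' n2) d2) dA EB.
split=> //; have cU : @nbr_closed bridge (~: middle l1 s1 l2 s2).
  apply: nbr_closedC => x y xM xy.
  have : (x : G) \in middle l1 s1 l2 s2 := xM.
  rewrite middleP => /and4P[x1 x2 x3 x4].
  move: xy; rewrite adjE (negPf x2) (negPf x4) !orbF => xy.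
  have : (y : G) \in middle l1 s1 l2 s2; last by [].
  rewrite middleP; apply/and4P; split.
  - by apply: contraTneq xy => ->; rewrite adj_sym (stub_adj_leaf1 stubs).
  - by apply: contraTneq xy => ->; rewrite adj_sym adj1.
  - by apply: contraTneq xy => ->; rewrite adj_sym (stub_adj_leaf2 stubs).
  by apply: contraTneq xy => ->; rewrite adj_sym adj2.
have lU : l1 \in ~: middle l1 s1 l2 s2 by rewrite in_setC middleP eqxx.
have := closedT _ cU lU; rewrite -[RHS]setC0 => /setC_inj M0.
by rewrite -card_stub_middle M0 cards0.
Qed.

Lemma no_middle_nbr_2P2 : N1 = set0 -> N2 = set0 -> #|G| = 4 ->
  isomorphic G (dunion (path_graph 2) (path_graph 2)).
Proof.
move=> N10 N20 n4; have [n12 n1 n2 n12' n21'] := pair_neq d1 d2 a1 a2 ne.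
have adj1 y : @adj G s1 y = (y == l1) by rewrite (stub_adj_stem1 stubs y ns) -/N1 N10 inE orbF.
have adj2 y : @adj G s2 y = (y == l2) by rewrite stub_adj_stem2 N20 inE orbF.
apply: isomorphic_sym.
pose f (x : dunion (path_graph 2) (path_graph 2)) : G := match x with
  | inl i => if i == ord0 then l1 else s1 | inr i => if i == ord0 then l2 else s2 end.
have E := (negPf n12, negPf n1, negPf n2, negPf n12', negPf n21', negPf s12).
exists f.
  apply: inj_card_bij; last by rewrite card_sum !card_ord n4.
  move=> [[[|[|//]] i]|[[|[|//]] i]] [[[|[|//]] j]|[[|[|//]] j]] //= /eqP;
  rewrite ?E // 1?eq_sym ?E // => _; congr (_ _); exact: val_inj.
by move=> [[[|[|//]] i]|[[|[|//]] i]] [[[|[|//]] j]|[[|[|//]] j]];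
  rewrite /= ?(stub_adj_leaf1 stubs) ?(stub_adj_leaf2 stubs) ?adj1 ?adj2 ?eqxx ?E // 1?eq_sym ?E.
Qed.

(** Removing l1, l2 and s2 leaves a 2-regular graph with s1 on one of its cycles; l1 turns this
    cycle into F, and l2, s2 form K_2. The positions of s1 and s2 are recorded because the edge
    added in [H_graph] joins exactly these two vertices. *)
Lemma loop_decomposition : #|N1| = 2 -> N2 = set0 ->
  exists c (Z : sgraph)
    (f : dunion (dunion (F_graph c.+3) (complete_graph 2)) Z -> G),
  [/\ two_regular Z, bijective f, forall x y, adj (f x) (f y) = adj x y,
      forall z, (f (inl z) == s1) = if z is inl (inl x) then x == 0 :> nat else false &
      forall z, (f (inl z) == s2) = if z is inr y then y == 0 :> nat else false].
Proof.
move=> c1 N20; have [n12 n1 n2 n12' n21'] := pair_neq d1 d2 a1 a2 ne.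
have adj1 y : adj s1 y = (y == l1) || (y \in N1) by apply: (stub_adj_stem1 stubs y ns).
have adj2 y : adj s2 y = (y == l2) by rewrite stub_adj_stem2 N20 inE orbF.
pose U : {set G} := ~: [set l1; l2; s2].
have UP u : (u \in U) = [&& u != l1, u != l2 & u != s2].
  by rewrite /U !inE !negb_or -andbA.
have Ul1 u : adj u l1 = (u == s1) by rewrite adj_sym (stub_adj_leaf1 stubs).
have Ul2 u : u \in U -> adj u l2 = false.
  by rewrite UP adj_sym (stub_adj_leaf2 stubs) => /and3P[_ _ /negPf].
have Us2 u : u \in U -> adj u s2 = false.
  by rewrite UP adj_sym adj2 => /and3P[_ /negPf].
have regU : two_regular (induced U).
  move=> x; have xU := valP x; have [x1 x2 x3] := and3P (etrans (esym (UP _)) xU).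
  have -> : degree x = #|[set y in U | adj (val x) y]|.
    rewrite /degree -(card_imset _ val_inj); apply: eq_card => y.
    rewrite in_set; apply/imsetP/andP => [[z]|[yU xy]].
      by rewrite inE => xz ->; split; [apply: valP|].
    by exists (Sub y yU); rewrite ?inE.
  have [xs|xs] := eqVneq (val x) s1.
    rewrite xs -c1; apply: eq_card => y; rewrite in_set adj1 UP.
    have [->|yl1] /= := eqVneq y l1; first by rewrite (negPf leaf1_notin).
    rewrite andb_idl // in_set middleP => /andP[/and4P[_ _ -> ->]] //.
  rewrite -(stub_middle stubs (x := val x)); last by rewrite middleP x1 xs x2 x3.
  apply: eq_card => y; rewrite [LHS]in_set [RHS]in_set andb_idl // UP => xy.
  apply/and3P; split; apply: contraTneq xy => ->.
  - by rewrite Ul1.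
  - by rewrite Ul2.
  by rewrite Us2.
have s1U : s1 \in U by rewrite UP eq_sym n1 eq_sym n21' s12.
have [c [Z [g [regZ bg adjg gs]]]] := cycle_component (Sub s1 s1U : induced U) regU.
have gI := bij_inj bg.
pose f (z : dunion (dunion (F_graph c.+3) (complete_graph 2)) Z) : G :=
  match z with
  | inl (inl (inl x)) => val (g (inl x))
  | inl (inl (inr _)) => l1
  | inl (inr y) => if y == 0 :> nat then s2 else l2
  | inr w => val (g (inr w))
  end.
have gU z : [&& val (g z) != l1, val (g z) != l2 & val (g z) != s2].
  by rewrite -UP; apply: valP.
have gl1 z : (val (g z) == l1) = false by case/and3P: (gU z) => /negPf.
have gl2 z : (val (g z) == l2) = false by case/and3P: (gU z) => _ /negPf.
have gs2 z : (val (g z) == s2) = false by case/and3P: (gU z) => _ _ /negPf.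
have gs1 x : (val (g (inl x)) == s1) = (x == 0 :> nat) by rewrite -gs -val_eqE.
have gs1' w : (val (g (inr w)) == s1) = false.
  apply/negP => /eqP E; have /eqP : (g (inl ord0) == Sub s1 s1U) by rewrite gs.
  have -> : Sub s1 s1U = g (inr w) by apply: val_inj.
  by move/gI.
have gUl2 z : adj (val (g z)) l2 = false by apply: Ul2; apply: valP.
have gUs2 z : adj (val (g z)) s2 = false by apply: Us2; apply: valP.
have F (a b : G) : a != b -> (b == a) = false by rewrite eq_sym => /negPf.
have E := (negPf n12, negPf n1, negPf n2, negPf n12', negPf n21', negPf s12,
  F _ _ n12, F _ _ n1, F _ _ n2, F _ _ n12', F _ _ n21', F _ _ s12).
have adjval a b : adj (val (g a)) (val (g b)) = adj a b by rewrite -adjg.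
exists c, Z, f; split=> //.
- apply: inj_card_bij.
    move=> [[[x|x]|x]|x] [[[y|y]|y]|y] //= /eqP.
    + by rewrite val_eqE => /eqP/gI[->].
    + by rewrite gl1.
    + by case: ifP; rewrite ?gs2 ?gl2.
    + by rewrite val_eqE => /eqP/gI.
    + by rewrite eq_sym gl1.
    + by move=> _; rewrite (ord1 x) (ord1 y).
    + by case: ifP; rewrite ?E.
    + by rewrite eq_sym gl1.
    + by case: ifP => _; rewrite eq_sym ?gs2 ?gl2.
    + by case: ifP; rewrite ?E.
    + case: x y => [[|[|//]] i] [[|[|//]] j] //=; rewrite ?E //;
      by move=> _; congr (inl (inr _)); apply: val_inj.
    + by case: ifP => _; rewrite eq_sym ?gs2 ?gl2.
    + by rewrite val_eqE => /eqP/gI.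
    + by rewrite gl1.
    + by case: ifP; rewrite ?gs2 ?gl2.
    + by rewrite val_eqE => /eqP/gI[->].
  have cU := bij_eq_card bg; rewrite card_induced card_sum card_ord in cU.
  have := cardsC U; rewrite -cU /U setCK.
  have -> : #|[set l1; l2; s2]| = 3.
    by rewrite setUC cardsU1 cards2 !inE !E.
  by move=> <-; rewrite !card_sum !card_ord; lia.
- move=> x y; case: x => [[[x|x]|x]|x]; case: y => [[[y|y]|y]|y]; rewrite /= /add_edges_adj /=.
  + by rewrite adjval /= !andbF orbF.
  + by rewrite Ul1 gs1 andbT orbF.
  + by case: ifP => _; rewrite ?gUs2 ?gUl2.
  + by rewrite adjval.
  + by rewrite adj_sym Ul1 gs1.
  + by rewrite adj_irr (ord1 x) (ord1 y).
  + by case: ifP => _; rewrite (stub_adj_leaf1 stubs) ?E.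
  + by rewrite adj_sym Ul1 gs1'.
  + by case: ifP => _; rewrite adj_sym ?gUs2 ?gUl2.
  + by case: ifP => _; rewrite adj_sym (stub_adj_leaf1 stubs) ?E.
  + case: x y => [[|[|//]] i] [[|[|//]] j]; rewrite /complete_adj -?val_eqE /= ?adj_irr ?a2 //;
    by rewrite adj_sym a2.
  + by case: ifP => _; rewrite adj_sym ?gUs2 ?gUl2.
  + by rewrite adjval.
  + by rewrite Ul1 gs1'.
  + by case: ifP => _; rewrite ?gUs2 ?gUl2.
  + by rewrite adjval.
- move=> [[x|x]|x] /=; rewrite ?gs1 ?E //.
  by case: ifP; rewrite ?E.
move=> [[x|x]|x] /=; rewrite ?gs2 ?E //.
by case: ifP; rewrite ?eqxx ?E.
Qed.

(** Cycle lengths 3 and at least 6 are excluded by [Fp3_cyclep_neq] and [Fp_cyclep_neq]. For 4 and 5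
    the union with K_2 has the polynomial of P_7 or P_8, so [pathp_cyclep_eq] rules out further
    cycles. *)
Lemma loop_case : #|N1| = 2 -> N2 = set0 ->
  exists i (f : dunion (F_graph i) (complete_graph 2) -> G),
  [/\ i = 4 \/ i = 5, #|G| = (i + 3)%N, bijective f, forall x y, adj (f x) (f y) = adj x y &
    (forall z, (f z == s1) = if z is inl (inl x) then x == 0 :> nat else false) /\
    (forall z, (f z == s2) = if z is inr y then y == 0 :> nat else false)].
Proof.
move=> c1 N20; have [c [Z [f [regZ bf adjf fs1 fs2]]]] := loop_decomposition c1 N20.
have iso : isomorphic (dunion (dunion (F_graph c.+3) (complete_graph 2)) Z) G by exists f.
have cG := isomorphic_card iso; rewrite !card_sum !card_ord in cG.
have [cs [cs3 Scs Ecs]] := two_regular_codom_poly regZ.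
have := isomorphic_codom_poly iso.
rewrite !codom_poly_dunion codom_poly_K2 codom_poly_F_graph // Ecs EG.
have -> : #|G| = (c.+3 + 3 + sumn cs)%N by rewrite -cG Scs; lia.
case: c f bf adjf fs1 fs2 iso cG => [|[|[|c]]] f bf adjf fs1 fs2 iso cG EF.
- by case: (Fp3_cyclep_neq cs3 EF).
- rewrite Fp4 in EF; have cs0 := pathp_cyclep_eq (isT : 2 <= 7)%N cs3 EF.
  rewrite cs0 /= in Scs; exists 4, (f \o inl); split=> //; first by left.
  + by rewrite cs0.
  + apply: inj_card_bij; first by move=> x y /= /(bij_inj bf)[].
    by rewrite -cG -Scs !card_sum !card_ord.
  by move=> x y /=; rewrite adjf.
- rewrite Fp5 in EF; have cs0 := pathp_cyclep_eq (isT : 2 <= 8)%N cs3 EF.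
  rewrite cs0 /= in Scs; exists 5, (f \o inl); split=> //; first by right.
  + by rewrite cs0.
  + apply: inj_card_bij; first by move=> x y /= /(bij_inj bf)[].
    by rewrite -cG -Scs !card_sum !card_ord.
  by move=> x y /=; rewrite adjf.
by case: (@Fp_cyclep_neq c.+4.+2 cs isT cs3 EF).
Qed.
End Cases.

(** * The classification *)

Section Final.

Lemma F_leaf (c : nat) : degree (inr ord0 : F_graph c.+3) = 1%N.
Proof.
rewrite /degree (_ : [set u | _] = [set inl ord0]) ?cards1 //.
apply/setP => -[u|u]; rewrite in_set in_set1 /= /add_edges_adj /=.
  by apply/eqP/eqP => [u0|[->]//]; congr inl; apply: val_inj.
by rewrite (ord1 u) eqxx.
Qed.

Lemma F_stem (c : nat) (x : F_graph c.+3) :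
  stem x = if x is inl y then y == 0 :> nat else false.
Proof.
have leaf_inr : leaf (inr ord0 : F_graph c.+3) by rewrite /leaf F_leaf.
have leaf_inl (y : 'I_c.+3) : leaf (inl y : F_graph c.+3) = false.
  apply/negbTE; rewrite /leaf neq_ltn; apply/orP; right.
  have S1 (z : 'I_c.+3) : ordS z != z.
    rewrite -val_eqE /=; have [->|zc] := eqVneq (z : nat) c.+2; first by rewrite modnn.
    by rewrite modn_small; have := ltn_ord z; lia.
  have S2 : ordS y != ord_pred y.
    apply/eqP => /(congr1 (@ordS _)); rewrite ord_predK => /(congr1 val) /=.
    have [->|yc] := eqVneq (y : nat) c.+2; first by rewrite modnn modn_small.
    rewrite (@modn_small y.+1); last by have := ltn_ord y; lia.
    have [->|yc1] := eqVneq (y : nat) c.+1; first by rewrite modnn.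
    by rewrite modn_small; have := ltn_ord y; lia.
  have c2 : #|[set inl (ordS y); inl (ord_pred y)] : {set F_graph c.+3}| = 2.
    by rewrite cards2 (_ : inl _ != inl _) //; apply: contra S2 => /eqP[->].
  rewrite -{1}c2; apply/subset_leq_card/subsetP => u; rewrite !inE.
  move=> /orP[] /eqP->; rewrite /= /add_edges_adj /= /cycle_adj.
    by rewrite eq_sym S1 eqxx.
  have := S1 (ord_pred y); rewrite ord_predK => ->.
  by rewrite eqxx orbT.
have leafE (u : F_graph c.+3) : leaf u = (u == inr ord0).
  by case: u => u; rewrite ?leaf_inl // (ord1 u) leaf_inr eqxx.
apply/existsP/idP => [[u /andP[]]|].
  by rewrite leafE => + /eqP uE; rewrite uE; case: x => x; rewrite /= /add_edges_adj //= ?(ord1 x) ?andbT ?orbF.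
case: x => // x x0; exists (inr ord0); rewrite leafE eqxx andbT.
by rewrite /= /add_edges_adj /= x0.
Qed.

(** A leaf that is also a stem would lie in a K_2 component. This supplies the hypothesis of
    [codom_poly_stem_edges] for [tilde_path]. *)
Lemma path_stem_leaf (n : nat) (x : path_graph n) : (3 <= n)%N -> stem x ->
  exists l, [/\ leaf l, adj x l & ~~ stem l].
Proof.
move=> n3 /existsP[u /andP[xu lu]]; exists u; split=> //.
apply/existsP => -[w /andP[uw lw]].
have wx : w = x.
  apply/eqP; apply: contraTT lu => wx; rewrite /leaf neq_ltn; apply/orP; right.
  have -> : 2 = #|[set w; x]| by rewrite cards2 wx.
  apply/subset_leq_card/subsetP => y; rewrite !inE => /orP[] /eqP-> //.
  by rewrite adj_sym.
rewrite {}wx {w uw} in lw.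
wlog xu1 : x u xu lu lw / (x.+1 == u :> nat) => [H|].
  have := xu; rewrite /= /path_adj => /orP[]; first exact: H.
  by apply: (H u x); rewrite // adj_sym.
have deg2 (y a b : path_graph n) : adj y a -> adj y b -> a != b -> leaf y -> False.
  move=> ya yb ab; rewrite /leaf => /eqP dy; have : (#|[set a; b]| <= degree y)%N.
    by apply/subset_leq_card/subsetP => z; rewrite !inE => /orP[] /eqP->.
  by rewrite cards2 ab dy.
have un := ltn_ord u.
case x0 : (x : nat) => [|k].
  have u2 : (2 < n)%N by [].
  apply: (deg2 u x (Ordinal u2)) => //.
  - by rewrite adj_sym.
  - by rewrite /= /path_adj /= -(eqP xu1) x0.
  by rewrite -val_eqE /= x0.
have kn : (k < n)%N by have := ltn_ord x; lia.
apply: (deg2 x (Ordinal kn) u) => //.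
  by rewrite /= /path_adj /= x0 eqxx orbT.
by rewrite -val_eqE /= -(eqP xu1) x0; lia.
Qed.

Lemma card_path_graph (n : nat) : #|path_graph n| = n.
Proof. exact: card_ord. Qed.

Lemma codom_poly_tilde (n : nat) : (3 <= n)%N ->
  codom_poly (tilde_path n) = codom_poly (path_graph n).
Proof.
move=> n3; apply: codom_poly_stem_edges => x; rewrite orbb => sx.
by have [l [ll xl nl]] := path_stem_leaf n3 sx; exists l; rewrite orbb.
Qed.

Lemma codom_poly_F_K2 (i : nat) : i = 4 \/ i = 5 ->
  codom_poly (dunion (F_graph i) (complete_graph 2)) = pathp (i + 3).
Proof.
by move=> [->|->]; rewrite codom_poly_dunion codom_poly_K2 codom_poly_F_graph // ?Fp4 ?Fp5.
Qed.

Lemma degree_dunion_inl (G H : sgraph) (x : G) :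
  @degree (dunion G H) (inl x) = degree x.
Proof.
have inlI : injective (fun y : G => inl y : dunion G H) by move=> a b [].
rewrite /degree -[RHS](card_imset _ inlI); apply: eq_card => -[y|y].
  by rewrite (mem_imset _ _ inlI) !in_set.
by rewrite in_set; apply/esym/negbTE/imsetP => -[].
Qed.

Lemma codom_poly_H (i : nat) : (3 <= i)%N ->
  codom_poly (H_graph i) = codom_poly (dunion (F_graph i) (complete_graph 2)).
Proof.
move=> i3; have -> : i = (i - 3).+3 by lia.
move: (i - 3) => c {i i3}; apply: codom_poly_stem_edges.
move=> [[x|x]|y]; rewrite ?F_stem ?orbF //=.
  move=> x0; exists (inl (inr ord0)); rewrite /= F_stem; split=> //; last first.
    by rewrite /= /add_edges_adj /= x0.
  by rewrite /leaf degree_dunion_inl F_leaf.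
move=> y0; exists (inr (Ordinal (isT : 1 < 2)%N)); split=> //; last first.
  by rewrite /= /complete_adj -val_eqE /= (eqP y0).
rewrite /leaf /degree (_ : [set u | _] = [set inr ord0]) ?cards1 //.
by apply/setP => -[u|[[|[|//]] u]]; rewrite !inE.
Qed.

Lemma D_equiv_path (G : sgraph) (n : nat) : (2 <= n)%N ->
  D_equiv G (path_graph n) <-> #|G| = n /\ codom_poly G = pathp n.
Proof.
by move=> n2; rewrite -codom_poly_path_graph //; split=> [/D_equivP|GE];
   [rewrite card_path_graph|apply/D_equivP; rewrite card_path_graph].
Qed.

(** All outcomes for n >= 3 at once, each with its range of n, so that one classification serves
    every case of the theorem. *)
Definition path_mates (n : nat) (G : sgraph) : Prop :=
  [\/ isomorphic G (path_graph n),
      (5 <= n)%N /\ isomorphic G (tilde_path n),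
      n = 4 /\ isomorphic G (dunion (path_graph 2) (path_graph 2)) |
      (n = 7 \/ n = 8) /\
      (isomorphic G (dunion (F_graph (n - 3)) (complete_graph 2)) \/
       isomorphic G (H_graph (n - 3)))].

Lemma path_mates_D_equiv (n : nat) (G : sgraph) : (2 <= n)%N ->
  path_mates n G -> D_equiv G (path_graph n).
Proof.
move=> n2 mates; apply/(D_equiv_path _ n2).
have via (H : sgraph) : #|H| = n -> codom_poly H = pathp n -> isomorphic G H ->
    #|G| = n /\ codom_poly G = pathp n.
  by move=> cH EH iso; rewrite (isomorphic_card iso) (isomorphic_codom_poly iso).
case: mates => [||[n4]|[n78 [|]]].
- by apply: via; rewrite ?card_path_graph ?codom_poly_path_graph.
- by move=> [n5]; apply: via; rewrite ?card_ord // codom_poly_tilde ?codom_poly_path_graph //; lia.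
- apply: via; first by rewrite card_sum !card_ord n4.
  by rewrite codom_poly_dunion !codom_poly_path_graph // n4 /pathp /=; ring.
- have i45 : n - 3 = 4 \/ n - 3 = 5 by lia.
  apply: via; first by rewrite !card_sum !card_ord; lia.
  by rewrite codom_poly_F_K2 //; congr pathp; lia.
have i45 : n - 3 = 4 \/ n - 3 = 5 by lia.
apply: via; first by rewrite !card_sum !card_ord; lia.
by rewrite codom_poly_H ?codom_poly_F_K2 //; [congr pathp|]; lia.
Qed.

Lemma stem_two_stubs (G : sgraph) (l1 s1 l2 s2 x : G) :
  two_stubs l1 s1 l2 s2 -> (forall x : G, x != l1 -> x != l2 -> degree x = 2%N) ->
  stem x = (x == s1) || (x == s2).
Proof.
move=> st dA; have leafE (u : G) : leaf u = (u == l1) || (u == l2).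
  rewrite /leaf; have [->|u1] := eqVneq u l1; first by rewrite (stub_deg1 st).
  by have [->|u2] := eqVneq u l2; [rewrite (stub_deg2 st)|rewrite dA].
apply/existsP/idP => [[u /andP[]]|].
  rewrite leafE adj_sym => + /orP[] /eqP uE; rewrite uE.
    by rewrite (stub_adj_leaf1 st) => ->.
  by rewrite (stub_adj_leaf2 st) => ->; rewrite orbT.
by move=> /orP[] /eqP->; [exists l1|exists l2]; rewrite leafE eqxx ?orbT adj_sym;
   [rewrite (stub_adj1 st)|rewrite (stub_adj2 st)].
Qed.

(** G has non-adjacent stems; H is the graph to be classified, which may have the edge between the
    stems in addition. *)
Lemma one_middle_nbr (G H : sgraph) (l1 s1 l2 s2 : G) :
  two_stubs l1 s1 l2 s2 -> ~~ adj s1 s2 -> codom_poly G = pathp #|G| ->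
  #|middle_nbr l1 s1 l2 s2 s1| = 1%N -> #|middle_nbr l1 s1 l2 s2 s2| = 1%N ->
  isomorphic H G \/ isomorphic H (add_edges (pred1 s1) (pred1 s2)) ->
  path_mates #|G| H.
Proof.
move=> st ns EG c1 c2 HG.
have [n12 n1 n2 n12' n21'] := pair_neq (stub_deg1 st) (stub_deg2 st)
  (stub_adj1 st) (stub_adj2 st) (stub_neq st).
have dA := stub_two_leaf st ns c1 c2.
have [[f bf adjf] _] := two_leaf_path n12 (stub_deg1 st) (stub_deg2 st) dA EG.
case: HG => HG; first by constructor 1; apply: isomorphic_trans HG _; exists f.
constructor 2; split.
  rewrite -(card_stub_middle st) addn4 !ltnS.
  have /card_gt0P[v] : (0 < #|middle_nbr l1 s1 l2 s2 s1|)%N by rewrite c1.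
  by rewrite in_set => /andP[vM _]; apply/card_gt0P; exists v.
apply: isomorphic_trans HG _.
apply: isomorphic_trans (_ : isomorphic _ (add_edges (@stem G) (@stem G))) _; last first.
  by apply: (isomorphic_add_edges bf adjf) => x; apply: stem_iso.
exists id => [|x y]; first by exists id.
rewrite /= /add_edges_adj; congr (_ || _); rewrite !(stem_two_stubs _ st dA) /=.
have [->|xy] := eqVneq x y; rewrite ?eqxx //=.
have [xs1|xs1] := eqVneq x s1; have [xs2|xs2] := eqVneq x s2;
have [ys1|ys1] := eqVneq y s1; have [ys2|ys2] := eqVneq y s2; rewrite ?orbT ?andbT //=;
by move: xy; rewrite ?xs1 ?xs2 ?ys1 ?ys2 ?eqxx.
Qed.

Lemma add_edges_swap (G : sgraph) (p q : pred G) :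
  isomorphic (add_edges p q) (add_edges q p).
Proof.
by exists id => [|x y]; [exists id|rewrite /= /add_edges_adj [q x && _ || _]orbC].
Qed.

Lemma two_middle_nbrs (G H : sgraph) (l1 s1 l2 s2 : G) :
  two_stubs l1 s1 l2 s2 -> ~~ adj s1 s2 -> codom_poly G = pathp #|G| ->
  #|middle_nbr l1 s1 l2 s2 s1| = 2%N -> middle_nbr l1 s1 l2 s2 s2 = set0 ->
  isomorphic H G \/ isomorphic H (add_edges (pred1 s1) (pred1 s2)) ->
  path_mates #|G| H.
Proof.
move=> st ns EG c1 c2 HG.
have [i [f [i45 -> bf adjf [fs1 fs2]]]] := loop_case st ns EG c1 c2.
have i3 : (3 <= i)%N by lia.
constructor 4; rewrite addnK; split; first by lia.
case: HG => HG; [left|right]; apply: isomorphic_trans HG _; apply: isomorphic_sym.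
  by exists f.
have iE : i = (i - 3).+3 by lia.
apply: (isomorphic_add_edges bf adjf) => z.
  rewrite [LHS]fs1; case: z => // x; move: x; rewrite iE => x.
  by rewrite F_stem.
by rewrite [LHS]fs2; case: z.
Qed.

Lemma two_stubs_mates (G : sgraph) (l1 s1 l2 s2 : G) :
  two_stubs l1 s1 l2 s2 -> codom_poly G = pathp #|G| ->
  (#|middle_nbr l1 s1 l2 s2 s1| + #|middle_nbr l1 s1 l2 s2 s2| <= 2)%N ->
  ~~ odd (#|middle_nbr l1 s1 l2 s2 s1| + #|middle_nbr l1 s1 l2 s2 s2|) ->
  path_mates #|G| G.
Proof.
move=> st EG.
suff main (G' : sgraph) (l1' s1' l2' s2' : G') :
  two_stubs l1' s1' l2' s2' -> ~~ adj s1' s2' -> codom_poly G' = pathp #|G'| ->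
  isomorphic G G' \/ isomorphic G (add_edges (pred1 s1') (pred1 s2')) ->
  (#|middle_nbr l1' s1' l2' s2' s1'| + #|middle_nbr l1' s1' l2' s2' s2'| <= 2)%N ->
  ~~ odd (#|middle_nbr l1' s1' l2' s2' s1'| + #|middle_nbr l1' s1' l2' s2' s2'|) ->
  path_mates #|G'| G.
  have [ab|nab] := boolP (adj s1 s2); last first.
    by apply: (main G) => //; left; apply: isomorphic_refl.
  have [st' E' <- <-] := two_stubs_del st ab.
  apply: (main (del_edge s1 s2)) => //; first by rewrite /= /del_edge_adj !eqxx andbF.
    by rewrite E' EG.
  by right; apply/isomorphic_sym/add_del_edge.
move=> {st EG l1 s1 l2 s2} st ns EG HG.
set N1 := middle_nbr _ _ _ _ s1'; set N2 := middle_nbr _ _ _ _ s2'.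
(* An even total of at most 2 leaves the pairs (0,0), (0,2), (1,1) and (2,0). *)
case c1 : #|N1| => [|[|[|//]]]; case c2 : #|N2| => [|[|[|//]]] // _ _.
- have N10 : N1 = set0 by apply: cards0_eq.
  have N20 : N2 = set0 by apply: cards0_eq.
  have [iso n4] := no_middle_nbr st ns EG N10 N20.
  case: HG => HG; last by constructor 1; apply: isomorphic_trans HG iso.
  constructor 3; split=> //; apply: isomorphic_trans HG _.
  exact: (no_middle_nbr_2P2 st ns N10 N20 n4).
- have N10 : N1 = set0 by apply: cards0_eq.
  have swap s : middle_nbr l2' s2' l1' s1' s = middle_nbr l1' s1' l2' s2' s.
    by rewrite /middle_nbr middle_swap.
  apply: (@two_middle_nbrs G' G l2' s2' l1' s1'); rewrite ?swap //.
  + exact: two_stubs_swap.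
  + by rewrite adj_sym.
  case: HG => HG; [by left|right].
  exact: isomorphic_trans HG (add_edges_swap _ _).
- exact: (one_middle_nbr st ns EG c1 c2 HG).
have N20 : N2 = set0 by apply: cards0_eq.
exact: (two_middle_nbrs st ns EG c1 N20 HG).
Qed.

Lemma path_mates_of_codom_poly (G : sgraph) (n : nat) : (3 <= n)%N ->
  #|G| = n -> codom_poly G = pathp n -> path_mates n G.
Proof.
move=> n3 cG EG.
have [k1 k2 k3 k4] := num_codom_path cG n3 EG.
have b1 : num_bad G 1 = 0%N by have := num_bad_codom G 1; rewrite cG bin1; lia.
have b2 : num_bad G 2 = 2 by have := num_bad_codom G 2; rewrite cG; lia.
have b3 : (num_bad G 3 = 3 * #|G| - 8)%N by have := num_bad_codom G 3; rewrite cG; lia.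
have b4 : (5 <= n)%N ->
    (num_bad G 4 = 2 * 'C(#|G| - 2, 2) + (#|G| - 4) * (#|G| - 4) - 2)%N.
  by move=> n5; have := num_bad_codom G 4; have := k4 n5; rewrite cG; lia.
have [l1 [s1 [l2 [s2 [[d1 d2 a1 a2 ne] leaves]]]]] := leaf_pairs b1 b2.
have deg_gt0 (v : G) := degree_gt0 v b1.
have [deg2 inj] := middle_deg2 d1 d2 a1 a2 ne leaves deg_gt0 b3.
have noC4 (T : {set G}) : T \subset middle l1 s1 l2 s2 -> #|T| = 4 -> ~ nbr_closed T.
  move=> /subsetP TM; apply: no_C4_component EG _; first by lia.
  by move=> x /TM; apply: deg2.
have M := card_middle d1 d2 a1 a2 ne; rewrite cG in M.
have [n12 n1 n2 n12' n21'] := pair_neq d1 d2 a1 a2 ne.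
have count (s : G) : (\sum_(v in middle l1 s1 l2 s2) (adj v s : nat)
    = #|middle_nbr l1 s1 l2 s2 s|)%N.
  rewrite -sum1_card [RHS](eq_bigl (fun v => (v \in middle l1 s1 l2 s2) && adj v s)).
    by rewrite big_mkcondr; apply: eq_bigr => v _; case: (adj v s).
  by move=> v; rewrite in_set.
have nbrs := middle_nbrs d1 d2 a1 a2 deg2.
set A := middle l1 s1 l2 s2 in M deg2 inj noC4 count nbrs.
have bound : (\sum_(v in A) (adj v s1 : nat)
    + (s1 != s2) * \sum_(v in A) (adj v s2 : nat) <= 2 * (s1 != s2))%N.
  (* The count of four-sets is available from n = 5 on. For n <= 4 a middle vertex could exist only
     beside a common stem, which would be its only possible neighbour, although it has degree 2. *)
  have [n5|n5] := leqP 5 n.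
    by apply: stem_middle_nbrs; rewrite ?b4 ?cG.
  have [A0|A1] := posnP #|A|.
    by rewrite (cards0_eq A0) !big_set0 muln0.
  have [v vA] : exists v, v \in A by apply/card_gt0P.
  have := nbrs v vA; move: M A1; case: (s1 != s2); first by move=> /=; lia.
  rewrite addn0 mul0n addn0 => M A1.
  have : (#|[set w in A | adj v w]| < #|A|)%N.
    apply: proper_card; apply/properP; split; last by exists v; rewrite // in_set adj_irr andbF.
    by apply/subsetP => w; rewrite in_set => /andP[].
  by case: (adj v s1); lia.
(* A common stem has no middle neighbour by [bound], so its neighbours are the two leaves, and G has
   two leaves and otherwise degree 2. *)
have [s12|s12] := eqVneq s1 s2.
  rewrite s12 eqxx mul0n muln0 addn0 leqn0 sum_nat_eq0 in bound.
  have ds : degree s1 = 2%N.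
    rewrite /degree (_ : [set y | adj s1 y] = [set l1; l2]) ?cards2 ?n12 //.
    apply/setP => y; rewrite in_set in_set2.
    have [->|y1] := eqVneq y l1; first by rewrite adj_sym a1.
    have [->|y2] /= := eqVneq y l2; first by rewrite adj_sym s12 a2.
    have [->|ys] := eqVneq y s1; first by rewrite adj_irr.
    have yA : y \in A by rewrite middleP y1 ys y2 -s12.
    by have /forallP/(_ y) := bound; rewrite yA adj_sym s12 eqb0 => /negbTE.
  have [x xl1 xl2||iso _] := @two_leaf_path G l1 l2 n12 d1 d2.
  - have [->//|xs] := eqVneq x s1.
    by apply: deg2; rewrite middleP xl1 xs xl2 -s12.
  - by rewrite cG.
  by constructor 1; rewrite -cG.
have st : two_stubs l1 s1 l2 s2 by split.
rewrite -cG; apply: (two_stubs_mates st); first by rewrite cG.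
  by move: bound; rewrite s12 mul1n muln1 !count.
(* Parity of the degree sum of the middle vertices. *)
have : (\sum_(v in A) (#|[set w in A | adj v w]| + (adj v s1 + (s1 != s2) * adj v s2))
        = 2 * #|A|)%N.
  by rewrite (eq_bigr (fun=> 2)) ?sum_nat_const ?(mulnC 2) // => v; apply: nbrs.
rewrite big_split big_split /= s12; under [X in (_ + (_ + X))%N]eq_bigr do rewrite mul1n.
rewrite !count => /(congr1 odd).
by rewrite oddD (negPf (even_sum_nbrs A)) oddM /= => ->.
Qed.

Lemma path_mates_iff (G : sgraph) (n : nat) : (3 <= n)%N ->
  D_equiv G (path_graph n) <-> path_mates n G.
Proof.
move=> n3; have n2 : (2 <= n)%N by apply: ltnW.
split; last exact: path_mates_D_equiv.
by move=> /(D_equiv_path _ n2)[cG EG]; apply: path_mates_of_codom_poly.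
Qed.

Lemma D_equiv_path1 (G : sgraph) :
  D_equiv G (path_graph 1) -> isomorphic G (path_graph 1).
Proof.
move=> /D_equivP[]; rewrite card_path_graph => c1 _.
apply: isomorphic_sym; have /card_gt0P[x _] : (0 < #|G|)%N by rewrite c1.
exists (fun=> x).
  by apply: inj_card_bij; [move=> i j _; rewrite (ord1 i) (ord1 j)|rewrite c1 card_ord].
by move=> i j; rewrite (ord1 i) (ord1 j) !adj_irr.
Qed.

Lemma D_equiv_path2 (G : sgraph) :
  D_equiv G (path_graph 2) -> isomorphic G (path_graph 2).
Proof.
move=> /(D_equiv_path _ (leqnn 2))[c2 EG].
have b1 : num_bad G 1 = 0%N.
  have : ((num_codom G 1)%:R = 2 :> int)%R.
    rewrite -coef_codom_poly EG /pathp /= GRing.mulr1.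
    by rewrite !coefD coef1 coefX.
  by have := num_bad_codom G 1; rewrite c2 bin1; lia.
have /card_gt0P[x _] : (0 < #|G|)%N by rewrite c2.
have /card_gt0P[y] := degree_gt0 x b1; rewrite inE => xy.
have nxy : x != y by apply: contraTneq xy => ->; rewrite adj_irr.
apply: isomorphic_sym.
exists (fun i : 'I_2 => if i == ord0 then x else y).
  apply: inj_card_bij; last by rewrite c2 card_ord.
  have nyx : y != x by rewrite eq_sym.
  by move=> [[|[|//]] i] [[|[|//]] j] //= /eqP;
     rewrite ?(negPf nxy) ?(negPf nyx) // => _; apply: val_inj.
by move=> [[|[|//]] i] [[|[|//]] j]; rewrite /= ?adj_irr // ?xy // adj_sym xy.
Qed.
End Final.

Theorem theorem3p16 (n : nat) (n_gt0 : (0 < n)%N) :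
  [/\ (n <= 3)%N ->
        forall G : sgraph,
          D_equiv G (path_graph n) <-> isomorphic G (path_graph n),
      n = 4%N ->
        forall G : sgraph,
          D_equiv G (path_graph n) <->
          isomorphic G (path_graph 4) \/
          isomorphic G (dunion (path_graph 2) (path_graph 2)),
      n = 7%N \/ n = 8%N ->
        forall G : sgraph,
          D_equiv G (path_graph n) <->
          [\/ isomorphic G (path_graph n),
              isomorphic G (tilde_path n),
              isomorphic G (dunion (F_graph (n - 3)) (complete_graph 2)) |
              isomorphic G (H_graph (n - 3))]
    & [\/ n = 5%N, n = 6%N | (9 <= n)%N] ->
        forall G : sgraph,
          D_equiv G (path_graph n) <->
          isomorphic G (path_graph n) \/ isomorphic G (tilde_path n)].
Proof.
have back (G : sgraph) : isomorphic G (path_graph n) -> D_equiv G (path_graph n).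
  move=> iso; apply/D_equivP.
  by rewrite (isomorphic_card iso) (isomorphic_codom_poly iso).
split=> [n3 G|n4 G|n78 G|n9 G].
- split; last exact: back.
  case: n n_gt0 n3 {back} => [|[|[|[|//]]]] // _ _; first exact: D_equiv_path1.
    exact: D_equiv_path2.
  by move/(path_mates_iff _ (leqnn 3)) => [//|[]|[]|[[]]].
- rewrite n4; split=> [/(path_mates_iff _ (isT : 3 <= 4))|].
    by case=> [|[]|[_]|[[]]] //; [left|right].
  move=> H; apply/path_mates_iff => //; case: H => H; first by constructor 1.
  by constructor 3.
- have n3 : (3 <= n)%N by lia.
  split=> [/(path_mates_iff _ n3)|H].
    case=> [|[]|[n4]|[_ [|]]] // H; [constructor 1|constructor 2| |constructor 3|constructor 4] => //.
    by lia.
  apply/path_mates_iff => //; case: H => H; [constructor 1|constructor 2|constructor 4|constructor 4] => //.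
  + by split=> //; lia.
  + by split=> //; left.
  by split=> //; right.
have n3 : (3 <= n)%N by case: n9 => [->|->|] //; lia.
split=> [/(path_mates_iff _ n3)|H].
  case=> [|[]|[n4]|[n78]] // H; [left|right| |] => //; by case: n9; lia.
apply/path_mates_iff => //; case: H => H; [constructor 1|constructor 2] => //.
by split=> //; case: n9 => [->|->|] //; lia.
Qed.
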